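(* Let $N\ge2$, $\omega_1,\dots,\omega_N\in\mathbb{R}$, $\kappa>0$ and $\varepsilon\in(0,1]$ with $\kappa>(2+\varepsilon)\|\Omega\|_\infty$, where $\|\Omega\|_\infty=\max_i|\omega_i|$. For initial data $(\theta_i^0)$ let $(\theta_i(t))$ solve \[ \dot\theta_i=\omega_i-\frac{\kappa}{N}\sum_{j=1}^N(1+\cos\theta_j)\sin\theta_i,\qquad\theta_i(0)=\theta_i^0, \] with $R(t)=\frac1N\sum_j(1+\cos\theta_j(t))$, and let $m$ be the normalized Lebesgue measure on $[-\pi,\pi]^N$. Let $T_0=\frac{25}{\kappa N\varepsilon(5-\varepsilon)}\log\Big(\big(1+\frac2N\big)\big(\frac{2\sqrt5}{\sqrt{\pi\varepsilon}\,e^{1/2+\varepsilon^2/25}}\big)^N-\frac2N\Big)$. For each $T>0$, let $E_T$ be the set of $(\theta_i^0)\in[-\pi,\pi]^N$ such that: $R(t)\ge\frac1{\sqrt2}-\frac{3\varepsilon}{20}$ for all $t\ge T$; $\sup_{t\ge T}\theta_i(t)-\inf_{t\ge T}\theta_i(t)<2\pi$ for all $i$; and for every $i$ and every $t_0\ge T$ with $\cos\theta_i(t_0)\ge-\frac1{\sqrt2}$, one has $\cos\theta_i(t)\ge-\frac1{\sqrt2}$ for $t\ge t_0$ and $\cos\theta_i(t)\ge\frac1{\sqrt2}$ for $t\ge t_0+\frac{(2+\varepsilon)\pi}{\kappa-(2+\varepsilon)\|\Omega\|_\infty}$. Then \[ m(E_T)\ge\begin{cases}1-\frac{1}{N/2+1}\Big(\frac{\sqrt{\pi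 e\varepsilon}}{2\sqrt5}\Big)^N\Big(1-e^{-\frac{\kappa N\varepsilon(5-\varepsilon)T}{25}}\Big)-\exp\Big(-\frac{N\varepsilon^2}{25}-\frac{\kappa N\varepsilon(5-\varepsilon)T}{25}\Big),& T\le T_0,\\[2mm] 1-\Big(\frac{20}{\pi e\varepsilon}+\frac{4\kappa(5-\varepsilon)}{5\pi e}(T-T_0)\Big)^{-N/2},& T>T_0.\end{cases} \] If in addition $\kappa>8\|\Omega\|_\infty$, then for each $T>0$ \[ m\Big\{(\theta_i^0)\in[-\pi,\pi]^N:\sup_{t\ge T}\theta_i(t)-\inf_{t\ge T}\theta_i(t)<2\pi\ \forall i\Big\}\ge\begin{cases}1-\Big(e^{1/2}+\frac{3\kappa T}{\pi e}\Big)^{-N/2},&8\|\Omega\|_\infty<\kappa\le16\sqrt2\|\Omega\|_\infty,\\[1mm] 1-\Big(\frac4{\pi e}\big(\frac{\kappa}{2\sqrt2\|\Omega\|_\infty}\big)^{2/3}+\frac{3\kappa T}{\pi e}\Big)^{-N/2},&\kappa>16\sqrt2\|\Omega\|_\infty,\end{cases} \] where the probability is $1$ if $\|\Omega\|_\infty=0$. *)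

(* Defs.v *)
From HB Require Import structures.
From mathcomp Require Import all_boot all_order all_algebra.
From mathcomp Require Import all_classical all_reals all_analysis.
Set Implicit Arguments. Unset Strict Implicit. Unset Printing Implicit Defensive.
Import Order.TTheory GRing.Theory Num.Theory.
Import numFieldNormedType.Exports.
Local Open Scope classical_set_scope.
Local Open Scope ring_scope.

Section KuramotoDefs.
Variables (R : realType) (N : nat).

Definition normOmega (omega : 'I_N -> R) : R := \big[Num.max/0]_(i < N) `|omega i|.

Definition order_param (th : 'I_N -> R) : R :=
  N%:R^-1 * \sum_(j < N) (1 + cos (th j)).

Definition kuramoto_rhs (omega : 'I_N -> R) (kappa : R) (th : 'I_N -> R) (i : 'I_N) : R :=
  omega i - kappa / N%:R * \sum_(j < N) (1 + cos (th j)) * sin (th i).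

Definition is_solution (omega : 'I_N -> R) (kappa : R) (x : 'I_N -> R)
  (theta : R -> 'I_N -> R) : Prop :=
  theta 0 = x /\
  forall (i : 'I_N) (t : R),
    is_derive t 1 (fun s => theta s i) (kuramoto_rhs omega kappa (theta t) i).

Definition box (a b : 'I_N -> R) : set ('I_N -> R) :=
  [set x | forall i, a i <= x i < b i].
Definition box_vol (a b : 'I_N -> R) : R := \prod_(i < N) Num.max (b i - a i) 0.

Definition leb_outer (A : set ('I_N -> R)) : \bar R :=
  ereal_inf [set s | exists a b : nat -> 'I_N -> R,
     A `<=` \bigcup_k box (a k) (b k) /\
     s = (\sum_(0 <= k <oo) (box_vol (a k) (b k))%:E)%E].

Definition cube : set ('I_N -> R) := [set x | forall i, - pi <= x i <= pi].

(* normalized Lebesgue (inner) measure on [-pi,pi]^N of a subset E of the cube: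
   m(E) = 1 - m^*([-pi,pi]^N \ E); it coincides with the normalized Lebesgue
   measure whenever E is Lebesgue measurable. *)
Definition norm_meas (E : set ('I_N -> R)) : \bar R :=
  (1 - ((2 * pi) ^- N)%:E * leb_outer (cube `\` E))%E.

Definition oscillation_from (f : R -> R) (T : R) : \bar R :=
  (ereal_sup [set (f t)%:E | t in [set t | (T <= t)%R]] -
   ereal_inf [set (f t)%:E | t in [set t | (T <= t)%R]])%E.

Definition good_set (omega : 'I_N -> R) (kappa eps T : R)
  (sol : ('I_N -> R) -> R -> 'I_N -> R) : set ('I_N -> R) :=
  [set x | cube x /\
    (forall t, T <= t -> order_param (sol x t) >= (Num.sqrt 2)^-1 - 3 * eps / 20) /\
    (forall i, (oscillation_from (fun t => sol x t i) T < (2 * pi)%:E)%E) /\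
    (forall i t0, T <= t0 -> cos (sol x t0 i) >= - (Num.sqrt 2)^-1 ->
       (forall t, t0 <= t -> cos (sol x t i) >= - (Num.sqrt 2)^-1) /\
       (forall t, t0 + (2 + eps) * pi / (kappa - (2 + eps) * normOmega omega) <= t ->
          cos (sol x t i) >= (Num.sqrt 2)^-1))].

Definition bounded_osc_set (T : R) (sol : ('I_N -> R) -> R -> 'I_N -> R) :
  set ('I_N -> R) :=
  [set x | cube x /\
    forall i, (oscillation_from (fun t => sol x t i) T < (2 * pi)%:E)%E].

End KuramotoDefs.

(* Main.v *)
(** The divergence of the vector field is at least [kappa N R (1 - R)], so the flow expands
    volume as long as [R] stays away from [0] and [1].  Let [b] be a threshold such that, once [R]
    exceeds [b - eta], the oscillators already in the basin of [0] stay there forever; the bad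
    initial data then have [R < b - eta] on the whole of [[0, T]].  Transporting a Lipschitz cutoff
    of this set by the flow gives a volume [V t] with
    [V' >= kappa N (1 - rho) (rho V - J rho)] for every [rho <= 1 - b], where [J rho] is the mean of
    [(rho - R)^+]; this mean, as well as [V T], is bounded by Chernoff estimates which factor over
    the coordinates.  Comparing backwards in time with explicit supersolutions (an exponential for
    fixed [rho], then a power when [rho] is proportional to [V^(2/N)]) bounds [V 0].

    No Jacobian of the flow is needed: means are taken over uniform grids, and one backward Euler
    step of the flow is split into [N] substitutions in a single variable, each exact up to
    [O(h^2 + 1/n)] by the fundamental theorem of calculus on Lipschitz test functions. *)

Require Import Defs.
From HB Require Import structures.
From mathcomp Require Import all_boot all_order all_algebra.
From mathcomp Require Import all_classical all_reals all_analysis.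
From mathcomp Require Import ring lra.
Import Order.TTheory GRing.Theory Num.Theory.
Import numFieldNormedType.Exports.
Local Open Scope classical_set_scope.
Local Open Scope ring_scope.

Set Implicit Arguments. Unset Strict Implicit.

(** * Trapping of oscillators *)

Section RealCalculus.
Context {R : realType}.
Implicit Types (f g y : R -> R) (a b c t s m x : R).

(** The volume is a limsup of grid means, so no time derivative is available. Its growth is a
    one-step inequality with error [C h^2]: the grid is refined at fixed [h], [C] is uniform in [t],
    [h] and [rho], and the comparison with supersolutions is itself discrete. It runs backwards
    because the a priori smallness of [V T] holds whatever [T] is, while growth makes [V 0] smaller
    still.

    Two Chernoff bounds are used. Near its mean [1], [R] obeys a Hoeffding bound [v = e^(-N d^2)],
    [d = eps/5]; near [0] it obeys [G(rho) = (pi e rho / 4)^(N/2)]. With [rho = eps/5] fixed, the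
    exponential phase takes the bound from [v] down to [G(rho)], and [T0] is exactly its duration.
    After that [rho] may shrink with the volume. The choice [G(rho) = V] makes the loss [J rho] at
    most the fraction [2/(N e)] of the gain [rho V], and leaves [V' >= const V^(1+2/N)], whence the
    power law.

    The strip of width [eta] below [b] leaves room for a Lipschitz cutoff that equals [1] on the bad
    set; such a majorant is all that an outer measure requires. *)

Lemma is_derive_continuous f x (df : R) : is_derive x 1 f df -> {for x, continuous f}.
Proof. by move=> [fx _]; apply/differentiable_continuous/derivable1_diffP. Qed.

Lemma is_derive_within f (df : R -> R) a b :
  (forall x, is_derive x 1 f (df x)) -> {within `[a, b], continuous f}.
Proof. by move=> fd; apply: derivable_within_continuous => x _; have [] := fd x. Qed.

Lemma mean_value f (df : R -> R) a b : (forall x, is_derive x 1 f (df x)) -> a <= b ->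
  exists2 c, a <= c <= b & f b - f a = df c * (b - a).
Proof.
move=> fd ab; have [|c] := @MVT_segment R f df a b ab (fun x _ => fd x).
  exact: is_derive_within fd.
by rewrite in_itv/= => cab ->; exists c.
Qed.

Lemma derive_nonneg_le f (df : R -> R) a b : (forall x, is_derive x 1 f (df x)) -> a <= b ->
  (forall x, a <= x <= b -> 0 <= df x) -> f a <= f b.
Proof.
move=> fd ab df0; have [c cab e] := mean_value fd ab.
by rewrite -subr_ge0 e mulr_ge0 ?df0 ?subr_ge0.
Qed.

Lemma is_derive_pos_right f x (df : R) : is_derive x 1 f df -> 0 < df ->
  exists2 d, 0 < d & forall s, x < s < x + d -> f x < f s.
Proof.
move=> [fx <-] df0.
have /cvgrPdist_lt /(_ _ df0) := fx.
rewrite /prop_near1/= => /nbhs_ballP[d /= d0 H].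
exists d => // s /andP[xs sd].
have := H (s - x); rewrite /ball/= => /(_ _ _).
have -> : `|0 - (s - x)| < d by rewrite sub0r normrN gtr0_norm; lra.
have -> : s - x != 0 by rewrite subr_eq0 gt_eqF.
move=> /(_ isT isT); rewrite /GRing.scale/= mulr1 subrK.
rewrite /derive /= /GRing.scale/=.
set l := lim _ ; rewrite ltr_norml => /andP[_]; rewrite ltrBlDr ltrDl.
by rewrite pmulr_rgt0 ?invr_gt0 ?subr_gt0.
Qed.

(* Looking at the last time the function is at least [m], it would equal [m]
   there, and a positive derivative contradicts maximality. *)
Lemma barrier y (dy : R -> R) a b m : (forall t, is_derive t 1 y (dy t)) -> a <= b ->
  m <= y a -> (forall t, a <= t <= b -> y t = m -> 0 < dy t) -> m <= y b.
Proof.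
move=> yd ab ma pos; rewrite leNgt; apply/negP => ybm.
pose S := [set t | a <= t <= b /\ m <= y t].
have Sa : S a by split => //; rewrite lexx.
have Sub : ubound S b by move=> t [/andP[]].
have hS : has_sup S by split; [exists a | exists b].
set u := sup S.
have au : a <= u by apply: ub_le_sup Sa; exists b.
have ub : u <= b by apply: ge_sup => //; exists a.
have yu : m <= y u.
  rewrite leNgt; apply/negP => yum.
  have /cvgrPdist_lt /(_ (m - y u)) := is_derive_continuous (yd u).
  rewrite subr_gt0 => /(_ yum) /nbhs_ballP[d /= d0 H].
  have [t [/andP[ta tb] my] ut] := sup_adherent d0 hS.
  have tu : t <= u by apply: ub_le_sup; [exists b | split => //; rewrite ta].
  have := H t; rewrite /ball/= => /(_ _).
  rewrite ger0_norm ?subr_ge0// ltrBlDr -/u in ut *.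
  by move=> /(_ ltac:(lra)); rewrite ltr_norml => /andP[]; lra.
have ltub : u < b by rewrite lt_neqAle ub andbT; apply: contraTneq yu => ->; rewrite -ltNge.
have yum : y u = m.
  apply/eqP; rewrite eq_le yu andbT.
  have cy : {within `[u, b], continuous y} by exact: is_derive_within yd.
  rewrite leNgt; apply/negP => yum.
  have [|v] := IVT (v := m) (ltW ltub) cy.
    by rewrite minEle maxEle; case: ifP => h; lra.
  rewrite in_itv/= => /andP[uv vb] yv.
  have vu : v <= u by apply: ub_le_sup; [exists b | split; rewrite ?yv//; lra].
  have e : v = u by lra.
  by move: yum; rewrite -e yv ltxx.
have [d d0 H] := is_derive_pos_right (yd u) (pos u ltac:(lra) yum).
pose s := Num.min b (u + d / 2).
have us : u < s by rewrite /s lt_min; lra.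
have sd : s < u + d by rewrite /s gt_min; lra.
have sb : s <= b by rewrite /s ge_min lexx.
have := H s ltac:(lra); rewrite yum => ms.
have : s <= u by apply: ub_le_sup; [exists b | split; [lra|exact: ltW]].
by lra.
Qed.

End RealCalculus.

(** * Wells of the cosine and the oscillation of a single phase *)

Section Oscillation.
Context {R : realType}.
Implicit Types (f th : R -> R) (T c s t x : R).

Lemma cos_add2piz (k : int) x : cos (x + 2 * pi * k%:~R) = cos x.
Proof.
have nat_case (n : nat) (z : R) : cos (z + 2 * pi * n%:R) = cos z.
  rewrite (_ : z + _ = z + (pi *+ 2) *+ n); last by rewrite -[in RHS]mulr_natr -[pi *+ 2]mulr_natl.
  exact: (periodicn (@cosD2pi R)).
case: k => n; first exact: nat_case.
rewrite NegzE mulrNz mulrN -[RHS](nat_case n.+1 _) -[in LHS](nat_case n.+1 _).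
by rewrite subrK nat_case.
Qed.

Lemma reduce_2pi x : exists k : int, - pi <= x - 2 * pi * k%:~R < pi.
Proof.
have p0 := @pi_gt0 R.
exists (Num.floor ((x + pi) / (2 * pi))).
have /andP[h1 h2] := floor_itv ((x + pi) / (2 * pi)).
move: h1 h2; rewrite ler_pdivlMr ?ltr_pdivrMr ?mulr_gt0// intrD => h1 h2.
by apply/andP; split; lra.
Qed.

Lemma norm_le_acos x c : 0 <= c <= 1 -> `|x| <= pi -> - c <= cos x -> `|x| <= acos (- c).
Proof.
move=> /andP[c0 c1] xp cx.
have Nc : -1 <= - c <= 1 by apply/andP; split; lra.
rewrite leNgt; apply/negP => h.
have : cos `|x| < cos (acos (- c)).
  rewrite ltr_cos// in_itv/=; first by rewrite acos_ge0//= acos_lepi.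
  by rewrite normr_ge0.
by rewrite acosK ?in_itv//= cos_norm; lra.
Qed.

Lemma oscillation_lt_2pi f T m M : M - m < 2 * pi ->
  (forall t, T <= t -> m <= f t <= M) -> (oscillation_from f T < (2 * pi)%:E)%E.
Proof.
move=> Mm H; apply: (@le_lt_trans _ _ (M%:E - m%:E)%E); last by rewrite -EFinB lte_fin.
apply: leeB.
  by apply: ge_ereal_sup => _ [t Tt <-]; rewrite lee_fin; have /andP[] := H t Tt.
by apply: le_ereal_inf_tmp => _ [t Tt <-]; rewrite lee_fin; have /andP[] := H t Tt.
Qed.

Lemma between_values f (df : R -> R) s t v : (forall t, is_derive t 1 f (df t)) -> s <= t ->
  (f s <= v <= f t) || (f t <= v <= f s) -> exists2 u, s <= u <= t & f u = v.
Proof.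
move=> fd st h; have [|u] := IVT (v := v) st (is_derive_within fd).
  by rewrite minEle maxEle; case: ifP; move/orP: h; lra.
by rewrite in_itv/= => ust fu; exists u.
Qed.

Lemma is_derive_shift th (dth : R -> R) (k : R) : (forall t, is_derive t 1 th (dth t)) ->
  forall t, is_derive t 1 (fun s => th s - k) (dth t).
Proof.
move=> thd t; rewrite (_ : (fun s => _) = th \- cst k)//.
by rewrite -[dth t]subr0; apply: is_deriveB.
Qed.

(** Leaving the well around [2 pi k] means passing through an odd multiple of [pi], where the cosine
    is [-1 < - c]. *)
Lemma stays_in_well th (dth : R -> R) T c (k : int) s t :
  (forall t, is_derive t 1 th (dth t)) -> 0 < c -> c < 1 ->
  (forall s t, T <= s -> s <= t -> - c <= cos (th s) -> - c <= cos (th t)) ->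
  T <= s -> s <= t -> - c <= cos (th s) ->
  `|th s - 2 * pi * k%:~R| <= pi -> `|th t - 2 * pi * k%:~R| <= acos (- c).
Proof.
move=> thd c0 c1 inv Ts st cs ps.
have cosf (u : R) : cos (th u - 2 * pi * k%:~R) = cos (th u).
  by rewrite -mulrN -intrN cos_add2piz.
have shifted (e : int) (u : R) : is_derive u 1 (fun s => th s - 2 * pi * e%:~R) (dth u).
  exact: is_derive_shift.
have ct := inv _ _ Ts st cs.
apply: norm_le_acos; [lra| |by rewrite cosf].
rewrite leNgt; apply/negP => pt.
have [u sut [eu|eu]] : exists2 u, s <= u <= t &
    th u - 2 * pi * k%:~R = pi \/ th u - 2 * pi * k%:~R = - pi.
  have [h|h] := lerP 0 (th t - 2 * pi * k%:~R).
    rewrite ger0_norm// in pt.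
    have [|u ust eu] := between_values (v := pi) (shifted k) st.
      by move: ps; rewrite ler_norml => /andP[? ?]; apply/orP; left => /=; lra.
    by exists u => //; left.
  rewrite ltr0_norm// in pt.
  have [|u ust eu] := between_values (v := - pi) (shifted k) st.
    by move: ps; rewrite ler_norml => /andP[? ?]; apply/orP; right => /=; lra.
  by exists u => //; right.
all: have := inv s u Ts ltac:(lra) cs; rewrite -cosf eu ?cosN cospi; lra.
Qed.

(** Once [cos >= - c], the phase is caught by one well for good. Before that it cannot have touched
    a neighbouring well, and it cannot have visited the gaps on both sides of its own. A well with
    one adjacent gap has length [2 pi], and the inequality is strict because extrema over [[T, t1]]
    are attained outside the next well. *)
Lemma invariant_well_oscillation th (dth : R -> R) T c :
  (forall t, is_derive t 1 th (dth t)) -> 0 < c -> c < 1 ->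
  (forall s t, T <= s -> s <= t -> - c <= cos (th s) -> - c <= cos (th t)) ->
  (oscillation_from th T < (2 * pi)%:E)%E.
Proof.
move=> thd c0 c1 inv.
have p0 := @pi_gt0 R.
have shifted (e : int) (t : R) : is_derive t 1 (fun s => th s - 2 * pi * e%:~R) (dth t).
  exact: is_derive_shift.
have Nc : -1 < - c <= 1 by lra.
have a0_lt := acos_ltpi Nc.
have a0_ge : 0 <= acos (- c) by apply: acos_ge0; lra.
set a0 := acos (- c) in a0_lt a0_ge.
have [[t1 [Tt1 ct1]]|none] := pselect (exists t, T <= t /\ - c <= cos (th t)); last first.
  have [k /andP[k1 k2]] := reduce_2pi (th T - pi).
  have cosf (u : R) : cos (th u - 2 * pi * k%:~R - pi) = - cos (th u).
    have := @cosDpi R (th u - 2 * pi * k%:~R - pi); rewrite subrK.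
    by rewrite -mulrN -intrN cos_add2piz => ->; rewrite opprK.
  (* The cosine is negative from [T] on, which keeps [th] within [pi / 2] of one odd multiple of
     [pi]. *)
  apply: (@oscillation_lt_2pi _ _ (2 * pi * k%:~R + pi / 2) (2 * pi * k%:~R + 3 * pi / 2)).
    by lra.
  move=> t Tt.
  have cneg u : T <= u -> cos (th u) < - c.
    by move=> Tu; rewrite ltNge; apply/negP => h; apply: none; exists u.
  have avoid u : T <= u -> cos (th u - 2 * pi * k%:~R) != 1.
    by move=> Tu; rewrite -mulrN -intrN cos_add2piz; have := cneg u Tu; apply: contraTneq => ->; lra.
  have : `|th t - 2 * pi * k%:~R - pi| <= pi.
    rewrite leNgt; apply/negP; rewrite ltr_normr => /orP[h|h].
      have [|u ust eu] := between_values (v := pi *+ 2) (shifted k) Tt.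
        by apply/orP; left; rewrite mulr2n; lra.
      by have := avoid u ltac:(lra); rewrite eu cos2pi eqxx.
    have [|u ust eu] := between_values (v := 0) (shifted k) Tt.
      by apply/orP; right => /=; lra.
    by have := avoid u ltac:(lra); rewrite eu cos0 eqxx.
  have ct := cneg t Tt.
  move=> /(@norm_le_acos _ 0) => /(_ ltac:(lra)).
  by rewrite cosf oppr0 acos0 ler_norml => /(_ ltac:(lra)); lra.
have [k /andP[k1 k2]] := reduce_2pi (th t1).
set w := 2 * pi * k%:~R in k1 k2.
have after t : t1 <= t -> `|th t - w| <= a0.
  by move=> tt; apply: (stays_in_well thd c0 c1 inv Tt1 tt ct1); rewrite ler_norml -/w; lra.
have cw : {within `[T, t1], continuous th} by exact: is_derive_within thd.
have [tm] := EVT_min Tt1 cw; rewrite in_itv/= => /andP[Tm m1] mmin.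
have [tM] := EVT_max Tt1 cw; rewrite in_itv/= => /andP[TM M1] mmax.
have bnd t : T <= t <= t1 -> th tm <= th t <= th tM.
  by move=> h; rewrite mmin ?mmax ?in_itv.
have /ler_normlP[h1 h2] := after t1 (lexx _).
have ca0 : cos a0 = - c by rewrite acosK// in_itv/=; lra.
(* Reaching [w - 2 pi + a0], the right edge of the well on the left, would trap the phase there, yet
   [th t1] is within [a0 < pi] of [w]. *)
have low : w - 2 * pi + a0 < th tm.
  rewrite ltNge; apply/negP => le.
  have [|u /andP[mu ut] eu] := between_values (v := w - 2 * pi + a0) thd m1.
    by apply/orP; left => /=; lra.
  have ew : th u - 2 * pi * (k - 1)%:~R = a0 by rewrite eu intrB /w; ring.
  have cu : - c <= cos (th u).
    by rewrite -(cos_add2piz (- (k - 1))) intrN mulrN ew ca0.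
  have := stays_in_well (k := k - 1) thd c0 c1 inv (le_trans Tm mu) ut cu.
  rewrite ew ger0_norm// => /(_ (ltW a0_lt)).
  rewrite (_ : 2 * pi * _ = w - 2 * pi); last by rewrite intrB /w; ring.
  by rewrite -/a0 => /ler_normlP[]; lra.
have up : th tM < w + 2 * pi - a0.
  rewrite ltNge; apply/negP => le.
  have [|u /andP[mu ut] eu] := between_values (v := w + 2 * pi - a0) thd M1.
    by apply/orP; right => /=; lra.
  have ew : th u - 2 * pi * (k + 1)%:~R = - a0 by rewrite eu intrD /w; ring.
  have cu : - c <= cos (th u).
    by rewrite -(cos_add2piz (- (k + 1))) intrN mulrN ew cosN ca0.
  have := stays_in_well (k := k + 1) thd c0 c1 inv (le_trans TM mu) ut cu.
  rewrite ew normrN ger0_norm// => /(_ (ltW a0_lt)).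
  rewrite (_ : 2 * pi * _ = w + 2 * pi); last by rewrite intrD /w; ring.
  by rewrite -/a0 => /ler_normlP[]; lra.
have center s t : T <= s -> s <= t -> th s = w -> `|th t - w| <= a0.
  move=> Ts st es; apply: (stays_in_well thd c0 c1 inv Ts st).
    by rewrite es -[w]add0r cos_add2piz cos0; lra.
  by rewrite es subrr normr0; exact: ltW.
(* Visits to both gaps force a passage through [w], and [center] then excludes the gap visited
   later. *)
have one_side : w - a0 <= th tm \/ th tM <= w + a0.
  have [?|lt1] := lerP (w - a0) (th tm); first by left.
  have [?|lt2] := lerP (th tM) (w + a0); first by right.
  have [mM|Mm] := lerP tm tM.
    have [|u /andP[mu ut] eu] := between_values (v := w) thd mM.
      by apply/orP; left => /=; lra.
    by have /ler_normlP[] := center u tM ltac:(lra) ut eu; lra.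
  have [|u /andP[mu ut] eu] := between_values (v := w) thd (ltW Mm).
    by apply/orP; right => /=; lra.
  by have /ler_normlP[] := center u tm ltac:(lra) ut eu; lra.
have full t : T <= t -> (th tm <= th t <= th tM) \/ (w - a0 <= th t <= w + a0).
  move=> Tt; have [h|h] := lerP t t1; first by left; apply: bnd; lra.
  by right; have /ler_normlP[] := after t (ltW h); lra.
case: one_side => h.
  apply: (@oscillation_lt_2pi _ _ (w - a0) (Num.max (th tM) (w + a0))).
    by rewrite ltrBlDr gt_max; lra.
  by move=> t /full; rewrite le_max => -[]; lra.
apply: (@oscillation_lt_2pi _ _ (Num.min (th tm) (w - a0)) (w + a0)).
  by rewrite ltrBlDr -ltrBlDl lt_min; lra.
by move=> t /full; rewrite ge_min => -[]; lra.
Qed.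

End Oscillation.

(** * Self-consistent lower bound on the order parameter *)

Section Trapping.
Context {R : realType}.

(** Continuity method: [lo], assumed up to time [t], improves to [hi > lo], so by continuity the
    supremum of the times up to which [lo] holds can be pushed further until it reaches [b]. *)
Lemma bootstrap (y dy : R -> R) (a lo hi : R) : (forall t : R, is_derive t 1 y (dy t)) ->
  lo < hi -> lo <= y a ->
  (forall t, a <= t -> (forall u, a <= u <= t -> lo <= y u) -> hi <= y t) ->
  forall t, a <= t -> hi <= y t.
Proof.
move=> yd lohi loa step b ab.
suff: forall u, a <= u <= b -> lo <= y u by exact: step.
pose S := [set t | a <= t <= b /\ forall u, a <= u <= t -> lo <= y u].
have Sa : S a.
  by split; [rewrite lexx|move=> u; rewrite -eq_le => /eqP <-].
have hS : has_sup S by split; [exists a | exists b => t [/andP[]]].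
set u := sup S.
have au : a <= u by apply: ub_le_sup Sa; exists b => t [/andP[]].
have ub : u <= b by apply: ge_sup => [|t [/andP[]]//]; exists a.
have below v : a <= v -> v < u -> lo <= y v.
  move=> av vu; have [|t [_ H]] := @sup_adherent _ S (u - v) _ hS.
    by rewrite subr_gt0.
  by rewrite -/u => vt; apply: H; lra.
have lou : lo <= y u.
  move: au; rewrite le_eqVlt => /predU1P[<-//|au].
  rewrite leNgt; apply/negP => ylo.
  have /cvgrPdist_lt /(_ (lo - y u)) := is_derive_continuous (yd u).
  rewrite subr_gt0 => /(_ ylo) /nbhs_ballP[d /= d0 H].
  pose v := Num.max a (u - d / 2).
  have vu : v < u by rewrite /v gt_max; lra.
  have vd : u - d < v by rewrite /v lt_max; apply/orP; right; lra.
  have av : a <= v by rewrite /v le_max lexx.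
  have := H v; rewrite /ball/= => /(_ _).
  rewrite gtr0_norm ?subr_gt0// => /(_ ltac:(lra)).
  by rewrite ltr_norml => /andP[]; have := below v av vu; lra.
have upto v : a <= v <= u -> lo <= y v.
  by move=> /andP[av]; rewrite le_eqVlt => /predU1P[->//|]; exact: below.
have hiu := step u au upto.
move: ub; rewrite le_eqVlt => /predU1P[<-//|ub].
have /cvgrPdist_lt /(_ (hi - lo)) := is_derive_continuous (yd u).
rewrite subr_gt0 => /(_ lohi) /nbhs_ballP[d /= d0 H].
pose v := Num.min b (u + d / 2).
have uv : u < v by rewrite /v lt_min; lra.
have vd : v < u + d by rewrite /v gt_min; apply/orP; right; lra.
have vb : v <= b by rewrite /v ge_min lexx.
have : S v.
  split; first by lra.
  move=> w /andP[aw wv]; have [wu|uw] := lerP w u; first by apply: upto; lra.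
  have := H w; rewrite /ball/= => /(_ _).
  rewrite ler0_norm ?subr_le0 ?(ltW uw)// => /(_ ltac:(lra)).
  by rewrite ltr_norml => /andP[]; lra.
move=> /(@ub_le_sup _ S); rewrite -/u => h.
by have : v <= u; [apply: h; exists b => t [/andP[]]|lra].
Qed.

Section Model.
Context {N : nat}.
Implicit Types (omega x : 'I_N -> R) (th : R -> 'I_N -> R) (kappa : R).

Lemma kuramoto_rhsE omega kappa x i :
  kuramoto_rhs omega kappa x i = omega i - kappa * order_param x * sin (x i).
Proof. by rewrite /kuramoto_rhs /order_param -mulr_suml !mulrA. Qed.

Lemma le_normOmega omega i : `|omega i| <= normOmega omega.
Proof. by rewrite /normOmega; apply: (le_bigmax _ (fun i => `|omega i|)). Qed.

Lemma normOmega_ge0 omega : 0 <= normOmega omega.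
Proof. by rewrite /normOmega; elim/big_ind: _ => // u v u0 v0; rewrite le_max u0. Qed.

Lemma order_param_ge0 x : 0 <= order_param x.
Proof.
rewrite mulr_ge0 ?invr_ge0 ?ler0n// sumr_ge0// => i _.
Qed.

Lemma order_param_le x y d : (0 < N)%N -> (forall i, cos (x i) - d <= cos (y i)) ->
  order_param x - d <= order_param y.
Proof.
move=> N0 H; have N0' : 0 < N%:R :> R by rewrite ltr0n.
rewrite /order_param -[d](mulKf (lt0r_neq0 N0')) -mulrBr ler_pM2l ?invr_gt0//.
rewrite mulr_natl -[N in d *+ N]card_ord -sumr_const -sumrB.
by apply: ler_sum => i _; have := H i; lra.
Qed.

Lemma is_derive_order_param th (v : R -> 'I_N -> R) (t : R) :
  (forall i, is_derive t 1 (fun s => th s i) (v t i)) ->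
  is_derive t 1 (fun s => order_param (th s))
    (N%:R^-1 * \sum_(j < N) (- sin (th t j) * v t j)).
Proof.
move=> H.
rewrite (_ : (fun s => _) =
    N%:R^-1 *: \sum_(j < N) (cst 1 + (cos \o (fun s => th s j)))); last first.
  by apply/funext => s; rewrite /order_param /= !fctE/= fct_sumE.
apply: is_deriveZ; apply: is_derive_sum => j.
rewrite -[X in is_derive _ _ _ X]add0r; apply: is_deriveD.
Qed.

Lemma is_derive_cos_solution omega kappa x th i (t : R) : is_solution omega kappa x th ->
  is_derive t 1 (fun s => cos (th s i))
    (sin (th t i) * (kappa * order_param (th t) * sin (th t i) - omega i)).
Proof.
move=> [_ H]; rewrite (_ : (fun s => _) = cos \o (fun s => th s i))//.
have D := is_derive1_comp (is_derive_cos (th t i)) (H i t).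
by apply: (is_derive_eq D); rewrite kuramoto_rhsE; ring.
Qed.

(** With [z], [S], [w] standing for [sin theta_i], the order parameter and [omega_i], the right side
    is the derivative of [cos theta_i]. It is at least [|z| (kappa r |z| - W)], a product of two
    factors that increase with [|z|] and are nonnegative from [s] on. *)
Lemma drift_lower_bound (kappa S r w W s z : R) : 0 <= kappa -> 0 <= r -> r <= S -> `|w| <= W ->
  0 <= s -> s <= `|z| -> W <= kappa * r * s ->
  s * (kappa * r * s - W) <= z * (kappa * S * z - w).
Proof.
move=> k0 r0 rS wW s0 sz Ws.
have e : z * (kappa * S * z - w) = kappa * S * (`|z| * `|z|) - w * z.
  by rewrite -expr2 real_normK ?num_real//; ring.
have wz : w * z <= W * `|z|.
  by rewrite (le_trans (ler_norm _))// normrM ler_wpM2r.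
have h1 : kappa * r * (`|z| * `|z|) <= kappa * S * (`|z| * `|z|).
  by rewrite ler_wpM2r ?mulr_ge0// ler_wpM2l.
have h2 : s * (kappa * r * s - W) <= `|z| * (kappa * r * `|z| - W).
  by rewrite ler_pM ?subr_ge0// lerB// ler_wpM2l// mulr_ge0.
by rewrite e; lra.
Qed.

Lemma sin_lower_bound (z c s : R) : 0 <= s -> s ^+ 2 + c ^+ 2 <= 1 -> - c <= cos z <= c ->
  s <= `|sin z|.
Proof.
move=> s0 sc /andP[c1 c2].
rewrite -(@ler_pXn2r _ 2)// ?nnegrE// real_normK ?num_real// sin2cos2.
have : cos z ^+ 2 <= c ^+ 2.
  by rewrite -[_ ^+ 2]real_normK ?num_real// ler_pXn2r// ?nnegrE// ?ler_norml ?c1//; lra.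
by lra.
Qed.

(* On [{|cos| <= c}] the sine dominates [s], so [cos theta_i] strictly increases. *)
Lemma level_invariant omega kappa x th i (a b r s c m : R) : is_solution omega kappa x th ->
  0 <= kappa -> 0 <= r -> 0 < s -> s ^+ 2 + c ^+ 2 <= 1 ->
  normOmega omega < kappa * r * s -> a <= b ->
  (forall t, a <= t <= b -> r <= order_param (th t)) ->
  - c <= m <= c -> m <= cos (th a i) -> m <= cos (th b i).
Proof.
move=> sol k0 r0 s0 sc ks ab Rr mc ma.
apply: (barrier (fun t => is_derive_cos_solution i t sol) ab ma) => t abt em.
have sz : s <= `|sin (th t i)| by apply: (sin_lower_bound (ltW s0) sc); rewrite em.
apply: lt_le_trans (drift_lower_bound k0 r0 (Rr t abt) (le_normOmega omega i) (ltW s0) sz (ltW ks)).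
by rewrite mulr_gt0 ?subr_gt0.
Qed.

(* Each [cos theta_i] loses at most [1 - c]: above [-c] it stays above its minimum with [c], and
   below [-c] it is already within [1 - c] of its absolute minimum. *)
Lemma order_param_trap omega kappa x th (t0 R0 c s : R) : is_solution omega kappa x th ->
  (0 < N)%N -> 0 < kappa -> 0 < s -> 0 <= c <= 1 -> s ^+ 2 + c ^+ 2 <= 1 ->
  normOmega omega < kappa * (R0 - (1 - c)) * s -> R0 <= order_param (th t0) ->
  forall t, t0 <= t -> R0 - (1 - c) <= order_param (th t).
Proof.
move=> sol N0 k0 s0 c01 sc ks R0t.
set r := R0 - (1 - c) in ks *.
have W0 := normOmega_ge0 omega.
set W := normOmega omega in ks W0.
have sk0 : 0 < kappa * s by rewrite mulr_gt0.
(* [q] is the value of the order parameter at which the coupling only balances the frequencies. The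
   midpoint of [q] and [r] serves as [lo]: still strong enough for [level_invariant], yet strictly
   below the bound [r] to be recovered. *)
pose q := W / (kappa * s).
have qE : kappa * s * q = W by rewrite /q mulrC divfK// gt_eqF.
have q0 : 0 <= q by rewrite divr_ge0// ltW.
have qr : q < r by rewrite /q ltr_pdivrMr//; lra.
have kq : W < kappa * ((r + q) / 2) * s.
  have : kappa * s * q < kappa * s * r by rewrite ltr_pM2l.
  by lra.
apply: (bootstrap (lo := (r + q) / 2) (fun t =>
  is_derive_order_param (v := fun t => kuramoto_rhs omega kappa (th t)) (fun i => sol.2 i t))).
- by lra.
- by rewrite /r in qr *; lra.
move=> t tt0 H.
apply: le_trans (order_param_le (x := th t0) (d := 1 - c) N0 _); first by rewrite lerD2r.
move=> i; have [h|h] := lerP (- c) (cos (th t0 i)); last first.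
  by have := cos_geN1 (th t i); lra.
have : Num.min (cos (th t0 i)) c <= cos (th t i).
  apply: (level_invariant (r := (r + q) / 2) (s := s) (c := c) sol (ltW k0) _ s0 sc kq tt0 H).
  - by lra.
  - by rewrite le_min ge_min lexx orbT; lra.
  - by rewrite ge_min lexx.
by have := cos_le1 (th t0 i); rewrite ge_min => ?; move=> /orP[]; lra.
Qed.

End Model.
End Trapping.

(** * Good behaviour after a single crossing of the threshold *)

Section GoodSets.
Context {R : realType} {N : nat}.
Implicit Types (omega x : 'I_N -> R) (th : R -> 'I_N -> R) (kappa : R).

Lemma bounded_oscillation_of_crossing omega kappa x th (t0 T R0 c s : R) :
  is_solution omega kappa x th -> (0 < N)%N -> 0 < kappa -> 0 < s -> 0 < c < 1 ->
  s ^+ 2 + c ^+ 2 <= 1 -> 1 - c <= R0 ->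
  normOmega omega < kappa * (R0 - (1 - c)) * s -> R0 <= order_param (th t0) -> t0 <= T ->
  forall i, (oscillation_from (fun t => th t i) T < (2 * pi)%:E)%E.
Proof.
move=> sol N0 k0 s0 /andP[c0 c1] sc R0c ks Rt0 t0T i.
have trap := order_param_trap sol N0 k0 s0 _ sc ks Rt0.
apply: (invariant_well_oscillation (fun t => sol.2 i t) c0 c1) => u v Tu uv.
apply: (level_invariant (r := R0 - (1 - c)) sol (ltW k0) _ s0 sc ks uv).
- by lra.
- by move=> t uvt; apply: trap; lra.
- by lra.
Qed.

Lemma invsqrt2_bounds : let q : R := (Num.sqrt 2)^-1 in
  [/\ q ^+ 2 = 2^-1, 0 < q, 7 / 10 < q & q < 71 / 100].
Proof.
move=> q.
have q2 : q ^+ 2 = 2^-1 by rewrite /q exprVn sqr_sqrtr.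
have q0 : 0 < q by rewrite invr_gt0 sqrtr_gt0.
by split => //; nra.
Qed.

(** Constants for [q = 1/sqrt 2]. The trap is run with [c = q + 6e/100] and [s = q - 7e/100], so a
    start at [1 - 21e/100] loses [1 - c] and leaves exactly [q - 3e/20]. The outer inequalities let
    [W < kappa / (2 + e)] pay for the trap and for settling at level [q]; the middle one is
    [s^2 + c^2 <= 1]. *)
Lemma trap_constants_ineq (e q : R) : 0 < e <= 1 -> q ^+ 2 = 2^-1 -> 0 < q -> 7 / 10 < q -> q < 71 / 100 ->
  1 < (2 + e) * (q - 3 * e / 20) * (q - 7 * e / 100) /\
  (q - 7 * e / 100) ^+ 2 + (q + 6 * e / 100) ^+ 2 <= 1 /\
  1 <= (2 + e) * (q - 3 * e / 20) * q.
Proof. by move=> /andP[e0 e1] q2 q0 q7 q71; split; [nra|split; nra]. Qed.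

(* On [{|cos| <= q}] the cosine grows at speed at least [q (kappa r q - |Omega|)], hence crosses
   the interval [[-q, q]] within time [2 / (kappa r q - |Omega|)]. *)
Lemma settling omega kappa x th i (q r tau a : R) : is_solution omega kappa x th ->
  0 <= kappa -> 0 < q -> q ^+ 2 + q ^+ 2 <= 1 -> 0 <= r -> normOmega omega < kappa * r * q ->
  (forall t, a <= t -> r <= order_param (th t)) -> - q <= cos (th a i) ->
  0 <= tau -> 2 <= tau * (kappa * r * q - normOmega omega) ->
  forall t, a + tau <= t -> q <= cos (th t i).
Proof.
move=> sol k0 q0 sc r0 kq Rr ca tau0 htau.
have level m b t : a <= b -> b <= t -> - q <= m <= q -> m <= cos (th b i) -> m <= cos (th t i).
  move=> ab bt; apply: (level_invariant sol k0 r0 q0 sc kq bt) => u /andP[bu _].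
  by apply: Rr; exact: le_trans ab bu.
have aat : a <= a + tau by rewrite lerDl.
have qq : - q <= q <= q by rewrite lexx andbT; lra.
have Nq : - q <= - q <= q by rewrite lexx /=; lra.
suff reach : q <= cos (th (a + tau) i) by move=> t at_; exact: (level q (a + tau)).
have [//|low] := lerP q (cos (th (a + tau) i)).
have [u /andP[au ut] e] := mean_value (fun t => is_derive_cos_solution i t sol) aat.
(* If the cosine exceeded [q] at the mean-value time [u], invariance of the level [q] would
   contradict [low]. *)
have cu : - q <= cos (th u i) <= q.
  rewrite (level (- q) a u)//= leNgt; apply/negP => /ltW h; move: low; rewrite ltNge => /negP; apply.
  exact: (level q u).
have sq := sin_lower_bound (ltW q0) sc cu.
have := drift_lower_bound k0 r0 (Rr u au) (le_normOmega omega i) (ltW q0) sq (ltW kq).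
move: e; set D := sin _ * _ => e dD.
have h1 := ler_wpM2r tau0 dD; have h2 := ler_wpM2l (ltW q0) htau.
move: e; rewrite [a + tau]addrC addrK => e.
have : q * 2 <= cos (th (tau + a) i) - cos (th a i).
  by rewrite e; apply: le_trans h2 _; apply: le_trans h1; rewrite mulrCA [leLHS]mulrC.
by rewrite addrC in low *; lra.
Qed.

Lemma good_of_crossing omega kappa x th (eps t0 T : R) :
  is_solution omega kappa x th -> (0 < N)%N -> 0 < kappa -> 0 < eps <= 1 ->
  (2 + eps) * normOmega omega < kappa ->
  1 - 21 * eps / 100 <= order_param (th t0) -> t0 <= T ->
  (forall t, T <= t -> order_param (th t) >= (Num.sqrt 2)^-1 - 3 * eps / 20) /\
  (forall i, (oscillation_from (fun t => th t i) T < (2 * pi)%:E)%E) /\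
  (forall i t0, T <= t0 -> cos (th t0 i) >= - (Num.sqrt 2)^-1 ->
     (forall t, t0 <= t -> cos (th t i) >= - (Num.sqrt 2)^-1) /\
     (forall t, t0 + (2 + eps) * pi / (kappa - (2 + eps) * normOmega omega) <= t ->
        cos (th t i) >= (Num.sqrt 2)^-1)).
Proof.
move=> sol N0 k0 e01 kW Rt0 t0T.
have [] := invsqrt2_bounds; set q := (Num.sqrt 2)^-1 => q2 q0 q7 q71.
have [ks1 [sc1 ks2]] := trap_constants_ineq e01 q2 q0 q7 q71.
have W0 := normOmega_ge0 omega; set W := normOmega omega in kW W0 *.
have s0 : 0 < q - 7 * eps / 100 by lra.
have rE : 1 - 21 * eps / 100 - (1 - (q + 6 * eps / 100)) = q - 3 * eps / 20 by lra.
have scale (z : R) : 1 <= (2 + eps) * z -> kappa / (2 + eps) <= kappa * z.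
  move=> h; rewrite ler_pdivrMr; last by lra.
  by rewrite -mulrA [z * _]mulrC ler_peMr// ltW.
have Wk : W < kappa / (2 + eps) by rewrite ltr_pdivlMr; lra.
have trap := @order_param_trap _ _ omega kappa x th t0 (1 - 21 * eps / 100) (q + 6 * eps / 100)
  (q - 7 * eps / 100) sol N0 k0 s0 ltac:(lra) sc1.
rewrite rE in trap.
have {}trap t : T <= t -> q - 3 * eps / 20 <= order_param (th t).
  move=> Tt; apply: trap => //; last by lra.
  by rewrite -mulrA; apply: lt_le_trans Wk (scale _ _); lra.
have kq : W < kappa * (q - 3 * eps / 20) * q.
  by rewrite -mulrA; apply: lt_le_trans Wk (scale _ _); lra.
have sc : q ^+ 2 + q ^+ 2 <= 1 by rewrite q2; lra.
have r0 : 0 <= q - 3 * eps / 20 by lra.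
have level m i a b : T <= a -> a <= b -> - q <= m <= q -> m <= cos (th a i) -> m <= cos (th b i).
  move=> Ta ab; apply: (level_invariant sol (ltW k0) r0 q0 sc kq ab) => t abt.
  by apply: trap; lra.
split => //; split.
  move=> i; apply: (invariant_well_oscillation (fun t => sol.2 i t) q0) => [|u v Tu uv]; first by lra.
  by apply: level => //; lra.
move=> i a Ta ca; split=> [t at_|].
  by apply: (level (- q) i a t Ta at_ _ ca); rewrite lexx /=; clear -q0; lra.
have D0 : 0 < kappa - (2 + eps) * W by rewrite subr_gt0.
have p2 := @pi_ge2 R; have p0 := @pi_ge0 R.
have e2 : 0 < 2 + eps by clear -e01; lra.
set tau := (2 + eps) * pi / _.
have tau0 : 0 <= tau by rewrite divr_ge0 ?mulr_ge0 ?(ltW D0) ?(ltW e2).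
(* Crossing [[-q, q]] takes time at most [2 / (kappa / (2 + eps) - W)]; the [pi] in the stated
   settling time dominates this [2]. *)
have tauE : tau * (kappa / (2 + eps) - W) = pi.
  by rewrite /tau; field; rewrite !gt_eqF.
apply: (settling sol (ltW k0) q0 sc r0 kq) => // [t at_|].
  by apply: trap; exact: le_trans Ta at_.
apply: (le_trans p2); rewrite -tauE ler_wpM2l// lerB// -mulrA; apply: scale.
by rewrite mulrA.
Qed.

(* Without frequencies every [cos theta_i] is nondecreasing. *)
Lemma bounded_oscillation_no_frequency omega kappa x th T : is_solution omega kappa x th ->
  0 < kappa -> normOmega omega = 0 ->
  forall i, (oscillation_from (fun t => th t i) T < (2 * pi)%:E)%E.
Proof.
move=> sol k0 W0 i; have half : 0 < (2^-1 : R) < 1 by lra.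
have /andP[h0 h1] := half.
apply: (invariant_well_oscillation (fun t => sol.2 i t) h0 h1) => u v _ uv h.
apply: le_trans h _; apply: (derive_nonneg_le (fun t => is_derive_cos_solution i t sol) uv) => t _.
have -> : omega i = 0.
  by apply/eqP; rewrite -normr_le0 -W0; exact: le_normOmega.
by rewrite subr0 mulrCA -expr2 mulr_ge0 ?sqr_ge0// mulr_ge0 ?order_param_ge0// ltW.
Qed.

End GoodSets.

(** * The flow *)

Section Flow.
Context {R : realType}.

Lemma lipschitz_of_derive (f df : R -> R) (K : R) : (forall x : R, is_derive x 1 f (df x)) ->
  (forall x, `|df x| <= K) -> forall a b, `|f a - f b| <= K * `|a - b|.
Proof.
move=> fd dK a b; wlog ab : a b / a <= b.
  by move=> H; case/orP: (le_total a b) => [/H//|/H]; rewrite (distrC a) (distrC (f a)).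
rewrite (distrC a) (distrC (f a)); have [c _ ->] := mean_value fd ab.
by rewrite normrM ler_wpM2r.
Qed.

Lemma cos_lipschitz (a b : R) : `|cos a - cos b| <= `|a - b|.
Proof.
rewrite -[leRHS]mul1r; apply: (lipschitz_of_derive (df := fun x => - sin x)) => x.
by rewrite normrN sin_max.
Qed.

Lemma sin_lipschitz (a b : R) : `|sin a - sin b| <= `|a - b|.
Proof.
rewrite -[leRHS]mul1r; apply: (lipschitz_of_derive (df := fun x => cos x)) => x.
exact: cos_max.
Qed.

Lemma is_derive_mull (c t : R) : is_derive t 1 (fun s : R => c * s) c.
Proof. by have := is_deriveZ c (is_derive_id t (1 : R)); rewrite /GRing.scale/= mulr1. Qed.

Lemma is_derive_expR_scale (c t : R) : is_derive t 1 (fun s => expR (c * s)) (expR (c * t) * c).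
Proof. exact: (is_derive1_comp (is_derive_expR (c * t)) (is_derive_mull c t)). Qed.

(** Two-sided in time, because transported functions are evaluated along the backward flow. *)
Lemma gronwall (E dE : R -> R) (c : R) : (forall t : R, is_derive t 1 E (dE t)) ->
  (forall t, `|dE t| <= c * E t) -> forall t, E t <= E 0 * expR (c * `|t|).
Proof.
move=> Ed bd t.
have D k (u : R) : is_derive u 1 (E \* (fun s => expR (k * s)))
    ((dE u + k * E u) * expR (k * u)).
  apply: (is_derive_eq (is_deriveM (Ed u) (is_derive_expR_scale k u))).
  by rewrite /GRing.scale/=; ring.
have [t0|/ltW t0] := lerP 0 t.
  have : - (E 0 * expR (- c * 0)) <= - (E t * expR (- c * t)).
    apply: (derive_nonneg_le (fun u => is_deriveN (D (- c) u)) t0) => u _.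
    rewrite -mulNr mulr_ge0 ?expR_ge0//.
    by have := bd u; rewrite ler_norml => /andP[]; lra.
  rewrite mulr0 expR0 mulr1 lerN2 => h.
  by rewrite -ler_pdivrMr ?expR_gt0// -expRN -mulNr ger0_norm.
have : E t * expR (c * t) <= E 0 * expR (c * 0).
  apply: (derive_nonneg_le (D c) t0) => u _.
  rewrite mulr_ge0 ?expR_ge0//.
  by have := bd u; rewrite ler_norml => /andP[]; lra.
rewrite mulr0 expR0 mulr1 => h.
by rewrite -ler_pdivrMr ?expR_gt0// -expRN -mulrN ler0_norm// opprK.
Qed.

Section Model.
Context {N : nat}.
Implicit Types (omega x y : 'I_N -> R) (th u v : R -> 'I_N -> R) (kappa : R).

Definition l1dist x y : R := \sum_(i < N) `|x i - y i|.

Lemma l1dist_ge0 x y : 0 <= l1dist x y.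
Proof. exact: sumr_ge0. Qed.

Lemma le_l1dist x y i : `|x i - y i| <= l1dist x y.
Proof. by rewrite /l1dist (bigD1 i)//= lerDl sumr_ge0. Qed.

Lemma l1dist_sym x y : l1dist x y = l1dist y x.
Proof. by apply: eq_bigr => i _; rewrite distrC. Qed.

Lemma l1dist_le x y (d : R) : (forall i, `|x i - y i| <= d) -> l1dist x y <= N%:R * d.
Proof.
move=> H; rewrite mulr_natl -[N in d *+ N]card_ord -sumr_const.
by apply: ler_sum => i _.
Qed.

Lemma order_param_lipschitz x y : `|order_param x - order_param y| <= l1dist x y.
Proof.
rewrite -mulrBr -sumrB normrM ger0_norm ?invr_ge0//.
have [N0|N0] := posnP N.
  by rewrite (_ : N%:R^-1 = 0) ?mul0r ?l1dist_ge0//; apply/eqP; rewrite invr_eq0 pnatr_eq0; apply/eqP.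
rewrite mulrC ler_pdivrMr ?ltr0n//.
apply: (@le_trans _ _ (l1dist x y)).
  apply: le_trans (ler_norm_sum _ _ _) _; apply: ler_sum => i _.
  by rewrite [1 + _]addrC addrKA cos_lipschitz.
by rewrite ler_peMr ?l1dist_ge0// ler1n.
Qed.

Lemma order_param_le2 x : order_param x <= 2.
Proof.
have [N0|N0] := posnP N.
  by rewrite /order_param big1 ?mulr0// => i; have := ltn_ord i; rewrite [X in (_ < X)%N]N0.
rewrite /order_param mulrC ler_pdivrMr ?ltr0n// mulr_natr -[N in 2 *+ N]card_ord -sumr_const.
by apply: ler_sum => i _; have := cos_le1 (x i); lra.
Qed.

Lemma rhs_lipschitz omega kappa x y i : 0 <= kappa ->
  `|kuramoto_rhs omega kappa x i - kuramoto_rhs omega kappa y i| <= 3 * kappa * l1dist x y.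
Proof.
move=> k0; rewrite !kuramoto_rhsE.
rewrite (_ : _ - _ = - (kappa * ((order_param x - order_param y) * sin (x i)
     + order_param y * (sin (x i) - sin (y i))))); last by ring.
rewrite normrN normrM (ger0_norm k0) (_ : 3 * _ * _ = kappa * (3 * l1dist x y)); last by ring.
rewrite ler_wpM2l//.
apply: le_trans (ler_normD _ _) _.
rewrite (normrM (_ - _)) (normrM (order_param y)).
have h1 : `|order_param x - order_param y| * `|sin (x i)| <= l1dist x y * 1.
  by rewrite ler_pM// ?order_param_lipschitz ?sin_max.
have h2 : `|order_param y| * `|sin (x i) - sin (y i)| <= 2 * l1dist x y.
  rewrite ler_pM//; first by rewrite ger0_norm ?order_param_ge0 ?order_param_le2.
  exact: le_trans (sin_lipschitz _ _) (le_l1dist _ _ _).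
by lra.
Qed.

Lemma rhs_bound omega kappa x i : 0 <= kappa ->
  `|kuramoto_rhs omega kappa x i| <= normOmega omega + 2 * kappa.
Proof.
move=> k0; rewrite kuramoto_rhsE; apply: le_trans (ler_normB _ _) _.
apply: lerD; first exact: le_normOmega.
rewrite normrM (normrM kappa) (ger0_norm k0) (ger0_norm (order_param_ge0 x)) -[leRHS]mulr1.
have R0 := order_param_ge0 x.
apply: ler_pM; rewrite ?sin_max//; first exact: mulr_ge0.
by rewrite mulrC ler_wpM2r// order_param_le2.
Qed.

Lemma sqr_sum_le (a : 'I_N -> R) : (\sum_i `|a i|) ^+ 2 <= N%:R * \sum_i a i ^+ 2.
Proof.
rewrite expr2 mulr_suml.
under eq_bigr do rewrite mulr_sumr.
apply: (@le_trans _ _ (\sum_i \sum_j (a i ^+ 2 + a j ^+ 2) / 2)).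
  apply: ler_sum => i _; apply: ler_sum => j _.
  rewrite ler_pdivlMr// -[a i ^+ 2]real_normK ?num_real// -[a j ^+ 2]real_normK ?num_real//.
  by have := sqr_ge0 (`|a i| - `|a j|); nra.
under eq_bigr do rewrite -mulr_suml big_split/= sumr_const card_ord.
by rewrite -mulr_suml big_split/= sumr_const card_ord sumrMnl -[_ *+ N]mulr_natl; lra.
Qed.

Lemma sum_sqr_le (a : 'I_N -> R) : \sum_i a i ^+ 2 <= (\sum_i `|a i|) ^+ 2.
Proof.
rewrite expr2 mulr_suml; apply: ler_sum => i _.
rewrite -[_ ^+ 2]real_normK ?num_real// expr2 ler_wpM2l//.
by rewrite (bigD1 i)//= lerDl sumr_ge0.
Qed.

(** The [l1] distance is not differentiable, so Gronwall is applied to the sum of squares; going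
    back and forth by Cauchy-Schwarz costs factors of [N]. *)
Lemma solutions_dist omega kappa x y u v : (0 < N)%N -> 0 <= kappa ->
  is_solution omega kappa x u -> is_solution omega kappa y v ->
  forall t, l1dist (u t) (v t) <= N%:R * expR (6 * kappa * N%:R * `|t|) * l1dist x y.
Proof.
move=> N0 k0 [u0 su] [v0 sv] t.
set c := 6 * kappa * N%:R.
have N1 : 1 <= N%:R :> R by rewrite ler1n.
have c0 : 0 <= c by rewrite !mulr_ge0// ler0n.
pose w s i := u s i - v s i.
pose dw s i := kuramoto_rhs omega kappa (u s) i - kuramoto_rhs omega kappa (v s) i.
have wd i (s : R) : is_derive s 1 (fun r => w r i) (dw s i) by exact: is_deriveB.
have Ed (s : R) : is_derive s 1 (fun r => \sum_i w r i ^+ 2) (\sum_i (2 * w s i * dw s i)).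
  rewrite (_ : (fun r => _) = \sum_i (fun r => w r i) ^+ 2); last first.
    by apply/funext => r; rewrite fct_sumE.
  apply: is_derive_sum => i; apply: (is_derive_eq (is_deriveX 2 (wd i s))).
have Eb s : `|\sum_i (2 * w s i * dw s i)| <= c * \sum_i w s i ^+ 2.
  apply: le_trans (ler_norm_sum _ _ _) _.
  apply: (@le_trans _ _ (\sum_i (2 * `|w s i| * (3 * kappa * l1dist (u s) (v s))))).
    apply: ler_sum => i _; rewrite !normrM ger0_norm// ler_wpM2l ?mulr_ge0//.
    exact: rhs_lipschitz.
  rewrite -mulr_suml -mulr_sumr -/(l1dist (u s) (v s)).
  have -> : 2 * l1dist (u s) (v s) * (3 * kappa * l1dist (u s) (v s)) =
     6 * kappa * l1dist (u s) (v s) ^+ 2 by ring.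
  by rewrite /c -[leRHS]mulrA ler_wpM2l ?mulr_ge0//; exact: sqr_sum_le.
have := gronwall Ed Eb t; rewrite /w u0 v0 => G.
have e1 : 1 <= expR (c * `|t|) by rewrite -expR0 ler_expR mulr_ge0.
rewrite -(@ler_pXn2r _ 2)// ?nnegrE ?mulr_ge0 ?l1dist_ge0 ?expR_ge0 ?ler0n//.
apply: le_trans (sqr_sum_le _) _.
have h : \sum_i (u t i - v t i) ^+ 2 <= l1dist x y ^+ 2 * expR (c * `|t|).
  by apply: le_trans G _; rewrite ler_wpM2r ?expR_ge0//; exact: sum_sqr_le.
apply: (@le_trans _ _ (N%:R * (l1dist x y ^+ 2 * expR (c * `|t|)))); first by rewrite ler_wpM2l.
rewrite [leRHS](_ : _ = N%:R * (l1dist x y ^+ 2 * expR (c * `|t|)) * (N%:R * expR (c * `|t|)));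
  last by ring.
have D0 := l1dist_ge0 x y.
by rewrite ler_peMr ?mulr_ege1// !mulr_ge0// ?expR_ge0 ?ler0n.
Qed.

Lemma solution_unique omega kappa x u v : (0 < N)%N -> 0 <= kappa ->
  is_solution omega kappa x u -> is_solution omega kappa x v -> u = v.
Proof.
move=> N0 k0 su sv; apply/funext => t; apply/funext => i.
have := solutions_dist N0 k0 su sv t.
rewrite [X in _ * X](_ : _ = 0) ?mulr0; last first.
  by rewrite /l1dist big1// => j _; rewrite subrr normr0.
move=> /(le_trans (le_l1dist _ _ i)); rewrite normr_le0 subr_eq0.
by move/eqP.
Qed.

(** Functions invariant under every [turn] are functions on the torus; this makes boundary terms
    cancel in the one-variable substitutions. *)
Definition turn x (i : 'I_N) : 'I_N -> R := fun j => x j + (j == i)%:R * (2 * pi).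

Lemma cos_turn x i j : cos (turn x i j) = cos (x j).
Proof.
rewrite /turn; case: eqP => _; last by rewrite mul0r addr0.
by rewrite mul1r mulr_natl cosD2pi.
Qed.

Lemma sin_turn x i j : sin (turn x i j) = sin (x j).
Proof.
rewrite /turn; case: eqP => _; last by rewrite mul0r addr0.
by rewrite mul1r mulr_natl sinD2pi.
Qed.

Lemma order_param_turn x i : order_param (turn x i) = order_param x.
Proof. by congr (_ * _); apply: eq_bigr => j _; rewrite cos_turn. Qed.

Lemma rhs_turn omega kappa x i : kuramoto_rhs omega kappa (turn x i) = kuramoto_rhs omega kappa x.
Proof. by apply/funext => j; rewrite !kuramoto_rhsE order_param_turn sin_turn. Qed.

Lemma is_solution_turn omega kappa x u i : is_solution omega kappa x u ->
  is_solution omega kappa (turn x i) (fun t => turn (u t) i).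
Proof.
move=> [u0 su]; split => [|j t]; first by rewrite u0.
rewrite rhs_turn -[kuramoto_rhs _ _ _ _]addr0 /turn.
by apply: is_deriveD; exact: su.
Qed.

Lemma is_solution_shift omega kappa x u s : is_solution omega kappa x u ->
  is_solution omega kappa (u s) (fun t => u (t + s)).
Proof.
move=> [u0 su]; split => [|j t]; first by rewrite add0r.
have D : is_derive t 1 (fun r : R => r + s) 1.
  by rewrite -[X in is_derive _ _ _ X]addr0; apply: is_deriveD.
by have := @is_derive1_comp _ _ (fun r => r + s) t _ _ (su j (t + s)) D; rewrite mulr1.
Qed.

Section Sol.
Variables (omega : 'I_N -> R) (kappa : R) (sol : ('I_N -> R) -> R -> 'I_N -> R).
Hypotheses (N0 : (0 < N)%N) (k0 : 0 <= kappa).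
Hypothesis solP : forall x, is_solution omega kappa x (sol x).

Lemma flowD x s t : sol (sol x s) t = sol x (t + s).
Proof.
have := solution_unique N0 k0 (solP (sol x s)) (is_solution_shift s (solP x)).
by move=> /(congr1 (@^~ t)).
Qed.

Lemma flow_turn x i t : sol (turn x i) t = turn (sol x t) i.
Proof.
have := solution_unique N0 k0 (solP (turn x i)) (is_solution_turn i (solP x)).
by move=> /(congr1 (@^~ t)).
Qed.

Lemma flow_lipschitz (T : R) x y t : `|t| <= T ->
  l1dist (sol x t) (sol y t) <= N%:R * expR (6 * kappa * N%:R * T) * l1dist x y.
Proof.
move=> tT; apply: le_trans (solutions_dist N0 k0 (solP x) (solP y) t) _.
by rewrite ler_wpM2r ?l1dist_ge0// ler_wpM2l// ler_expR ler_wpM2l// !mulr_ge0.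
Qed.

Lemma flow_displacement x t : l1dist (sol x t) x <= N%:R * ((normOmega omega + 2 * kappa) * `|t|).
Proof.
have [sol0 sd] := solP x.
apply: l1dist_le => i.
have := lipschitz_of_derive (sd i) (fun s => rhs_bound omega (sol x s) i k0) t 0.
by rewrite sol0 subr0.
Qed.

Lemma flow_taylor x h i : 0 <= h ->
  `|x i - h * kuramoto_rhs omega kappa x i - sol x (- h) i| <=
     3 * kappa * N%:R * (normOmega omega + 2 * kappa) * h ^+ 2.
Proof.
move=> h0; have [sol0 sd] := solP x.
have hh : - h <= 0 by rewrite oppr_le0.
have [c /andP[c1 c2] e] := mean_value (sd i) hh.
rewrite sol0 sub0r opprK in e.
rewrite (_ : _ - _ = (kuramoto_rhs omega kappa (sol x c) i - kuramoto_rhs omega kappa x i) * h);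
  last by rewrite mulrBl -e; ring.
rewrite normrM (ger0_norm h0) expr2 mulrA ler_wpM2r//.
apply: le_trans (rhs_lipschitz omega _ _ i k0) _.
rewrite -!mulrA !ler_wpM2l//; apply: le_trans (flow_displacement x c) _.
have W0 := normOmega_ge0 omega.
by rewrite !ler_wpM2l// ?addr_ge0 ?mulr_ge0// ler0_norm// lerNl.
Qed.

End Sol.
End Model.
End Flow.

(** * Means over grids and substitution *)

Section Means.
Context {R : realType}.
Implicit Types (f g q : R -> R) (a b s x : R) (n k : nat).

Lemma mean_value_in f (df : R -> R) a b : (forall x : R, a <= x <= b -> is_derive x 1 f (df x)) ->
  a <= b -> exists2 c, a <= c <= b & f b - f a = df c * (b - a).
Proof.
move=> fd ab; have [x||c] := @MVT_segment R f df a b ab.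
- by rewrite in_itv/= => /andP[/ltW ? /ltW ?]; apply: fd; apply/andP.
- apply: derivable_within_continuous => x; rewrite in_itv/= => xab.
  by have [] := fd x xab.
by rewrite in_itv/= => cab ->; exists c.
Qed.

Lemma antiderivative q a : continuous q -> exists Q, forall x : R, a < x -> is_derive x 1 Q (q x).
Proof.
move=> cq.
exists (fun x => \int[lebesgue_measure]_(t in [set` `[a, x]]) q t)%R => x ax.
have xu : x < x + 1 by rewrite ltrDl.
have qi : lebesgue_measure.-integrable `[a, x + 1] (EFin \o q).
  apply: continuous_compact_integrable; first exact: segment_compact.
  by apply: continuous_subspaceT.
have [Qd QE] := continuous_FTC1_closed xu qi ax (cq x).
by rewrite -QE derive1E; apply: DeriveDef.
Qed.

(** The sums run over [k < n.+1], so the end [pi], the same point of the torus as [- pi], is left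
    out and the nodes form a cyclic group. *)
Definition gridpt n k : R := - pi + 2 * pi * k%:R / n.+1%:R.

Definition mean1 n f : R := n.+1%:R^-1 * \sum_(k < n.+1) f (gridpt n k).

Lemma mean1_le n f g : (forall x, f x <= g x) -> mean1 n f <= mean1 n g.
Proof. by move=> H; rewrite ler_wpM2l ?invr_ge0// ler_sum. Qed.

Lemma mean1D n f g : mean1 n (fun x => f x + g x) = mean1 n f + mean1 n g.
Proof. by rewrite /mean1 big_split/= mulrDr. Qed.

Lemma mean1Z n (c : R) f : mean1 n (fun x => c * f x) = c * mean1 n f.
Proof. by rewrite /mean1 -mulr_sumr mulrCA. Qed.

Lemma mean1_cst n (c : R) : mean1 n (fun _ => c) = c.
Proof. by rewrite /mean1 sumr_const card_ord -[c *+ _]mulr_natl mulKf// pnatr_eq0. Qed.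

Lemma gridptS n k : gridpt n k.+1 - gridpt n k = 2 * pi / n.+1%:R.
Proof. by rewrite /gridpt -natr1; field; rewrite addrC natr1 pnatr_eq0. Qed.

Lemma gridpt0 n : gridpt n 0 = - pi. Proof. by rewrite /gridpt mulr0 mul0r addr0. Qed.

Lemma gridptn n : gridpt n n.+1 = pi.
Proof. by rewrite /gridpt mulfK ?pnatr_eq0//; ring. Qed.

Lemma gridpt_in n k : (k <= n.+1)%N -> - pi <= gridpt n k <= pi.
Proof.
move=> kn; have p0 := @pi_gt0 R.
have h0 : 0 <= 2 * pi * k%:R / n.+1%:R :> R by rewrite !mulr_ge0 ?invr_ge0// ltW.
have h1 : 2 * pi * k%:R / n.+1%:R <= 2 * pi :> R.
  by rewrite ler_pdivrMr ?ltr0n// ler_pM2l ?mulr_gt0// ler_nat.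
by rewrite /gridpt; move: (_ / _) h0 h1 => X h0 h1; lra.
Qed.

Lemma riemann_mean n (Psi psi : R -> R) (L : R) :
  (forall x : R, - pi <= x <= pi -> is_derive x 1 Psi (psi x)) ->
  (forall x y, `|psi x - psi y| <= L * `|x - y|) ->
  `|mean1 n psi - (Psi pi - Psi (- pi)) / (2 * pi)| <= L * (2 * pi) / n.+1%:R.
Proof.
move=> Pd psiL; have p0 := @pi_gt0 R.
have n0 : 0 < n.+1%:R :> R by rewrite ltr0n.
have L0 : 0 <= L by have := psiL 1 0; rewrite subr0 normr1 mulr1; apply: le_trans.
have -> : Psi pi - Psi (- pi) = \sum_(k < n.+1) (Psi (gridpt n k.+1) - Psi (gridpt n k)).
  rewrite -(big_mkord xpredT (fun k => Psi (gridpt n k.+1) - Psi (gridpt n k))).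
  by rewrite (telescope_sumr (fun k => Psi (gridpt n k)))// gridpt0 gridptn.
rewrite /mean1 mulr_sumr mulr_suml -sumrB.
apply: le_trans (ler_norm_sum _ _ _) _.
apply: (@le_trans _ _ (\sum_(k < n.+1) (n.+1%:R^-1 * (L * (2 * pi) / n.+1%:R)))); last first.
  by rewrite sumr_const card_ord -[leLHS]mulr_natl mulVKf// gt_eqF.
apply: ler_sum => k _.
have kk : gridpt n k <= gridpt n k.+1 by rewrite -subr_ge0 gridptS divr_ge0 ?mulr_ge0// ltW.
have /andP[g0 _] := @gridpt_in n k (ltnW (ltn_ord k)).
have /andP[_ g1] := @gridpt_in n k.+1 (ltn_ord k).
have [|c /andP[c1 c2] ->] := @mean_value_in Psi psi (gridpt n k) (gridpt n k.+1) _ kk.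
  by move=> x /andP[x1 x2]; apply: Pd; apply/andP; split; lra.
rewrite gridptS (_ : _ - _ = n.+1%:R^-1 * (psi (gridpt n k) - psi c)); last first.
  have cancel (u v w z : R) : 0 < w -> 0 < z -> z^-1 * u - v * (w / z) / w = z^-1 * (u - v).
    by move=> ? ?; field; rewrite !gt_eqF.
  by apply: cancel => //; rewrite mulr_gt0.
rewrite normrM ger0_norm ?invr_ge0 ?(ltW n0)// ler_wpM2l ?invr_ge0 ?(ltW n0)//.
apply: le_trans (psiL _ _) _; rewrite -mulrA ler_wpM2l//.
by rewrite -(gridptS n k) ler0_norm; lra.
Qed.

Lemma antiderivative_period (Q g : R -> R) a b c : (forall x : R, a < x -> is_derive x 1 Q (g x)) ->
  (forall x, g (x + 2 * pi) = g x) -> a < b -> b <= c ->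
  Q (c + 2 * pi) - Q c = Q (b + 2 * pi) - Q b.
Proof.
move=> Qd gper ab bc; have p0 := @pi_gt0 R.
have D x : b <= x <= c -> is_derive x 1 (fun y => Q (y + 2 * pi) - Q y) 0.
  move=> /andP[bx _].
  have D1 : is_derive x 1 (fun r : R => r + 2 * pi) 1.
    by rewrite -[X in is_derive _ _ _ X]addr0; apply: is_deriveD.
  have ax2 : a < x + 2 * pi by lra.
  have D2 := @is_derive1_comp _ _ (fun r => r + 2 * pi) x _ _ (Qd _ ax2) D1.
  rewrite -[X in is_derive _ _ _ X](subrr (g x)) -{1}(gper x) -[g (x + _)]mulr1.
  by apply: is_deriveB => //; apply: Qd; lra.
have [d _] := mean_value_in D bc.
by rewrite mul0r => /eqP; rewrite subr_eq0 => /eqP.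
Qed.

Lemma lipschitz_continuous (g : R -> R) (L : R) : (forall x y, `|g x - g y| <= L * `|x - y|) ->
  continuous g.
Proof.
move=> gL x; apply/cvgrPdist_le => e e0.
have L0 : 0 <= L by have := gL 1 0; rewrite subr0 normr1 mulr1; apply: le_trans.
near=> y; apply: le_trans (gL _ _) _.
have : `|x - y| <= e / (L + 1).
  by near: y; apply: cvgr_dist_le; [exact: cvg_id|rewrite divr_gt0//; lra].
rewrite ler_pdivlMr; last by lra.
by have := normr_ge0 (x - y); nra.
Unshelve. all: by end_near.
Qed.

(* Integrating [g(f(s)) f'(s)] over a period gives the same value as [g], since
   [f(pi) = f(-pi) + 2 pi]; the weight [f' = 1 - h F'] produces the first-order term. *)
Lemma mean1_substitution n g (F dF : R -> R) (L M H h : R) : 0 <= L -> 0 <= M -> 0 <= h <= H ->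
  (forall x, `|g x| <= 1) -> (forall x y, `|g x - g y| <= L * `|x - y|) ->
  (forall x, g (x + 2 * pi) = g x) ->
  (forall x : R, is_derive x 1 F (dF x)) -> F (- pi) = F pi ->
  (forall x, `|F x| <= M) -> (forall x, `|dF x| <= M) ->
  (forall x y, `|dF x - dF y| <= M * `|x - y|) ->
  mean1 n g + h * mean1 n (fun s => g s * dF s)
    - (L * M ^+ 2 * h ^+ 2 + (L * (1 + H * M) ^+ 2 + H * M + L) * (2 * pi) / n.+1%:R)
  <= mean1 n (fun s => g (s - h * F s)).
Proof.
move=> L0 M0 /andP[h0 hH] g1 gL gper Fd Fpi FM dFM dFL.
have p0 := @pi_gt0 R.
have H0 : 0 <= H by lra.
have hM : 0 <= h * M by rewrite mulr_ge0.
have hMH : h * M <= H * M by rewrite ler_wpM2r.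
pose f s := s - h * F s.
have fd s : is_derive s 1 f (1 - h * dF s).
  rewrite (_ : f = id \- (h *: F)); last by apply/funext => x.
  exact: is_deriveB.
have hF s : `|h * F s| <= h * M by rewrite normrM (ger0_norm h0) ler_wpM2l.
have hdF s : `|h * dF s| <= h * M by rewrite normrM (ger0_norm h0) ler_wpM2l.
(* [a] lies to the left of [- pi] and of every [f s] with [s >= - pi], so the primitive [Q] is
   differentiable wherever it is evaluated. *)
pose a := - pi - h * M - 1.
have cg := lipschitz_continuous gL.
have [Q Qd] := antiderivative a cg.
have af s : - pi <= s -> a < f s.
  by move=> s1; have := hF s; rewrite /f /a ler_norml => /andP[]; lra.
have fpi : f pi = f (- pi) + 2 * pi by rewrite /f Fpi; ring.
have period b c (ab : a < b) (bc : b <= c) := antiderivative_period Qd gper ab bc.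
pose c0 := (Q pi - Q (- pi)) / (2 * pi).
(* [f] maps [[-pi, pi]] onto another full period, over which [g] has the same integral. *)
have c0E : (Q (f pi) - Q (f (- pi))) / (2 * pi) = c0.
  congr (_ / _); rewrite fpi; have -> : Q pi = Q (- pi + 2 * pi) by congr Q; ring.
  have aN : a < - pi by rewrite /a; lra.
  have [le|/ltW le] := lerP (- pi) (f (- pi)); first exact: period.
  by rewrite -(period _ _ _ le)// af.
have S1 := @riemann_mean n Q g L.
have {}S1 := S1 (fun x xp => Qd x ltac:(rewrite /a; lra)) gL; rewrite -/c0 in S1.
have fL x y : `|f x - f y| <= (1 + H * M) * `|x - y|.
  apply: (lipschitz_of_derive fd) => s; apply: le_trans (ler_normB _ _) _.
  by rewrite normr1; have := hdF s; lra.
have wL x y : `|g (f x) * (1 - h * dF x) - g (f y) * (1 - h * dF y)|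
    <= (L * (1 + H * M) ^+ 2 + H * M) * `|x - y|.
  rewrite (_ : _ - _ = (g (f x) - g (f y)) * (1 - h * dF x)
     + g (f y) * (h * (dF y - dF x))); last by ring.
  apply: le_trans (ler_normD _ _) _; rewrite !normrM (ger0_norm h0).
  have h1 : `|1 - h * dF x| <= 1 + H * M.
    by apply: le_trans (ler_normB _ _) _; rewrite normr1; have := hdF x; lra.
  have h2 : `|g (f x) - g (f y)| <= L * ((1 + H * M) * `|x - y|).
    by apply: le_trans (gL _ _) _; rewrite ler_wpM2l.
  have h3 : h * `|dF y - dF x| <= H * (M * `|x - y|).
    by apply: ler_pM => //; rewrite distrC dFL.
  have h4 : `|g (f x) - g (f y)| * `|1 - h * dF x| <= L * ((1 + H * M) * `|x - y|) * (1 + H * M).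
    exact: ler_pM.
  have h5 : `|g (f y)| * (h * `|dF y - dF x|) <= 1 * (H * (M * `|x - y|)).
    by apply: ler_pM => //; rewrite mulr_ge0.
  by lra.
have S2 := @riemann_mean n (Q \o f) (fun s => g (f s) * (1 - h * dF s)) _ _ wL.
have {}S2 := S2 (fun x xp => is_derive1_comp (Qd _ (af x ltac:(lra))) (fd x)).
rewrite /= c0E in S2.
have e : mean1 n (fun s => g (f s)) =
    mean1 n (fun s => g (f s) * (1 - h * dF s)) + h * mean1 n (fun s => g (f s) * dF s).
  by rewrite -mean1Z -mean1D; congr mean1; apply/funext => s; ring.
(* Replacing [f s] by [s] in the first-order term costs [O(h)], hence [O(h^2)] after the factor
   [h]. *)
have S3 : mean1 n (fun s => g s * dF s) - L * M ^+ 2 * h <= mean1 n (fun s => g (f s) * dF s).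
  rewrite -[X in _ - X](mean1_cst n) -mulN1r -mean1Z -mean1D; apply: mean1_le => s.
  rewrite -subr_ge0 (_ : _ - _ = (g (f s) - g s) * dF s + L * M ^+ 2 * h); last by ring.
  have : `|(g (f s) - g s) * dF s| <= L * (h * M) * M.
    rewrite normrM; apply: ler_pM => //; apply: le_trans (gL _ _) _.
    by rewrite ler_wpM2l// /f addrAC subrr add0r normrN.
  by rewrite ler_norml => /andP[]; lra.
have {}S3 := ler_wpM2l h0 S3.
move: S1 S2; rewrite !ler_norml => /andP[_ S1] /andP[S2 _].
rewrite e; move: S1 S2 S3; move: (n.+1%:R^-1 : R) (mean1 _ _) => ni m1.
by move: (mean1 _ _) (mean1 _ _) (mean1 _ _) => m2 m3 m4; lra.
Qed.

End Means.

(** * Grid means on the torus and reduction to one coordinate *)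

Section GridMean.
Context {R : realType} {N : nat}.
Implicit Types (p q : ('I_N -> R) -> R) (x y : 'I_N -> R) (i j : 'I_N) (n : nat).

Definition upd x i (s : R) : 'I_N -> R := fun j => if j == i then s else x j.

Definition grid n (k : {ffun 'I_N -> 'I_n.+1}) : 'I_N -> R := fun i => gridpt n (k i).

Definition gmean n p : R := (n.+1%:R ^+ N)^-1 * \sum_(k : {ffun 'I_N -> 'I_n.+1}) p (grid k).

Lemma gmean_le n p q : (forall x, p x <= q x) -> gmean n p <= gmean n q.
Proof. by move=> H; rewrite ler_wpM2l ?invr_ge0 ?exprn_ge0// ler_sum. Qed.

Lemma gmeanD n p q : gmean n (fun x => p x + q x) = gmean n p + gmean n q.
Proof. by rewrite /gmean big_split/= mulrDr. Qed.

Lemma gmeanZ n (c : R) p : gmean n (fun x => c * p x) = c * gmean n p.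
Proof. by rewrite /gmean -mulr_sumr mulrCA. Qed.

Lemma gmean_cst n (c : R) : gmean n (fun _ => c) = c.
Proof.
rewrite /gmean sumr_const card_ffun !card_ord -[c *+ _]mulr_natl natrX mulKf//.
Qed.

Lemma gmean_sum n (I : Type) (r : seq I) (F : I -> ('I_N -> R) -> R) :
  gmean n (fun x => \sum_(i <- r) F i x) = \sum_(i <- r) gmean n (F i).
Proof. by rewrite /gmean exchange_big/= mulr_sumr. Qed.

Lemma gmean_prod n (f : R -> R) : gmean n (fun x => \prod_i f (x i)) = mean1 n f ^+ N.
Proof.
rewrite /gmean /mean1 exprMn exprVn; congr (_ * _).
rewrite -[N in RHS]card_ord -prodr_const bigA_distr_bigA/=.
by apply: eq_bigr.
Qed.

(* Cyclic translations of the grid along one coordinate permute it. *)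
Lemma gmean_coord n p i : gmean n p = gmean n (fun x => mean1 n (fun s => p (upd x i s))).
Proof.
pose sh (j : 'I_n.+1) (k : {ffun 'I_N -> 'I_n.+1}) : {ffun 'I_N -> 'I_n.+1} :=
  [ffun l => if l == i then k l + j else k l].
have shK (j : 'I_n.+1) : bijective (sh j).
  by exists (sh (- j)) => k; apply/ffunP => l; rewrite !ffunE; case: eqP => // _;
    rewrite ?addrK ?subrK.
have inv (j : 'I_n.+1) : \sum_(k : {ffun 'I_N -> 'I_n.+1}) p (grid k) = \sum_k p (grid (sh j k)).
  exact: (reindex_inj (bij_inj (shK j))).
rewrite /gmean; congr (_ * _).
rewrite -mulr_sumr exchange_big/=.
have -> : \sum_(k : {ffun 'I_N -> 'I_n.+1}) p (grid k) = n.+1%:R^-1 * \sum_(j < n.+1) \sum_k p (grid (sh j k)).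
  under [in RHS]eq_bigr => j _ do rewrite -(inv j).
  by rewrite sumr_const card_ord -[X in _ = _ * X]mulr_natl mulKf// pnatr_eq0.
congr (_ * _); rewrite exchange_big [RHS]exchange_big/=; apply: eq_bigr => k _.
rewrite [RHS](reindex_inj (addrI (k i)))/=.
apply: eq_bigr => j _; congr p; apply/funext => l.
by rewrite /upd /grid !ffunE; case: eqP => [->|].
Qed.

Lemma gmean_le_coord n p q i (e : R) :
  (forall x, mean1 n (fun s => p (upd x i s)) <= mean1 n (fun s => q (upd x i s)) + e) ->
  gmean n p <= gmean n q + e.
Proof.
move=> H; rewrite (gmean_coord n p i) (gmean_coord n q i) -[X in _ + X](gmean_cst n e) -gmeanD.
exact: gmean_le.
Qed.

Definition periodic_all p := forall x i, p (turn x i) = p x.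
Definition lipschitz_all (L : R) p := forall x y, `|p x - p y| <= L * l1dist x y.

End GridMean.

(** * The divergence and partial Euler steps *)

Section Step.
Context {R : realType} {N : nat}.
Implicit Types (p q : ('I_N -> R) -> R) (x y : 'I_N -> R) (i j : 'I_N) (n m : nat)
  (omega : 'I_N -> R) (kappa h : R).

Lemma updE x i s : upd x i s i = s.
Proof. by rewrite /upd eqxx. Qed.

Lemma upd_turn x i s : upd x i (s + 2 * pi) = turn (upd x i s) i.
Proof. by apply/funext => j; rewrite /upd /turn; case: eqP; rewrite ?mul1r// mul0r addr0. Qed.

Lemma l1dist_upd x i s t : l1dist (upd x i s) (upd x i t) = `|s - t|.
Proof.
rewrite /l1dist (bigD1 i)//= !updE big1 ?addr0// => j /negbTE ji.
by rewrite /upd ji subrr normr0.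
Qed.

(** The derivative of the [i]-th component of the field in its own coordinate; the [sin^2] term
    comes from the dependence of the order parameter on [x i]. *)
Definition partial_div kappa x i : R :=
  - (kappa * order_param x * cos (x i)) + kappa / N%:R * sin (x i) ^+ 2.

Lemma is_derive_rhs omega kappa x i (s : R) :
  is_derive s 1 (fun r => kuramoto_rhs omega kappa (upd x i r) i) (partial_div kappa (upd x i s) i).
Proof.
have D : is_derive s 1 (fun r => order_param (upd x i r)) (N%:R^-1 * - sin s).
  have dj j : is_derive s 1 (fun r => upd x i r j) (j == i)%:R.
    rewrite /upd; case: eqP => _; [exact: is_derive_id|exact: is_derive_cst].
  have := is_derive_order_param (v := fun r j => (j == i)%:R) dj.
  rewrite (bigD1 i)//= eqxx mulr1 updE big1 ?addr0// => j /negbTE ->.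
  by rewrite mulr0.
rewrite (_ : (fun r => _) = cst (omega i) \-
    (kappa *: ((fun r => order_param (upd x i r)) * sin))); last first.
  by apply/funext => r; rewrite kuramoto_rhsE updE !fctE/= /GRing.scale/=; ring.
apply: (is_derive_eq (is_deriveB (is_derive_cst _ _ _) (is_deriveZ kappa (is_deriveM D (is_derive_sin s))))).
by rewrite /partial_div updE /GRing.scale/=; ring.
Qed.

Lemma partial_div_bound kappa x i : 0 <= kappa -> `|partial_div kappa x i| <= 3 * kappa.
Proof.
move=> k0; have R0 := order_param_ge0 x; have R2 := order_param_le2 x.
have N1 : (0 < N)%N := leq_ltn_trans (leq0n i) (ltn_ord i).
apply: le_trans (ler_normD _ _) _; rewrite normrN.
have h1 : `|kappa * order_param x * cos (x i)| <= kappa * 2 * 1.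
  rewrite normrM (ger0_norm (mulr_ge0 k0 R0)); apply: ler_pM; rewrite ?cos_max//.
    exact: mulr_ge0.
  by rewrite ler_wpM2l.
have h2 : `|kappa / N%:R * sin (x i) ^+ 2| <= kappa * 1 * 1.
  rewrite normrM normrX; apply: ler_pM; rewrite ?exprn_ile1 ?sin_max//.
  by rewrite ger0_norm ?divr_ge0// ler_wpM2l// invf_le1 ?ltr0n ?ler1n.
by lra.
Qed.

Lemma partial_div_lipschitz kappa x y i : 0 <= kappa ->
  `|partial_div kappa x i - partial_div kappa y i| <= 5 * kappa * l1dist x y.
Proof.
move=> k0; have R0 := order_param_ge0 y; have R2 := order_param_le2 y.
have N1 : (0 < N)%N := leq_ltn_trans (leq0n i) (ltn_ord i).
rewrite (_ : _ - _ = - (kappa * ((order_param x - order_param y) * cos (x i)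
     + order_param y * (cos (x i) - cos (y i)))) +
     kappa * (N%:R^-1 * ((sin (x i) + sin (y i)) * (sin (x i) - sin (y i))))); last first.
  by rewrite /partial_div; ring.
have d0 := l1dist_ge0 x y; have di := le_l1dist x y i.
have h1 : `|(order_param x - order_param y) * cos (x i)| <= l1dist x y * 1.
  by rewrite normrM ler_pM// ?order_param_lipschitz ?cos_max.
have h2 : `|order_param y * (cos (x i) - cos (y i))| <= 2 * l1dist x y.
  rewrite normrM (ger0_norm R0) ler_pM//.
  exact: le_trans (cos_lipschitz _ _) di.
have h3 : `|N%:R^-1 * ((sin (x i) + sin (y i)) * (sin (x i) - sin (y i)))| <= 1 * (2 * l1dist x y).
  rewrite normrM; apply: ler_pM => //.
    by rewrite ger0_norm ?invr_ge0// invf_le1 ?ltr0n ?ler1n.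
  rewrite normrM; apply: ler_pM => //; last exact: le_trans (sin_lipschitz _ _) di.
  apply: le_trans (ler_normD _ _) _.
  by have := sin_max (x i); have := sin_max (y i); lra.
apply: le_trans (ler_normD _ _) _; rewrite normrN (normrM kappa) [X in _ + X](normrM kappa) (ger0_norm k0).
rewrite -mulrDr (mulrC 5) -(mulrA kappa) ler_wpM2l//.
by have := ler_normD ((order_param x - order_param y) * cos (x i))
   (order_param y * (cos (x i) - cos (y i))); lra.
Qed.

(** Since the cosines sum to [N (R - 1)], the first terms add up to the left side exactly; the
    [sin^2] terms are nonnegative and are dropped. *)
Lemma sum_partial_div kappa x : (0 < N)%N -> 0 <= kappa ->
  kappa * N%:R * (order_param x * (1 - order_param x)) <= \sum_i partial_div kappa x i.
Proof.
move=> N0 k0; have n0 : N%:R != 0 :> R by rewrite pnatr_eq0 -lt0n.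
have e : \sum_i cos (x i) = N%:R * (order_param x - 1).
  rewrite mulrBr mulr1 /order_param mulVKf// big_split/= sumr_const card_ord.
  by rewrite addrAC subrr add0r.
rewrite /partial_div big_split/= sumrN -mulr_sumr e.
rewrite -[leLHS]addr0; apply: lerD; first by rewrite le_eqVlt; apply/orP; left; apply/eqP; ring.
by apply: sumr_ge0 => i _; rewrite mulr_ge0 ?sqr_ge0// divr_ge0.
Qed.

(** Interpolates between the identity at [m = 0] and the full backward Euler step at [m = N]; all
    velocities are taken at the original point. *)
Definition euler_partial omega kappa h m x : 'I_N -> R :=
  fun j => if (j < m)%N then x j - h * kuramoto_rhs omega kappa x j else x j.

Lemma euler_partial_displacement omega kappa h m x : 0 <= kappa -> 0 <= h ->
  l1dist (euler_partial omega kappa h m x) x <= N%:R * (h * (normOmega omega + 2 * kappa)).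
Proof.
move=> k0 h0; have W0 := normOmega_ge0 omega.
apply: l1dist_le => i; rewrite /euler_partial; case: ifP => _.
  by rewrite addrAC subrr add0r normrN normrM (ger0_norm h0) ler_wpM2l// rhs_bound.
by rewrite subrr normr0 mulr_ge0// addr_ge0// mulr_ge0.
Qed.

Lemma euler_partial_lipschitz omega kappa h m x y : 0 <= kappa -> 0 <= h ->
  l1dist (euler_partial omega kappa h m x) (euler_partial omega kappa h m y)
    <= (1 + h * (N%:R * (3 * kappa))) * l1dist x y.
Proof.
move=> k0 h0.
apply: (@le_trans _ _ (\sum_i (`|x i - y i| + h * (3 * kappa * l1dist x y)))).
  have d0 := l1dist_ge0 x y.
  apply: ler_sum => i _; rewrite /euler_partial; case: ifP => _; last first.
    by rewrite lerDl !mulr_ge0.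
  rewrite (_ : _ - _ = (x i - y i) - h * (kuramoto_rhs omega kappa x i - kuramoto_rhs omega kappa y i));
    last by ring.
  apply: le_trans (ler_normB _ _) _.
  by rewrite lerD2l normrM (ger0_norm h0) ler_wpM2l// rhs_lipschitz.
rewrite big_split/= sumr_const card_ord -/(l1dist x y) -[_ *+ N]mulr_natl.
by lra.
Qed.

Lemma euler_partial_turn omega kappa h m x i :
  euler_partial omega kappa h m (turn x i) = turn (euler_partial omega kappa h m x) i.
Proof.
apply/funext => j; rewrite /euler_partial rhs_turn /turn; case: ifP => // _.
by rewrite addrAC.
Qed.

(** Moving coordinate [i] beforehand displaces by [O(h)] the point at which the earlier velocities
    are evaluated, and these velocities are multiplied by [h]. *)
Lemma euler_partialS omega kappa h (i : 'I_N) x : 0 <= kappa -> 0 <= h ->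
  l1dist (euler_partial omega kappa h i (upd x i (x i - h * kuramoto_rhs omega kappa x i)))
         (euler_partial omega kappa h i.+1 x)
  <= N%:R * (3 * kappa * (normOmega omega + 2 * kappa) * h ^+ 2).
Proof.
move=> k0 h0; have W0 := normOmega_ge0 omega; set z := upd _ _ _.
have zx : l1dist z x <= h * (normOmega omega + 2 * kappa).
  have -> : x = upd x i (x i) by apply/funext => j; rewrite /upd; case: eqP => [->|].
  rewrite /z l1dist_upd.
  by rewrite [_ - h * _]addrC addrK normrN normrM (ger0_norm h0) ler_wpM2l// rhs_bound.
have pos : 0 <= 3 * kappa * (normOmega omega + 2 * kappa) * h ^+ 2.
  by rewrite !mulr_ge0 ?sqr_ge0// addr_ge0// mulr_ge0.
apply: l1dist_le => j; rewrite /euler_partial ltnS (leq_eqVlt j).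
have [/val_inj ->|ne] := eqVneq (j : nat) i.
  by rewrite ltnn /= /z updE subrr normr0.
have ji : (j == i) = false by apply/negbTE; rewrite -val_eqE.
have zj : z j = x j by rewrite /z /upd ji.
case: ifP => _; rewrite zj ?subrr ?normr0//.
rewrite (_ : _ - _ = h * (kuramoto_rhs omega kappa x j - kuramoto_rhs omega kappa z j)); last by ring.
rewrite normrM (ger0_norm h0) distrC.
apply: le_trans (ler_wpM2l h0 (rhs_lipschitz omega z x j k0)) _.
rewrite (_ : _ * h ^+ 2 = h * (3 * kappa * (h * (normOmega omega + 2 * kappa)))); last by ring.
by rewrite !ler_wpM2l// mulr_ge0.
Qed.

End Step.

Section StepEstimate.
Context {R : realType} {N : nat}.
Implicit Types (p q : ('I_N -> R) -> R) (x y : 'I_N -> R) (i j : 'I_N) (n m : nat)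
  (omega : 'I_N -> R) (kappa h L H : R).

Lemma upd_upd x i s t : upd (upd x i s) i t = upd x i t.
Proof. by apply/funext => j; rewrite /upd; case: eqP. Qed.

(** Coordinate [i] is averaged first with the others frozen, and [mean1_substitution] applies to the
    [i]-th component of the field. [C] is fixed before [q], [h] and [n], so that [n] can later go to
    infinity before [h] goes to [0]. *)
Lemma gmean_coordinate_step omega kappa L H : 0 <= kappa -> 0 <= L -> 0 <= H ->
  exists2 C, 0 <= C & forall q h n i,
    periodic_all q -> lipschitz_all L q -> (forall x, 0 <= q x <= 1) -> 0 <= h <= H ->
    gmean n (fun x => q (euler_partial omega kappa h i x))
      + h * gmean n (fun x => q x * partial_div kappa x i)
    <= gmean n (fun x => q (euler_partial omega kappa h i.+1 x)) + C * (h ^+ 2 + n.+1%:R^-1).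
Proof.
move=> k0 L0 H0; have W0 := normOmega_ge0 omega; have p0 := @pi_gt0 R.
pose W := normOmega omega + 2 * kappa.
(* One constant for three bounds: [|F| <= |Omega| + 2 kappa], [|dF| <= 3 kappa], and the Lipschitz
   constant [5 kappa] of [dF]. *)
pose M := normOmega omega + 5 * kappa.
pose L' := L * (1 + H * (N%:R * (3 * kappa))).
have W0' : 0 <= W by rewrite addr_ge0// mulr_ge0.
have M0 : 0 <= M by rewrite addr_ge0// mulr_ge0.
have L'0 : 0 <= L' by rewrite mulr_ge0// addr_ge0// !mulr_ge0.
pose C1 := L' * M ^+ 2 + L * (N%:R * (3 * kappa * W)) + L * (N%:R * W) * M.
pose C2 := (L' * (1 + H * M) ^+ 2 + H * M + L') * (2 * pi).
have C10 : 0 <= C1 by rewrite !(addr_ge0, sqr_ge0, mulr_ge0).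
have C20 : 0 <= C2.
  by rewrite !(ltW p0, addr_ge0, sqr_ge0, mulr_ge0).
exists (C1 + C2); first exact: addr_ge0.
move=> q h n i qper qlip q01 /andP[h0 hH].
rewrite -gmeanZ -gmeanD; apply: (@gmean_le_coord _ _ n _ _ i) => x.
pose g s := q (euler_partial omega kappa h i (upd x i s)).
pose F s := kuramoto_rhs omega kappa (upd x i s) i.
pose dF s := partial_div kappa (upd x i s) i.
have g01 s : 0 <= g s <= 1 by exact: q01.
have g1 s : `|g s| <= 1 by have /andP[? ?] := g01 s; rewrite ger0_norm.
have gL s t : `|g s - g t| <= L' * `|s - t|.
  apply: le_trans (qlip _ _) _; rewrite -mulrA ler_wpM2l//.
  apply: le_trans (euler_partial_lipschitz _ _ _ _ k0 h0) _.
  by rewrite l1dist_upd ler_wpM2r// lerD2l ler_wpM2r// !mulr_ge0.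
have gper s : g (s + 2 * pi) = g s by rewrite /g upd_turn euler_partial_turn qper.
have Fpi : F (- pi) = F pi.
  have e : pi = - pi + 2 * pi :> R by ring.
  by rewrite /F [in RHS]e upd_turn rhs_turn.
have Wb s : `|F s| <= W by exact: rhs_bound.
have FM s : `|F s| <= M by apply: le_trans (Wb s) _; rewrite /W /M; lra.
have dFM s : `|dF s| <= M.
  by apply: le_trans (partial_div_bound (upd x i s) i k0) _; rewrite /M; lra.
have dFL s t : `|dF s - dF t| <= M * `|s - t|.
  apply: le_trans (partial_div_lipschitz _ _ _ k0) _.
  by rewrite l1dist_upd ler_wpM2r// /M; lra.
have hH' : 0 <= h <= H by rewrite h0.
have S := mean1_substitution n L'0 M0 hH' g1 gL gper (is_derive_rhs omega kappa x i) Fpi FM dFM dFL.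
have A1 : mean1 n (fun s => g (s - h * F s)) - L * (N%:R * (3 * kappa * W)) * h ^+ 2 <=
    mean1 n (fun s => q (euler_partial omega kappa h i.+1 (upd x i s))).
  rewrite -[X in _ - X](mean1_cst n) -mulN1r -mean1Z -mean1D; apply: mean1_le => s.
  rewrite mulN1r lerBlDl -lerBlDr.
  apply: le_trans (ler_norm _) _; apply: le_trans (qlip _ _) _.
  rewrite -mulrA ler_wpM2l//.
  have := euler_partialS omega i (upd x i s) k0 h0.
  by rewrite upd_upd updE -/W => /le_trans; apply; rewrite le_eqVlt; apply/orP; left; apply/eqP; ring.
(* The weight is brought back from the partially moved point to [x], so that the contributions of
   all coordinates share the factor [q x] and add up to the divergence. *)
have A2 : mean1 n (fun s => q (upd x i s) * dF s) - L * (N%:R * W) * M * h <=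
    mean1 n (fun s => g s * dF s).
  rewrite -[X in _ - X](mean1_cst n) -mulN1r -mean1Z -mean1D; apply: mean1_le => s.
  rewrite mulN1r lerBlDl -lerBlDr -mulrBl.
  apply: le_trans (ler_norm _) _; rewrite normrM.
  rewrite (_ : _ * h = L * (N%:R * (h * W)) * M); last by ring.
  apply: ler_pM => //; apply: le_trans (qlip _ _) _.
  by rewrite ler_wpM2l// l1dist_sym; exact: euler_partial_displacement.
have {}A2 := ler_wpM2l h0 A2.
rewrite mean1D mean1Z -/g -/dF.
have hn : 0 <= (n.+1%:R^-1 : R) by rewrite invr_ge0.
have C1n := mulr_ge0 C10 hn; have C2h := mulr_ge0 C20 (sqr_ge0 h).
move: S A1 A2 C1n C2h; rewrite /C1 -/C2 -/(dF) -/F.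
move: (mean1 _ _) (mean1 _ _) (mean1 _ _) (mean1 _ _) (mean1 _ _) (n.+1%:R^-1) => m1 m2 m3 m4 m5 ni.
by lra.
Qed.

(** Discrete, one-sided form of the change of variables under the flow. The coordinate steps
    telescope from the identity to the full Euler step, which [flow_taylor] compares with the
    flow. *)
Lemma gmean_step omega kappa (sol : ('I_N -> R) -> R -> 'I_N -> R) L H :
  (0 < N)%N -> (forall x, is_solution omega kappa x (sol x)) ->
  0 <= kappa -> 0 <= L -> 0 <= H ->
  exists2 C, 0 <= C & forall q h n,
    periodic_all q -> lipschitz_all L q -> (forall x, 0 <= q x <= 1) -> 0 <= h <= H ->
    gmean n q + h * gmean n (fun x => q x * \sum_i partial_div kappa x i)
    <= gmean n (fun x => q (sol x (- h))) + C * (h ^+ 2 + n.+1%:R^-1).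
Proof.
move=> N0 solP k0 L0 H0; have W0 := normOmega_ge0 omega.
have [C C0 HC] := gmean_coordinate_step omega k0 L0 H0.
pose C1 := L * (N%:R * (3 * kappa * N%:R * (normOmega omega + 2 * kappa))).
have C10 : 0 <= C1 by rewrite !mulr_ge0// addr_ge0// mulr_ge0.
exists (N%:R * C + C1) => [|q h n qper qlip q01 h0H]; first by rewrite addr_ge0// mulr_ge0.
have /andP[h0 hH] := h0H.
pose D m := gmean n (fun x => q (euler_partial omega kappa h m x)).
have D0 : D 0%N = gmean n q by congr gmean; apply/funext => x; congr q; apply/funext.
have DN : D N - D 0%N = \sum_(i < N) (D i.+1 - D i).
  by rewrite -(big_mkord xpredT (fun k => D k.+1 - D k)) (telescope_sumr D).
have lower : h * gmean n (fun x => q x * \sum_i partial_div kappa x i)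
    - N%:R * (C * (h ^+ 2 + n.+1%:R^-1)) <= D N - D 0%N.
  rewrite DN; under [X in gmean n X]eq_fun do rewrite mulr_sumr.
  rewrite gmean_sum mulr_sumr [X in _ - X](_ : _ = \sum_(i < N) C * (h ^+ 2 + n.+1%:R^-1)); last first.
    by rewrite sumr_const card_ord mulr_natl.
  rewrite -sumrB; apply: ler_sum => i _.
  have := HC q h n i qper qlip q01 h0H; rewrite /D.
  by move: (gmean _ _) (gmean _ _) (gmean _ _) (C * _) => a b c d; lra.
have last_step : D N - C1 * h ^+ 2 <= gmean n (fun x => q (sol x (- h))).
  rewrite -[X in _ - X](@gmean_cst R N n) -mulN1r -gmeanZ -gmeanD; apply: gmean_le => x.
  rewrite mulN1r lerBlDl -lerBlDr.
  apply: le_trans (ler_norm _) _; apply: le_trans (qlip _ _) _.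
  rewrite -mulrA ler_wpM2l// -mulrA; apply: l1dist_le => j.
  rewrite /euler_partial ltn_ord; exact: flow_taylor.
have C1n : 0 <= C1 * n.+1%:R^-1 by rewrite mulr_ge0.
clear DN; move: lower last_step C1n; rewrite D0; move: (D N) C1 C10 (n.+1%:R^-1 : R) => DN' C1' _ ni.
by move: (gmean _ _) (gmean _ _) (gmean _ _) => m1 m2 m3; lra.
Qed.

End StepEstimate.

(** * Chernoff and Gaussian bounds for means *)

Section ExponentialMeans.
Context {R : realType}.
Implicit Types (a b s x : R) (n k : nat) (lambda K beta : R).

(** The primitive starting at [A] is dominated by the Gaussian integral over the whole line. *)
Lemma gauss_antiderivative (A : R) : exists G : R -> R,
  (forall x : R, A < x -> is_derive x 1 G (expR (- x ^+ 2))) /\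
  (forall x, 0 <= G x <= Num.sqrt pi).
Proof.
pose G x := \int[lebesgue_measure]_(t in [set` `[A, x]]) gauss_fun t.
have cq : continuous (@gauss_fun R) by exact: continuous_gauss_fun.
exists G; split => x => [Ax|].
  have xu : x < x + 1 by rewrite ltrDl.
  have qi : lebesgue_measure.-integrable `[A, x + 1] (EFin \o (@gauss_fun R)).
    apply: continuous_compact_integrable; first exact: segment_compact.
    by apply: continuous_subspaceT.
  have [Qd QE] := continuous_FTC1_closed xu qi Ax (cq x).
  by rewrite -/(gauss_fun x) -QE derive1E; apply: DeriveDef.
rewrite /G Rintegral_ge0/=; last by move=> t _; exact: gauss_fun_ge0.
rewrite -lee_fin fineK; last first.
  apply: integrable_fin_num => //.
  by apply: (integrableS _ _ _ (@integrableT_gauss R)).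
rewrite -integralT_gauss; apply: ge0_subset_integral => //.
- by apply/measurable_realfun.measurable_EFinP; exact: measurable_gauss_fun.
- by move=> t _; rewrite lee_fin gauss_fun_ge0.
Qed.

(** Below the chord, the mean slope of [sin] would be less than [2 / pi] on [[0, x]] and greater on
    [[x, pi / 2]], although the cosine decreases. *)
Lemma jordan_sin x : 0 <= x <= pi / 2 -> 2 / pi * x <= sin x.
Proof.
move=> /andP[x0 x1]; have p0 := @pi_gt0 R.
rewrite leNgt; apply/negP => neg.
have hd (t : R) : is_derive t 1 (fun u => sin u - 2 / pi * u) (cos t - 2 / pi).
  by apply: is_deriveB; exact: is_derive_mull.
have [c /andP[c0 c1]] := mean_value hd x0.
rewrite sin0 mulr0 !subr0 => e1.
have [d /andP[d0 d1]] := mean_value hd x1.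
rewrite sin_pihalf (_ : 2 / pi * (pi / 2) = 1); last by move: (@pi R) p0 => p p1; field; rewrite gt_eqF.
rewrite subrr sub0r => e2.
have hc : cos c - 2 / pi < 0.
  rewrite ltNge; apply/negP => h; have := mulr_ge0 h x0; rewrite -e1; lra.
have hd' : 0 < cos d - 2 / pi.
  have px : 0 <= pi / 2 - x by lra.
  rewrite ltNge; apply/negP => h; have : (cos d - 2 / pi) * (pi / 2 - x) <= 0 by rewrite mulr_le0_ge0.
  by rewrite -e2; lra.
have : cos c < cos d by lra.
by rewrite ltr_cos ?in_itv/=; lra.
Qed.

Lemma one_sub_cos_ge x : - pi <= x <= pi -> 2 / pi ^+ 2 * x ^+ 2 <= 1 - cos x.
Proof.
move=> xp; have p0 := @pi_gt0 R.
rewrite -cos_norm -[x ^+ 2]real_normK ?num_real//.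
have : 0 <= `|x| / 2 <= pi / 2.
  by rewrite divr_ge0//= ler_pM2r// ler_norml.
move=> /[dup] /andP[y0 _] /jordan_sin h.
have e : cos `|x| = 1 - 2 * sin (`|x| / 2) ^+ 2.
  have d (z : R) : cos (z *+ 2) = 1 - 2 * sin z ^+ 2 by rewrite cos_mulr2n cos2sin2; ring.
  by rewrite -d -[_ *+ 2]mulr_natr divfK.
rewrite e.
have : (2 / pi * (`|x| / 2)) ^+ 2 <= sin (`|x| / 2) ^+ 2.
  by rewrite ler_sqr ?nnegrE//; [|apply: le_trans h]; rewrite mulr_ge0// divr_ge0// ltW.
have -> : (2 / pi * (`|x| / 2)) ^+ 2 = pi ^- 2 * `|x| ^+ 2.
  by rewrite -exprVn -exprMn; congr (_ ^+ 2); move: (@pi R) p0 => p p1; field; rewrite gt_eqF.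
by lra.
Qed.

(* [1 - cos x >= 2 x^2 / pi^2] turns the mean into a Gaussian integral. *)
Lemma mean1_exp_one_cos lambda : 0 < lambda -> exists K, forall n,
  mean1 n (fun s => expR (- lambda * (1 + cos s))) <=
    Num.sqrt (pi / (8 * lambda)) + K / n.+1%:R.
Proof.
move=> l0; have p0 := @pi_gt0 R.
pose g s := expR (- lambda * (1 - cos s)).
have gL x y : `|g x - g y| <= lambda * `|x - y|.
  apply: (@lipschitz_of_derive _ _ (fun s => g s * (- lambda * sin s))) => s.
    have D : is_derive s 1 (fun u => - lambda * (1 - cos u)) (- lambda * sin s).
      rewrite (_ : (fun u => _) = - lambda *: (cst 1 \- cos)); last by apply/funext.
      by apply: is_deriveZ; rewrite -[sin s]opprK -sub0r; apply: is_deriveB.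
    exact: is_derive1_comp.
  rewrite normrM -[leRHS]mul1r; apply: ler_pM => //.
    by rewrite ger0_norm ?expR_ge0// -expR0 ler_expR mulNr oppr_le0 mulr_ge0 ?(ltW l0)//.
  by rewrite normrM normrN (gtr0_norm l0) ler_piMr ?sin_max// ltW.
have gper s : g (s + 2 * pi) = g s by rewrite /g mulr_natl cosD2pi.
have [Q Qd] := antiderivative (- (2 * pi)) (lipschitz_continuous gL).
(* Shifting by [pi] puts the maximum of the integrand at [0]; [per] below returns to the period
   [[-pi, pi]]. *)
have fE s : expR (- lambda * (1 + cos s)) = g (s + pi).
  by rewrite /g cosDpi opprK.
(* [c] is the Gaussian scale: [(c s)^2] equals [lambda] times the lower bound of
   [one_sub_cos_ge]. *)
have [c [c0 c2]] : exists c : R, 0 < c /\ c ^+ 2 = 2 / pi ^+ 2 * lambda.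
  exists (Num.sqrt (2 * lambda) / pi); split; first by rewrite divr_gt0 ?sqrtr_gt0 ?mulr_gt0.
  rewrite expr_div_n sqr_sqrtr; last by rewrite mulr_ge0// ltW.
  by move: (@pi R) p0 => p p1; field; rewrite gt_eqF.
have [G [Gd Gb]] := gauss_antiderivative (- (c * pi) - 1).
exists (lambda * (2 * pi)) => n.
rewrite (_ : (fun s => _) = (fun s => g (s + pi))); last by apply/funext.
have R1 := @riemann_mean _ n (fun s => Q (s + pi)) (fun s => g (s + pi)) lambda.
have {}R1 : `|mean1 n (fun s => g (s + pi)) - (Q (pi + pi) - Q (- pi + pi)) / (2 * pi)|
    <= lambda * (2 * pi) / n.+1%:R.
  apply: R1 => [x /andP[x1 x2]|x y]; last first.
    by apply: le_trans (gL _ _) _; rewrite opprD addrACA subrr addr0.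
  have D1 : is_derive x 1 (fun r : R => r + pi) 1.
    by rewrite -[X in is_derive _ _ _ X]addr0; apply: is_deriveD.
  have ax : - (2 * pi) < x + pi by lra.
  by have := @is_derive1_comp _ _ (fun r => r + pi) x _ _ (Qd _ ax) D1; rewrite mulr1.
have per := @antiderivative_period _ Q g (- (2 * pi)) (- pi) 0 Qd gper ltac:(lra) ltac:(lra).
rewrite add0r (_ : - pi + 2 * pi = pi) in per; last by ring.
have bound : Q pi - Q (- pi) <= Num.sqrt pi / c.
  have D x : - pi <= x <= pi ->
      is_derive x 1 (fun u => c^-1 * G (c * u) - Q u) (expR (- (c * x) ^+ 2) - g x).
    move=> /andP[x1 x2].
    have Dc := is_derive_mull c x.
    have ax : - (c * pi) - 1 < c * x.
      have := ler_wpM2l (ltW c0) x1; lra.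
    have D2 := @is_derive1_comp _ G (fun u => c * u) x _ _ (Gd _ ax) Dc.
    have D3 := is_deriveZ c^-1 D2.
    rewrite /GRing.scale/= mulrCA mulVf ?gt_eqF// mulr1 in D3.
    have D4 := Qd x ltac:(lra).
    exact: is_deriveB.
  have pp : - pi <= pi :> R by lra.
  have [z zp] := mean_value_in D pp.
  have gz : g z <= expR (- (c * z) ^+ 2).
    rewrite ler_expR mulNr lerN2 exprMn c2 mulrAC [leRHS]mulrC.
    by apply: ler_wpM2r; [exact: ltW|exact: one_sub_cos_ge].
  have : 0 <= (expR (- (c * z) ^+ 2) - g z) * (pi - - pi).
    by rewrite mulr_ge0 ?subr_ge0.
  move=> /[swap] <- h.
  have /andP[_ G1] := Gb (c * pi); have /andP[G2 _] := Gb (c * - pi).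
  have ci : 0 < c^-1 by rewrite invr_gt0.
  have := ler_wpM2l (ltW ci) G1; have := mulr_ge0 (ltW ci) G2.
  by rewrite [Num.sqrt pi / c]mulrC; lra.
have sE : Num.sqrt pi / c / (2 * pi) = Num.sqrt (pi / (8 * lambda)).
  have h : 0 <= Num.sqrt pi / c / (2 * pi) by rewrite !divr_ge0 ?sqrtr_ge0 ?mulr_ge0// ltW.
  apply/eqP; rewrite -(@eqrXn2 _ 2)// ?sqrtr_ge0//.
  rewrite !expr_div_n c2 !sqr_sqrtr ?divr_ge0 ?mulr_ge0 ?(ltW p0) ?(ltW l0)//.
  by apply/eqP; move: (@pi R) p0 => p p1; field; rewrite !gt_eqF.
move: R1; rewrite addNr (_ : pi + pi = 2 * pi); last by ring.
rewrite (_ : Q (2 * pi) - Q 0 = Q pi - Q (- pi)); last by rewrite per.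
rewrite ler_norml => /andP[_]; rewrite lerBlDr addrC => /le_trans; apply.
rewrite lerD2r -sE ler_pM2r// invr_gt0 mulr_gt0//.
Qed.

(** For the quartic [P], [P' - P = t^3 (1/12 - t/16)] has the sign of [t] on [[-1, 1]], so
    [P e^(-t)] is least at [0]. The coefficient [1/16] is the one that makes the mean in
    [mean1_exp_cos] equal to [1 + u + u^2/2] with [u = lambda^2/4]. *)
Lemma expR_le_quartic x : `|x| <= 1 ->
  expR x <= 1 + x + x ^+ 2 / 2 + x ^+ 3 / 6 + x ^+ 4 / 16.
Proof.
rewrite ler_norml => /andP[xm x1].
pose P (t : R) := 1 + t + t ^+ 2 / 2 + t ^+ 3 / 6 + t ^+ 4 / 16.
pose dP (t : R) := 1 + t + t ^+ 2 / 2 + t ^+ 3 / 4.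
have Pd (t : R) : is_derive t 1 P (dP t).
  rewrite (_ : P = (((cst 1 \+ id) \+ 2^-1 *: (id ^+ 2)) \+ 6^-1 *: (id ^+ 3)) \+ 16^-1 *: (id ^+ 4)); last first.
    by apply/funext => u; rewrite /P !fctE/= /GRing.scale/=; ring.
  rewrite (_ : dP t = (((0 + 1) + 2^-1 *: ((2%:R * t ^+ 1) *: (1 : R)))
     + 6^-1 *: ((3%:R * t ^+ 2) *: (1 : R))) + 16^-1 *: ((4%:R * t ^+ 3) *: (1 : R))); last first.
    by rewrite /dP /GRing.scale/=; field.
  exact: is_deriveD.
have fd (t : R) : is_derive t 1 (P \* (fun u => expR (- 1 * u))) ((dP t - P t) * expR (- 1 * t)).
  apply: (is_derive_eq (is_deriveM (Pd t) (is_derive_expR_scale (-1) t))).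
  by rewrite /GRing.scale/=; ring.
have e (t : R) : dP t - P t = t ^+ 3 * (12^-1 - t / 16) by rewrite /dP /P; field.
suff : 1 <= P x * expR (- 1 * x).
  by rewrite mulN1r expRN -ler_pdivrMr ?invr_gt0 ?expR_gt0// invrK mul1r.
have P0 : P 0 * expR (- 1 * 0) = 1 by rewrite mulr0 expR0 /P !expr0n /= !mul0r !addr0 mulr1.
have [x0|/ltW x0] := lerP 0 x.
  rewrite -[leLHS]P0; apply: (derive_nonneg_le fd x0) => t /andP[t0 tx].
  by rewrite mulr_ge0 ?expR_ge0// e mulr_ge0 ?exprn_ge0//; lra.
rewrite -[leLHS]P0 -lerN2; apply: (derive_nonneg_le (fun t => is_deriveN (fd t)) x0) => t /andP[tx t0].
rewrite -mulNr mulr_ge0 ?expR_ge0// e -mulNr mulr_ge0//; last by lra.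
by rewrite oppr_ge0 exprS mulr_le0_ge0 ?sqr_ge0.
Qed.

Lemma expR_ge_quadratic x : 0 <= x -> 1 + x + x ^+ 2 / 2 <= expR x.
Proof.
move=> x0.
pose P (t : R) := 1 + t + t ^+ 2 / 2.
have Pd (t : R) : is_derive t 1 P (1 + t).
  rewrite (_ : P = (cst 1 \+ id) \+ 2^-1 *: (id ^+ 2)); last first.
    by apply/funext => u; rewrite /P !fctE/= /GRing.scale/=; ring.
  rewrite (_ : 1 + t = (0 + 1) + 2^-1 *: ((2%:R * t ^+ 1) *: (1 : R))); last first.
    by rewrite /GRing.scale/=; field.
  exact: is_deriveD.
have fd (t : R) : is_derive t 1 (P \* (fun u => expR (- 1 * u))) ((1 + t - P t) * expR (- 1 * t)).
  apply: (is_derive_eq (is_deriveM (Pd t) (is_derive_expR_scale (-1) t))).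
  by rewrite /GRing.scale/=; ring.
suff : P x * expR (- 1 * x) <= 1.
  by rewrite mulN1r expRN ler_pdivrMr ?expR_gt0// mul1r.
have P0 : P 0 * expR (- 1 * 0) = 1 by rewrite mulr0 expR0 /P !expr0n /= !mul0r !addr0 mulr1.
rewrite -[leRHS]P0 -lerN2; apply: (derive_nonneg_le (fun t => is_deriveN (fd t)) x0) => t _.
rewrite -mulNr mulr_ge0 ?expR_ge0// /P.
by have := sqr_ge0 t; lra.
Qed.

(** This is [I_0(lambda) <= e^(lambda^2/4)] up to the grid error. In the quartic bound
    [cos^4 <= cos^2], odd powers of the cosine average to [0] and [cos^2] to [1/2]. *)
Lemma mean1_exp_cos lambda : 0 <= lambda <= 1 -> exists K, forall n,
  mean1 n (fun s => expR (- lambda * cos s)) <= expR (lambda ^+ 2 / 4) + K / n.+1%:R.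
Proof.
move=> /andP[l0 l1]; have p0 := @pi_gt0 R.
have [A AE] : exists A, A = lambda ^+ 2 / 2 + lambda ^+ 4 / 16 by eexists.
have [B BE] : exists B, B = lambda ^+ 3 / 6 by eexists.
pose psi (s : R) := 1 - lambda * cos s + A * cos s ^+ 2 - B * cos s ^+ 3.
pose Psi (s : R) := s - lambda * sin s + A * ((s + sin s * cos s) / 2) - B * (sin s - sin s ^+ 3 / 3).
have Psid (s : R) : is_derive s 1 Psi (psi s).
  rewrite (_ : Psi = ((id \- lambda *: sin) \+ A *: (2^-1 *: (id \+ sin * cos)))
      \- B *: (sin \- 3^-1 *: (sin ^+ 3))); last first.
    by apply/funext => u; rewrite /Psi !fctE/= /GRing.scale/=; field.
  have Dsin := is_derive_sin s; have Dcos := is_derive_cos s.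
  have Did := is_derive_id s (1 : R).
  apply: (is_derive_eq (is_deriveB (is_deriveD (is_deriveB Did (is_deriveZ lambda Dsin))
    (is_deriveZ A (is_deriveZ 2^-1 (is_deriveD Did (is_deriveM Dsin Dcos)))))
    (is_deriveZ B (is_deriveB Dsin (is_deriveZ 3^-1 (is_deriveX 3 Dsin)))))).
  rewrite /psi /GRing.scale/= mulrN -!expr2 sin2cos2.
  by field.
have A0 : 0 <= A by rewrite AE addr_ge0 ?divr_ge0 ?exprn_ge0.
have B0 : 0 <= B by rewrite BE divr_ge0 ?exprn_ge0.
have l2 : lambda ^+ 2 <= 1 by rewrite exprn_ile1.
have l3 : lambda ^+ 3 <= 1 by rewrite exprn_ile1.
have l4 : lambda ^+ 4 <= 1 by rewrite exprn_ile1.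
have psiL x y : `|psi x - psi y| <= 4 * `|x - y|.
  have c1 := cos_max x; have c2 := cos_max y.
  have cc := cos_lipschitz x y.
  rewrite (_ : _ - _ = (cos x - cos y) * (- lambda + A * (cos x + cos y)
     - B * (cos x ^+ 2 + cos x * cos y + cos y ^+ 2))); last by rewrite /psi; ring.
  rewrite normrM mulrC; apply: ler_pM => //.
  apply: le_trans (ler_normB _ _) _; apply: le_trans (lerD (ler_normD _ _) (lexx _)) _.
  rewrite normrN (ger0_norm l0) !normrM (ger0_norm A0) (ger0_norm B0).
  have h1 : `|cos x + cos y| <= 2 by apply: le_trans (ler_normD _ _) _; lra.
  have h2 : `|cos x ^+ 2 + cos x * cos y + cos y ^+ 2| <= 3.
    apply: le_trans (ler_normD _ _) _; apply: le_trans (lerD (ler_normD _ _) (lexx _)) _.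
    have h3 : `|cos x ^+ 2| <= 1 by rewrite normrX exprn_ile1.
    have h4 : `|cos y ^+ 2| <= 1 by rewrite normrX exprn_ile1.
    have h5 : `|cos x * cos y| <= 1 by rewrite normrM mulr_ile1.
    by lra.
  have := ler_wpM2l A0 h1; have := ler_wpM2l B0 h2.
  by rewrite AE BE in A0 B0 *; lra.
exists (4 * (2 * pi)) => n.
have h s : expR (- lambda * cos s) <= psi s.
  have lc : `|- lambda * cos s| <= 1.
    by rewrite normrM normrN (ger0_norm l0) mulr_ile1 ?cos_max.
  apply: le_trans (expR_le_quartic lc) _.
  have c4 : lambda ^+ 4 * cos s ^+ 4 <= lambda ^+ 4 * cos s ^+ 2.
    have c2 : cos s ^+ 2 <= 1 by have := cos2Dsin2 s; have := sqr_ge0 (sin s); lra.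
    rewrite ler_wpM2l ?exprn_ge0// (_ : cos s ^+ 4 = cos s ^+ 2 * cos s ^+ 2); last by ring.
    by rewrite ler_piMr ?sqr_ge0.
  rewrite !exprMn /psi AE BE -subr_ge0.
  rewrite (_ : _ - _ = (lambda ^+ 4 * cos s ^+ 2 - lambda ^+ 4 * cos s ^+ 4) / 16); last by field.
  by rewrite divr_ge0// subr_ge0.
apply: le_trans (mean1_le n h) _.
have := @riemann_mean _ n Psi psi 4 (fun x _ => Psid x) psiL.
have -> : (Psi pi - Psi (- pi)) / (2 * pi) = 1 + A / 2.
  rewrite /Psi sinN sinpi cosN cospi oppr0; move: (@pi R) p0 => p p1; field; rewrite gt_eqF//.
rewrite ler_norml => /andP[_]; rewrite lerBlDr addrC => /le_trans; apply.
rewrite lerD2r (_ : 1 + A / 2 = 1 + lambda ^+ 2 / 4 + (lambda ^+ 2 / 4) ^+ 2 / 2); last first.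
  by rewrite AE; field.
by apply: expR_ge_quadratic; rewrite divr_ge0// exprn_ge0.
Qed.

End ExponentialMeans.

(** * Growth of the transported volume *)

Section UpperMean.
Context {R : realType} {N : nat}.
Implicit Types (p q : ('I_N -> R) -> R) (x y : 'I_N -> R) (n : nat).

Lemma eventually_small (K e : R) : 0 < e -> exists n0, forall n, (n0 <= n)%N -> K / n.+1%:R <= e.
Proof.
move=> e0; exists (Num.bound `|K / e|) => n n0n.
rewrite ler_pdivrMr ?ltr0n//.
have /ltW h1 : K / e < n.+1%:R.
  apply: le_lt_trans (ler_norm _) _; apply: lt_le_trans (archi_boundP (normr_ge0 _)) _.
  by rewrite ler_nat ltnW.
by move: h1; rewrite ler_pdivrMr// mulrC.
Qed.

(* The limsup of the grid means; only upper bounds and step inequalities are needed, so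
   convergence is never proved. *)
Definition upmean p : R := inf [set v | exists n0, forall n, (n0 <= n)%N -> gmean n p <= v].

Lemma gmean_bounds n p : (forall x, 0 <= p x <= 1) -> 0 <= gmean n p <= 1.
Proof.
move=> p01; have h0 : @gmean R N n (fun _ => 0) <= gmean n p.
  by apply: gmean_le => x; have /andP[] := p01 x.
have h1 : gmean n p <= @gmean R N n (fun _ => 1) by apply: gmean_le => x; have /andP[] := p01 x.
by rewrite !gmean_cst in h0 h1; rewrite h0.
Qed.

Lemma upmean_set p : (forall x, 0 <= p x <= 1) ->
  has_inf [set v | exists n0, forall n, (n0 <= n)%N -> gmean n p <= v].
Proof.
move=> p01; split; first by exists 1; exists 0%N => n _; have /andP[] := gmean_bounds n p01.
exists 0 => v [n0 H]; apply: le_trans (H n0 (leqnn _)).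
by have /andP[] := gmean_bounds n0 p01.
Qed.

Lemma upmean_le p (v : R) : (forall x, 0 <= p x <= 1) ->
  (forall e, 0 < e -> exists n0, forall n, (n0 <= n)%N -> gmean n p <= v + e) -> upmean p <= v.
Proof.
move=> p01 H; apply/ler_addgt0Pr => e e0; apply: ge_inf; first by have [] := upmean_set p01.
exact: H.
Qed.

Lemma upmean_adherent p (e : R) : (forall x, 0 <= p x <= 1) -> 0 < e ->
  exists n0, forall n, (n0 <= n)%N -> gmean n p <= upmean p + e.
Proof.
move=> p01 e0; have [v [n0 H] /ltW ve] := inf_adherent e0 (upmean_set p01).
by exists n0 => n /H /le_trans; apply.
Qed.

Lemma upmean_bounds p : (forall x, 0 <= p x <= 1) -> 0 <= upmean p <= 1.
Proof.
move=> p01; apply/andP; split.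
  apply: lb_le_inf; first by have [] := upmean_set p01.
  move=> v [n0 H]; apply: le_trans (H n0 (leqnn _)).
  by have /andP[] := gmean_bounds n0 p01.
apply: upmean_le => // e e0; exists 0%N => n _.
by have /andP[_ h] := gmean_bounds n p01; lra.
Qed.

Lemma upmean_affine_le p q (a b : R) : (forall x, 0 <= p x <= 1) -> (forall x, 0 <= q x <= 1) ->
  0 < a ->
  (forall e, 0 < e -> exists n0, forall n, (n0 <= n)%N -> a * gmean n p - b - e <= gmean n q) ->
  a * upmean p - b <= upmean q.
Proof.
move=> p01 q01 a0 H; apply/ler_addgt0Pr => e e0.
have e2 : 0 < e / 2 by lra.
have [n1 H1] := upmean_adherent q01 e2; have [n2 H2] := H _ e2.
rewrite lerBlDr -ler_pdivlMl//; apply: ge_inf; first by have [] := upmean_set p01.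
exists (maxn n1 n2) => n; rewrite geq_max => /andP[/H1 h1 /H2 h2].
by rewrite ler_pdivlMl//; lra.
Qed.


Lemma gmean_prod_le p (f : R -> R) (beta K : R) : (forall s, 0 <= f s) -> 0 <= beta ->
  (forall x, p x <= \prod_i f (x i)) -> (forall n, mean1 n f <= beta + K / n.+1%:R) ->
  forall e, 0 < e -> exists n0, forall n, (n0 <= n)%N -> gmean n p <= beta ^+ N + e.
Proof.
move=> f0 b0 pf fm e e0.
have : (beta + d) ^+ N @[d --> 0] --> (beta + 0) ^+ N.
  apply: (@cvg_comp _ _ _ (fun d => beta + d) (fun z => z ^+ N)); last exact: exprn_continuous.
  by apply: cvgD; [exact: cvg_cst|exact: cvg_id].
rewrite addr0 => /cvgrPdist_le /(_ e e0) /nbhs_ballP[d /= d0 H].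
have d2 : 0 < d / 2 by lra.
have [n0 Hn] := eventually_small K d2.
exists n0 => n n0n.
apply: le_trans (gmean_le n pf) _; rewrite gmean_prod.
have m0 : 0 <= mean1 n f by rewrite -(mean1_cst n 0); exact: mean1_le.
apply: (@le_trans _ _ ((beta + d / 2) ^+ N)).
  rewrite lerXn2r ?nnegrE//; first by rewrite addr_ge0// ltW.
  by apply: le_trans (fm n) _; rewrite lerD2l Hn.
have := H (d / 2); rewrite /ball/= sub0r normrN gtr0_norm// => /(_ ltac:(lra)).
by rewrite ler_norml => /andP[]; lra.
Qed.

End UpperMean.

(** * Lipschitz cutoff of the bad set *)

Section Cutoff.
Context {R : realType} {N : nat}.
Implicit Types (x y : 'I_N -> R) (b eta T t : R) (sol : ('I_N -> R) -> R -> 'I_N -> R).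

Definition clamp (u : R) : R := Num.max 0 (Num.min 1 u).

Lemma clamp01 u : 0 <= clamp u <= 1.
Proof. by rewrite /clamp le_max lexx/= ge_max ler01 ge_min lexx. Qed.

Lemma clamp_eq1 u : 1 <= u -> clamp u = 1.
Proof. by move=> u1; rewrite /clamp min_l// max_r. Qed.

Lemma clamp_gt0 u : 0 < clamp u -> 0 < u.
Proof. by rewrite /clamp lt_max ltxx/= lt_min ltr01. Qed.

Lemma clamp_lipschitz u v : `|clamp u - clamp v| <= `|u - v|.
Proof.
have h (z : R) : [\/ clamp z = 0 /\ z <= 0, clamp z = 1 /\ 1 <= z | clamp z = z /\ 0 <= z <= 1].
  have [z0|z0] := lerP z 0; first by constructor 1; rewrite /clamp min_r ?max_l//; lra.
  have [z1|z1] := lerP 1 z; first by constructor 2; rewrite clamp_eq1.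
  by constructor 3; rewrite /clamp min_r ?max_r ?(ltW z0)// ltW.
have g (a c : R) : - c <= a -> a <= c -> `|a| <= c by move=> ? ?; rewrite ler_norml; lra.
have /andP[n1 n2] : - `|u - v| <= u - v <= `|u - v| by rewrite -ler_norml.
have n0 := normr_ge0 (u - v).
by case: (h u) => -[-> ?]; case: (h v) => -[-> ?]; apply: g; lra.
Qed.

Definition max_order (sol : ('I_N -> R) -> R -> 'I_N -> R) T x : R :=
  sup [set order_param (sol x s) | s in [set s | 0 <= s <= T]].

(** Equal to [1] where [R] stays at most [b - eta] on [[0, T]], and to [0] where it reaches [b]. *)
Definition cutoff sol b eta T x : R := clamp ((b - max_order sol T x) / eta).

Lemma max_order_sup sol T x : 0 <= T ->
  has_sup [set order_param (sol x s) | s in [set s | 0 <= s <= T]].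
Proof.
move=> T0; split; first by exists (order_param (sol x 0)); exists 0 => //=; rewrite lexx.
by exists 2 => _ [s _ <-]; exact: order_param_le2.
Qed.

Lemma le_max_order sol T x s : 0 <= s <= T -> order_param (sol x s) <= max_order sol T x.
Proof.
move=> /[dup] sT /andP[s0 /(le_trans s0) T0]; apply: ub_le_sup; last by exists s.
by have [] := max_order_sup sol x T0.
Qed.

Lemma max_order_le sol T x (v : R) : 0 <= T ->
  (forall s, 0 <= s <= T -> order_param (sol x s) <= v) -> max_order sol T x <= v.
Proof.
by move=> T0 H; apply: ge_sup; [have [] := max_order_sup sol x T0|move=> _ [s sT <-]; exact: H].
Qed.

End Cutoff.

(** * One-step growth inequality for the volume *)

Section Growth.
Context {R : realType} {N : nat}.
Implicit Types (x y : 'I_N -> R) (b eta T t rho : R) (omega : 'I_N -> R) (kappa : R)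
  (sol : ('I_N -> R) -> R -> 'I_N -> R).

(* Chernoff bound for the proportion of the torus on which the order parameter is at most [rho]. *)
Definition small_order_bound (M : nat) rho : R := (Num.sqrt (pi * expR 1 * rho) / 2) ^+ M.

(** [lambda = 1 / (2 rho)] minimizes [e^(lambda rho) sqrt (pi / (8 lambda))], and this is the
    minimum. *)
Lemma sqrt_chernoff rho : 0 < rho ->
  expR (2^-1) * Num.sqrt (pi / (8 * (2 * rho)^-1)) = Num.sqrt (pi * expR 1 * rho) / 2.
Proof.
move=> r0; have p0 := @pi_gt0 R.
have e1 : expR (2^-1) = Num.sqrt (expR 1) :> R.
  have -> : expR 1 = expR (2^-1) ^+ 2 :> R by rewrite -expRM_natl; congr expR; field.
  by rewrite sqrtr_sqr ger0_norm ?expR_ge0.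
have e2 : 2 = Num.sqrt (2 ^+ 2) :> R by rewrite sqrtr_sqr ger0_norm.
rewrite e1 [in RHS]e2 -sqrtrM ?expR_ge0// -sqrtrV// -sqrtrM ?mulr_ge0 ?expR_ge0 ?(ltW p0) ?(ltW r0)//.
by congr Num.sqrt; field; rewrite gt_eqF.
Qed.

Lemma prod_chernoff (lambda c : R) x :
  \prod_i (expR c * expR (- lambda * (1 + cos (x i)))) =
    expR (N%:R * c - lambda * N%:R * order_param x).
Proof.
under eq_bigr do rewrite -expRD.
rewrite -expR_sum; congr expR; rewrite big_split/= sumr_const card_ord -mulr_sumr mulr_natl.
have [N0|N0] := posnP N.
  rewrite [X in lambda * X * _](_ : _ = 0) ?mulr0 ?mul0r ?big1 ?mulr0 ?oppr0 ?mulr0//.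
    by move=> i; have := ltn_ord i; rewrite [X in (_ < X)%N]N0.
  by rewrite [X in X%:R]N0.
by rewrite /order_param -mulrA mulVKf ?pnatr_eq0 -?lt0n// mulNr.
Qed.

(* Used with [S] the order parameter and [X = e^(L (rho - S) - 1) / L], [L = N / (2 rho)], a
   product over the coordinates that dominates [(rho - S)^+]. *)
Lemma logistic_lower_bound (S q rho rhom b X : R) : 0 <= S -> 0 <= q <= 1 -> (0 < q -> S < b) ->
  0 < rho -> rho <= rhom -> rhom <= 1 -> b <= 1 - rhom -> 0 <= X -> rho - S <= X ->
  (1 - rhom) * (rho * q - X) <= q * (S * (1 - S)).
Proof.
move=> S0 /andP[q0 q1] qb r0 rm rm1 bm X0 SX.
have [qp|q00] := ltrP 0 q; last first.
  have -> : q = 0 by lra.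
  rewrite mulr0 mul0r sub0r mulrN oppr_le0 mulr_ge0//; lra.
have Sb := qb qp.
have m0 : 0 <= 1 - rhom by lra.
have h : (1 - rhom) * (rho - X) <= S * (1 - S).
  (* For [rho <= S], concavity of [S (1 - S)] up to [1 - rhom] gives at least [(1 - rhom) rho];
     below [rho], [S <= rhom] gives at least [(1 - rhom) S]. *)
  have [rS|Sr] := lerP rho S.
    have h1 : 0 <= (S - rho) * (1 - rhom - S) by rewrite mulr_ge0//; lra.
    have h2 : 0 <= S * (rhom - rho) by rewrite mulr_ge0//; lra.
    have h3 : 0 <= (1 - rhom) * X by rewrite mulr_ge0.
    by lra.
  have h1 : 0 <= (1 - rhom) * (S - (rho - X)) by rewrite mulr_ge0//; lra.
  have h2 : 0 <= S * (rhom - S) by rewrite mulr_ge0//; lra.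
  by lra.
have h1 := ler_wpM2l q0 h.
have h2 : 0 <= (1 - rhom) * (X - q * X) by rewrite mulr_ge0// subr_ge0 ler_piMl.
by lra.
Qed.

Section Sol.
Variables (omega : 'I_N -> R) (kappa : R) (sol : ('I_N -> R) -> R -> 'I_N -> R).
Hypotheses (N0 : (0 < N)%N) (k0 : 0 <= kappa).
Hypothesis solP : forall x, is_solution omega kappa x (sol x).

Lemma max_order_lipschitz T x y : 0 <= T ->
  `|max_order sol T x - max_order sol T y| <= N%:R * expR (6 * kappa * N%:R * T) * l1dist x y.
Proof.
move=> T0.
have half u v : max_order sol T u <=
    max_order sol T v + N%:R * expR (6 * kappa * N%:R * T) * l1dist u v.
  apply: max_order_le => // s sT.
  have := le_max_order sol v sT; rewrite -(lerD2r (N%:R * expR (6 * kappa * N%:R * T) * l1dist u v)).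
  apply: le_trans; rewrite -lerBlDl; apply: le_trans (ler_norm _) _.
  apply: le_trans (order_param_lipschitz _ _) _; apply: flow_lipschitz => //.
  by have /andP[s0 ?] := sT; rewrite ger0_norm.
have h1 := half x y; have h2 := half y x; rewrite [l1dist y x]l1dist_sym in h2.
by rewrite ler_norml; move: (max_order _ _ _) (max_order _ _ _) (_ * _) h1 h2 => a c d; lra.
Qed.

Lemma max_order_turn T x i : max_order sol T (turn x i) = max_order sol T x.
Proof.
rewrite /max_order; congr sup; apply/seteqP; split => _ [s sT <-]; exists s => //;
  by rewrite (flow_turn N0 k0 solP) order_param_turn.
Qed.

Definition survivors b eta T t x : R := cutoff sol b eta T (sol x (- t)).

Lemma survivors01 b eta T t x : 0 <= survivors b eta T t x <= 1.
Proof. exact: clamp01. Qed.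

Lemma survivors_turn b eta T t : periodic_all (survivors b eta T t).
Proof. by move=> x i; rewrite /survivors /cutoff (flow_turn N0 k0 solP) max_order_turn. Qed.

(** One exponential factor comes from the backward flow, the other from the maximum over [[0, T]].
    The constant does not depend on [t], which makes the error in [volume_growth] uniform. *)
Lemma survivors_lipschitz b eta T t : 0 < eta -> 0 <= t <= T ->
  lipschitz_all (eta^-1 * (N%:R * expR (6 * kappa * N%:R * T)) ^+ 2) (survivors b eta T t).
Proof.
move=> e0 /andP[t0 tT] x y.
have T0 : 0 <= T := le_trans t0 tT.
have ei : 0 <= eta^-1 by rewrite invr_ge0 ltW.
have L0 : 0 <= N%:R * expR (6 * kappa * N%:R * T) by rewrite mulr_ge0 ?expR_ge0.
apply: le_trans (clamp_lipschitz _ _) _.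
rewrite (_ : _ - _ = eta^-1 * (max_order sol T (sol y (- t)) - max_order sol T (sol x (- t))));
  last by ring.
rewrite normrM (ger0_norm ei) -[leRHS]mulrA ler_wpM2l//.
apply: le_trans (max_order_lipschitz _ _ T0) _.
rewrite l1dist_sym expr2 -[leRHS]mulrA ler_wpM2l//.
by apply: flow_lipschitz => //; rewrite normrN ger0_norm.
Qed.

(** The trajectory started at [sol x (- t)] passes through [x] at time [t], which is one of the
    times in [[0, T]]. *)
Lemma survivors_gt0 b eta T t x : 0 < eta -> 0 <= t <= T -> 0 < survivors b eta T t x ->
  order_param x < b.
Proof.
move=> e0 tT /clamp_gt0; rewrite pmulr_lgt0 ?invr_gt0// subr_gt0; apply: le_lt_trans.
apply: le_trans (le_max_order sol (sol x (- t)) tT).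
by rewrite (flowD N0 k0 solP) subrr (solP x).1.
Qed.

Lemma survivors_shift b eta T t h x : survivors b eta T t (sol x (- h)) = survivors b eta T (t + h) x.
Proof. by rewrite /survivors (flowD N0 k0 solP) opprD. Qed.

Definition volume b eta T t : R := upmean (survivors b eta T t).

(** [rho] may change from step to step while [rhom] stays fixed: the power phase lets [rho] follow
    the volume but keeps a constant factor [1 - rhom]. *)
Lemma volume_growth b eta T : 0 < eta -> 0 <= T ->
  exists2 C, 0 <= C & forall t h rho rhom, 0 <= t -> 0 <= h -> t + h <= T ->
    0 < rho -> rho <= rhom -> rhom <= 1 -> b <= 1 - rhom ->
    volume b eta T t
      + h * (kappa * N%:R * (1 - rhom) *
          (rho * volume b eta T t - 2 * rho / (N%:R * expR 1) * small_order_bound N rho))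
      - C * h ^+ 2 <= volume b eta T (t + h).
Proof.
move=> e0 T0.
have L0 : 0 <= eta^-1 * (N%:R * expR (6 * kappa * N%:R * T)) ^+ 2.
  by rewrite mulr_ge0 ?sqr_ge0// invr_ge0 ltW.
have [C C0 step] := gmean_step N0 solP k0 L0 T0.
exists C => // t h rho rhom t0 h0 thT r0 rm rm1 bm.
have n0 : 0 < N%:R :> R by rewrite ltr0n.
have tT : 0 <= t <= T by apply/andP; split => //; apply: le_trans thT; rewrite lerDl.
have hT : 0 <= h <= T by apply/andP; split => //; apply: le_trans thT; rewrite lerDr.
set p := survivors b eta T t.
pose lambda := (2 * rho)^-1.
have l0 : 0 < lambda by rewrite invr_gt0 mulr_gt0.
pose f (s : R) := expR (2^-1) * expR (- lambda * (1 + cos s)).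
have [K fK] := mean1_exp_one_cos l0.
pose A := 2 * rho / (N%:R * expR 1).
have A0 : 0 < A by rewrite divr_gt0 ?mulr_gt0 ?expR_gt0.
pose B := kappa * N%:R * (1 - rhom).
have B0 : 0 <= B by rewrite !mulr_ge0// subr_ge0.
have pointwise x : B * (rho * p x - A * \prod_i f (x i)) <= p x * \sum_i partial_div kappa x i.
  have p01 := survivors01 b eta T t x.
  have Xb : rho - order_param x <= A * \prod_i f (x i).
    rewrite prod_chernoff.
    have E := expR_ge1Dx (N%:R / 2 - lambda * N%:R * order_param x - 1).
    have AE (Y : R) : A * expR Y = 2 * rho / N%:R * expR (Y - 1).
      by rewrite /A expRB; field; rewrite !gt_eqF ?expR_gt0.
    rewrite AE.
    apply: le_trans (ler_wpM2l _ E); last by rewrite divr_ge0 ?mulr_ge0// ltW.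
    by rewrite /lambda le_eqVlt; apply/orP; left; apply/eqP; field; rewrite !gt_eqF.
  have X0 : 0 <= A * \prod_i f (x i).
    by rewrite mulr_ge0 ?(ltW A0)// prodr_ge0// => i _; rewrite mulr_ge0 ?expR_ge0.
  have /andP[p0 _] := p01.
  apply: (@le_trans _ _ (p x * (kappa * N%:R * (order_param x * (1 - order_param x))))); last first.
    by rewrite ler_wpM2l// sum_partial_div.
  have H := logistic_lower_bound (order_param_ge0 x) p01 (@survivors_gt0 b eta T t x e0 tT) r0 rm rm1 bm X0 Xb.
  have kN : 0 <= kappa * N%:R by rewrite mulr_ge0.
  rewrite [leRHS]mulrCA; apply: le_trans (ler_wpM2l kN H).
  by rewrite [leRHS]mulrA.
have chern : forall e, 0 < e -> exists n0, forall n, (n0 <= n)%N ->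
    gmean n (fun x => \prod_i f (x i)) <= small_order_bound N rho + e.
  apply: (@gmean_prod_le _ _ _ f (Num.sqrt (pi * expR 1 * rho) / 2) (expR (2^-1) * K)) => //.
    by move=> s; rewrite mulr_ge0 ?expR_ge0.
  move=> n; rewrite mean1Z -sqrt_chernoff// -mulrA -mulrDr ler_wpM2l ?expR_ge0//.
rewrite (_ : _ - C * h ^+ 2 = (1 + h * B * rho) * volume b eta T t -
   (h * B * A * small_order_bound N rho + C * h ^+ 2)); last by rewrite -/A -/B; ring.
clearbody A B.
have hBA : 0 <= h * B * A by rewrite !mulr_ge0// ltW.
apply: upmean_affine_le => [x|x||e e1]; [exact: survivors01|exact: survivors01| |].
  by rewrite ltr_pwDl// !mulr_ge0// ltW.
have d0 : 0 < e / 2 / (h * B * A + 1) by rewrite !divr_gt0// ltr_wpDl.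
have d1 : 0 < e / 2 by rewrite divr_gt0.
have [n1 H1] := chern _ d0; have [n2 H2] := eventually_small C d1.
exists (maxn n1 n2) => n; rewrite geq_max => /andP[/H1 h1 /H2 h2].
have := step p h n (survivors_turn b eta T t) (survivors_lipschitz b e0 tT) (survivors01 b eta T t) hT.
rewrite (_ : (fun x => p (sol x (- h))) = survivors b eta T (t + h)); last first.
  by apply/funext => x; exact: survivors_shift.
have G : B * (rho * gmean n p - A * gmean n (fun x => \prod_i f (x i))) <=
    gmean n (fun x => p x * \sum_i partial_div kappa x i).
  rewrite -!gmeanZ -mulN1r -gmeanZ -gmeanD -gmeanZ; apply: gmean_le => x.
  by rewrite mulN1r; exact: pointwise.
have h3 : h * B * A * (e / 2 / (h * B * A + 1)) <= e / 2.
  rewrite mulrCA ler_piMr ?(ltW d1)// ler_pdivrMr ?mul1r ?lerDl// ltr_wpDl//.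
have := ler_wpM2l h0 G; have := ler_wpM2l hBA h1.
move: h3 h2; rewrite mulrDr -/p.
move: (gmean n (fun x => \prod_i f (x i))) (gmean n (fun x => p x * _)) (gmean n (survivors _ _ _ _)) (gmean n p)
  (h * B * A * (e / 2 / (h * B * A + 1))) => g1 g2 g3 g4 d.
rewrite -[C / n.+1%:R]/(C * n.+1%:R^-1); move: (n.+1%:R^-1 : R) (small_order_bound _ _) => ni s.
by lra.
Qed.

End Sol.
End Growth.

(** * From grid means to the outer measure *)

Section OuterMeasure.
Context {R : realType} {N : nat}.
Implicit Types (p q : ('I_N -> R) -> R) (x y : 'I_N -> R) (n : nat) (A B : set ('I_N -> R)).

Lemma box_vol_ge0 (a b : 'I_N -> R) : 0 <= box_vol a b.
Proof. by apply: prodr_ge0 => i _; rewrite le_max lexx orbT. Qed.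

Lemma leb_outer_seq A (s : seq (('I_N -> R) * ('I_N -> R))) : (0 < N)%N ->
  (forall x, A x -> exists2 k, (k < size s)%N &
     box (nth (fun=> 0, fun=> 0) s k).1 (nth (fun=> 0, fun=> 0) s k).2 x) ->
  (leb_outer A <= (\sum_(ab <- s) box_vol ab.1 ab.2)%:E)%E.
Proof.
move=> N0 cov; set d := (fun=> 0, fun=> 0) in cov.
apply: ereal_inf_lbound; exists (fun k => (nth d s k).1), (fun k => (nth d s k).2); split.
  by move=> x /cov[k _ xk]; exists k.
(* The finite list is padded with degenerate boxes; their volume is a nonempty product of zeros
   because [N > 0]. *)
have vd : box_vol d.1 d.2 = 0.
  by rewrite /box_vol (bigD1 (Ordinal N0))//= subrr maxxx mul0r.
rewrite (nneseries_split 0%N (size s)); last by move=> k _; rewrite lee_fin box_vol_ge0.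
rewrite add0n [X in (_ + X)%E](_ : _ = 0%E) ?adde0; last first.
  by apply: eseries0 => k sk _; rewrite nth_default// vd.
by rewrite sumEFin (big_nth d).
Qed.

(** Slightly more than the grid step, so that the half-open cells also cover the endpoint [pi]. *)
Definition cell n : R := 2 * pi / n.+1%:R * (1 + n.+1%:R^-1).

Lemma cell_ge0 n : 0 <= cell n.
Proof.
have p0 := @pi_ge0 R; have h : 0 <= n.+1%:R^-1 :> R by rewrite invr_ge0.
by rewrite /cell !(p0, h, mulr_ge0, addr_ge0).
Qed.

Lemma cell_cover n (s : R) : - pi <= s <= pi ->
  exists k : 'I_n.+1, gridpt n k <= s < gridpt n k + cell n.
Proof.
move=> /andP[s1 s2]; have p0 := @pi_gt0 R.
have n0 : 0 < n.+1%:R :> R by rewrite ltr0n.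
pose step : R := 2 * pi / n.+1%:R.
have st0 : 0 < step by rewrite divr_gt0// mulr_gt0.
have cs : step < cell n by rewrite /cell -/step ltr_pMr// ltrDl invr_gt0.
have gE (k : nat) : gridpt n k = - pi + step * k%:R by rewrite /gridpt mulrAC.
have nE : step * n.+1%:R = 2 * pi by rewrite divfK// gt_eqF.
pose y := (s + pi) / step.
have y0 : 0 <= y by rewrite divr_ge0 ?(ltW st0)//; lra.
have ys : step * y = s + pi by rewrite mulrC divfK// gt_eqF.
have /andP[m1 m2] := truncn_itv y0.
have {}m1 := ler_wpM2l (ltW st0) m1; have := m2; rewrite -(ltr_pM2l st0) => {}m2.
rewrite ys in m1 m2.
have [mn|mn] := ltnP (Num.truncn y) n.+1.
  by exists (Ordinal mn); rewrite /= gE -natr1 mulrDr mulr1 in m2 *; lra.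
have nE' : step * n%:R + step = 2 * pi by rewrite -nE -natr1 mulrDr mulr1.
exists ord_max; rewrite gE /=.
have : step * n.+1%:R <= step * (Num.truncn y)%:R by rewrite ler_pM2l// ler_nat.
by rewrite nE; move: (cell n) cs => c cs; lra.
Qed.

(** Only the cells that meet [A] are kept. At the corner of such a cell [p] is at least
    [1 - L N cell], so the number of kept cells is controlled by the grid sum of [p]. *)
Lemma leb_outer_gmean p A (L : R) n : (0 < N)%N -> A `<=` @cube R N -> 0 <= L ->
  (forall x, 0 <= p x) -> (forall x, A x -> p x = 1) -> lipschitz_all L p ->
  (leb_outer A <= ((2 * pi) ^+ N * (1 + n.+1%:R^-1) ^+ N * (gmean n p + L * (N%:R * cell n)))%:E)%E.
Proof.
move=> N0 Acube L0 p0 p1 plip; have pi0 := @pi_gt0 R.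
have n0 : 0 < n.+1%:R :> R by rewrite ltr0n.
have c0 := cell_ge0 n.
pose hi (k : {ffun 'I_N -> 'I_n.+1}) : 'I_N -> R := fun i => grid k i + cell n.
pose meets (k : {ffun 'I_N -> 'I_n.+1}) := `[< exists2 x, A x & box (grid k) (hi k) x >].
pose s := [seq (@grid R N n k, hi k) | k <- enum meets].
apply: le_trans (leb_outer_seq (s := s) N0 _) _ => [x Ax|].
  have /choice[k Hk] : forall i, exists k : 'I_n.+1, gridpt n k <= x i < gridpt n k + cell n.
    by move=> i; apply: cell_cover; exact: Acube.
  pose f : {ffun 'I_N -> 'I_n.+1} := [ffun i => k i].
  have bx : box (grid f) (hi f) x by move=> i; rewrite /hi /grid ffunE.
  have mf : f \in enum meets by rewrite mem_enum; apply/asboolP; exists x.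
  exists (index f (enum meets)); first by rewrite size_map index_mem.
  by rewrite (nth_map f) ?index_mem// nth_index.
rewrite lee_fin big_map big_enum/=.
have vol k : box_vol (grid k) (hi k) = cell n ^+ N.
  rewrite /box_vol -[N in RHS]card_ord -prodr_const; apply: eq_bigr => i _.
  by rewrite /hi addrAC subrr add0r max_l.
under eq_bigr do rewrite vol.
rewrite -[X in X <= _]mulr1 mulr_suml big_mkcond/=.
apply: (@le_trans _ _ (\sum_(k : {ffun 'I_N -> 'I_n.+1})
    cell n ^+ N * (p (grid k) + L * (N%:R * cell n)))).
  apply: ler_sum => k _; case: ifPn => [/asboolP[x Ax bx]|_]; last first.
    by rewrite mulr_ge0 ?exprn_ge0// addr_ge0// mulr_ge0// mulr_ge0//.
  rewrite ler_wpM2l ?exprn_ge0//.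
  have xd : l1dist x (grid k) <= N%:R * cell n.
    apply: l1dist_le => i; have /andP[b1 b2] := bx i; rewrite /hi in b2.
    by rewrite ger0_norm; lra.
  have := plip x (grid k); rewrite (p1 x Ax) ler_norml => /andP[_ h].
  by have := ler_wpM2l L0 xd; lra.
rewrite -mulr_sumr big_split/= sumr_const card_ffun !card_ord -[_ *+ _]mulr_natl natrX.
rewrite /gmean /cell exprMn expr_div_n.
have nN : n.+1%:R ^+ N != 0 :> R by rewrite expf_neq0// gt_eqF.
move: (n.+1%:R ^+ N : R) nN => M M0; move: (n.+1%:R^-1 : R) (\sum_k _) => u S.
by rewrite le_eqVlt; apply/orP; left; apply/eqP; field.
Qed.

Lemma leb_outer_upmean p A (L : R) : (0 < N)%N -> A `<=` @cube R N -> 0 <= L ->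
  (forall x, 0 <= p x <= 1) -> (forall x, A x -> p x = 1) -> lipschitz_all L p ->
  (leb_outer A <= ((2 * pi) ^+ N * upmean p)%:E)%E.
Proof.
move=> N0 Acube L0 p01 p1 plip; have pi0 := @pi_gt0 R.
have /andP[U0 _] := upmean_bounds p01.
(* [g d] bounds the estimate of [leb_outer_gmean] when both [1/n.+1] and the excess of the grid mean
   over [upmean p] are at most [d]; it is continuous with the desired value at [0]. *)
pose g (d : R) := (2 * pi) ^+ N * (1 + d) ^+ N * ((upmean p + d) + L * (N%:R * (2 * pi * d * (1 + d)))).
apply/lee_addgt0Pr => e e0; rewrite -EFinD.
have cg : g d @[d --> 0] --> g 0.
  have c1 : (1 + d) @[d --> (0 : R)] --> (1 + 0 : R) by apply: cvgD; [exact: cvg_cst|exact: cvg_id].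
  apply: cvgM; [apply: cvgM; [exact: cvg_cst|]|apply: cvgD].
  - apply: (@cvg_comp _ _ _ (fun d => 1 + d) (fun z => z ^+ N)); first exact: c1.
    exact: exprn_continuous.
  - by apply: cvgD; [exact: cvg_cst|exact: cvg_id].
  apply: cvgM; first exact: cvg_cst; apply: cvgM; first exact: cvg_cst.
  by apply: cvgM; [apply: cvgM; [exact: cvg_cst|exact: cvg_id]|exact: c1].
have g0 : g 0 = (2 * pi) ^+ N * upmean p by rewrite /g !(addr0, mulr0, mul0r) expr1n mulr1.
have /cvgrPdist_le /(_ e e0) /nbhs_ballP[d /= d0 H] := cg.
have d2 : 0 < d / 2 by rewrite divr_gt0.
have gd : g (d / 2) <= (2 * pi) ^+ N * upmean p + e.
  have := H (d / 2); rewrite /ball/= sub0r normrN gtr0_norm// => /(_ ltac:(lra)).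
  by rewrite g0 ler_norml => /andP[]; lra.
have [n1 H1] := upmean_adherent p01 d2; have [n2 H2] := eventually_small 1 d2.
pose n := maxn n1 n2.
have h1 := H1 n (leq_maxl _ _); have h2 := H2 n (leq_maxr _ _).
rewrite mul1r in h2.
apply: le_trans (leb_outer_gmean n N0 Acube L0 (fun x => proj1 (andP (p01 x))) p1 plip) _.
rewrite lee_fin; apply: le_trans gd; rewrite /g.
have u0 : 0 <= n.+1%:R^-1 :> R by rewrite invr_ge0.
have pp : 0 <= 2 * pi :> R by rewrite mulr_ge0// ltW.
have m0 : 0 <= gmean n p by have /andP[] := gmean_bounds n p01.
have hc : cell n <= 2 * pi * (d / 2) * (1 + d / 2).
  have q1 : 2 * pi / n.+1%:R <= 2 * pi * (d / 2) by rewrite ler_wpM2l.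
  have q2 : 1 + n.+1%:R^-1 <= 1 + d / 2 by rewrite lerD2l.
  apply: (ler_pM _ _ q1 q2); [exact: mulr_ge0 pp u0|exact: addr_ge0].
have c0 := cell_ge0 n.
have q1 : (2 * pi) ^+ N * (1 + n.+1%:R^-1) ^+ N <= (2 * pi) ^+ N * (1 + d / 2) ^+ N.
  by rewrite ler_wpM2l ?exprn_ge0// lerXn2r ?nnegrE ?addr_ge0 ?(ltW d2)// lerD2l.
have q2 : gmean n p + L * (N%:R * cell n) <=
    upmean p + d / 2 + L * (N%:R * (2 * pi * (d / 2) * (1 + d / 2))).
  by apply: lerD => //; do 2!rewrite ler_wpM2l//.
apply: (ler_pM _ _ q1 q2).
  by apply: mulr_ge0; apply: exprn_ge0 => //; exact: addr_ge0.
by apply: addr_ge0 => //; apply: mulr_ge0 => //; exact: mulr_ge0.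
Qed.

End OuterMeasure.

(** * Comparison and final estimates *)

Section Comparison.
Context {R : realType}.
Implicit Types (V Y rho j : R -> R) (a b t h K C M : R).

(** A positive gap [V - Y] at [Ta] loses at most [E h^2] per step, hence a total that vanishes with
    [h], so it survives until [Tb]. Rates are taken at [t + h] because the supersolutions used are
    convex: their increment is at most [h] times the slope at the right end. *)
Lemma comparison V Y rho j (Ta Tb K C M rmax : R) : Ta <= Tb -> 0 <= K -> 0 <= C -> 0 <= M ->
  (forall t h, Ta <= t -> 0 <= h -> t + h <= Tb ->
    V t + h * (K * (rho (t + h) * V t - j (rho (t + h)))) - C * h ^+ 2 <= V (t + h)) ->
  (forall t, Ta <= t <= Tb -> 0 <= rho t <= rmax) ->
  (forall t h, Ta <= t -> 0 <= h -> t + h <= Tb ->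
    Y (t + h) - Y t <= h * (K * (rho (t + h) * Y (t + h) - j (rho (t + h)))) /\
    Y (t + h) - Y t <= h * M) ->
  V Tb <= Y Tb -> V Ta <= Y Ta.
Proof.
move=> Tab K0 C0 M0 HV Hr HY end_le; rewrite leNgt; apply/negP => start_lt.
have r0 : 0 <= rmax.
  have TaI : Ta <= Ta <= Tb by rewrite lexx.
  by have /andP[r1 r2] := Hr Ta TaI; apply: le_trans r1 r2.
(* [C] is the error of the step for [V]; [K rmax M] pays for replacing [Y (t + h)] by [Y t] on the
   right side. *)
have [E E0 EE] : exists2 E, 0 <= E & E = C + K * rmax * M.
  by exists (C + K * rmax * M) => //; rewrite addr_ge0// !mulr_ge0.
have D0 : 0 < V Ta - Y Ta by rewrite subr_gt0.
have D2 : 0 < (V Ta - Y Ta) / 2 by rewrite divr_gt0.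
have [m Hm] := eventually_small (E * (Tb - Ta) ^+ 2) D2.
have {}Hm := Hm m (leqnn m).
have m0 : 0 < m.+1%:R :> R by rewrite ltr0n.
have [h hE] : exists h, h = (Tb - Ta) / m.+1%:R by eexists.
have hm : h * m.+1%:R = Tb - Ta by rewrite hE divfK// gt_eqF.
have h0 : 0 <= h by rewrite hE divr_ge0 ?subr_ge0// ltW.
have total : E * h ^+ 2 * m.+1%:R <= (V Ta - Y Ta) / 2.
  apply: le_trans Hm; rewrite -hm exprMn le_eqVlt; apply/orP; left; apply/eqP.
  by field; rewrite gt_eqF// addrC natr1.
have Eh : 0 <= E * h ^+ 2 by rewrite mulr_ge0 ?sqr_ge0.
have track (k : nat) : (k <= m.+1)%N ->
    V Ta - Y Ta - E * h ^+ 2 * k%:R <= V (Ta + h * k%:R) - Y (Ta + h * k%:R).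
  elim: k => [_|k IH km]; first by rewrite !mulr0 subr0 addr0.
  have {}IH := IH (ltnW km).
  have kle : k.+1%:R <= m.+1%:R :> R by rewrite ler_nat.
  have kp : 0 <= k%:R :> R by [].
  set t := Ta + h * k%:R in IH *.
  have tS : Ta + h * k.+1%:R = t + h by rewrite /t -natr1 mulrDr mulr1 addrA.
  have Tt : Ta <= t by rewrite lerDl mulr_ge0.
  have tT : t + h <= Tb.
    by rewrite -tS -lerBrDl -hm ler_wpM2l.
  rewrite tS; have hv := HV t h Tt h0 tT; have [hy1 hy2] := HY t h Tt h0 tT.
  have thI : Ta <= t + h <= Tb by apply/andP; split => //; apply: le_trans Tt _; rewrite lerDl.
  have /andP[q0 q1] := Hr (t + h) thI.
  have pos : 0 <= V t - Y t.
    have : E * h ^+ 2 * k%:R <= E * h ^+ 2 * m.+1%:R by rewrite ler_wpM2l// ler_nat ltnW.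
    by lra.
  have w1 : 0 <= h * K * rho (t + h) by rewrite !mulr_ge0.
  have w2 := mulr_ge0 w1 pos.
  have w3 : h * K * rho (t + h) * (Y (t + h) - Y t) <= h * K * rmax * (h * M).
    have [y0|y0] := lerP 0 (Y (t + h) - Y t).
      by apply: ler_pM => //; rewrite ler_wpM2l// mulr_ge0.
    apply: (@le_trans _ _ 0); first by rewrite mulr_ge0_le0// ltW.
    by rewrite !mulr_ge0.
  rewrite -[k.+1%:R]natr1; rewrite EE in IH *.
  move: (V t) (V (t + h)) (Y t) (Y (t + h)) (rho (t + h)) (j _) (V Ta) (Y Ta) (k%:R : R) hv hy1 IH w2 w3
    => v1 v2 y1 y2 r jr va ya kk hv hy1 IH w2 w3.
  by lra.
have := track m.+1 (leqnn _); rewrite hm [Ta + _]addrC subrK; lra.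
Qed.

(** The bound solves [Y' = K r (Y - g)] with [Y Tb = v], and [j <= r g] makes it a supersolution. *)
Lemma comparison_exp V (j r K C g v Ta Tb : R) : Ta <= Tb -> 0 <= K -> 0 <= C -> 0 <= r -> g <= v ->
  j <= r * g ->
  (forall t h, Ta <= t -> 0 <= h -> t + h <= Tb ->
    V t + h * (K * (r * V t - j)) - C * h ^+ 2 <= V (t + h)) ->
  V Tb <= v -> V Ta <= g + (v - g) * expR (- (K * r * (Tb - Ta))).
Proof.
move=> Tab K0 C0 r0 gv jg HV Vv.
pose Y t := g + (v - g) * expR (- (K * r * (Tb - t))).
have k0 : 0 <= K * r by rewrite mulr_ge0.
have vg : 0 <= v - g by rewrite subr_ge0.
apply: (@comparison V Y (fun _ => r) (fun _ => j) Ta Tb K C (K * r * (v - g)) r) => //.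
- by rewrite mulr_ge0.
- by move=> t _; rewrite r0 lexx.
- move=> t h Tt h0 thT.
  have [E EE] : exists E, E = expR (- (K * r * (Tb - (t + h)))) by eexists.
  have E0 : 0 <= E by rewrite EE expR_ge0.
  have E1 : E <= 1 by rewrite EE -expR0 ler_expR oppr_le0 mulr_ge0// subr_ge0.
  have e : expR (- (K * r * (Tb - t))) = E * expR (- (K * r * h)).
    by rewrite EE -expRD; congr expR; ring.
  have b1 : 1 - K * r * h <= expR (- (K * r * h)) by exact: expR_ge1Dx.
  have step : Y (t + h) - Y t <= (v - g) * (E * (K * r * h)).
    rewrite /Y -EE e opprD addrACA subrr add0r -mulrBr ler_wpM2l// -{1}[E]mulr1 -mulrBr ler_wpM2l//.
    by lra.
  split; apply: le_trans step _.
    have h1 : 0 <= h * K * (r * g - j) by rewrite !mulr_ge0// subr_ge0.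
    by rewrite /Y -EE; lra.
  have h1 : 0 <= (v - g) * (K * r * h) * (1 - E).
    by apply: mulr_ge0; [apply: mulr_ge0 => //; exact: mulr_ge0|rewrite subr_ge0].
  by lra.
by rewrite /Y subrr mulr0 oppr0 expR0 mulr1 addrC subrK.
Qed.

Lemma powRE (z x : R) : 0 < z -> z `^ x = expR (x * ln z).
Proof. by move=> z0; rewrite /powR gt_eqF. Qed.

(** With [z = a + B (Tb - t)], [Y = z^(-m)] and [r = c / z], the loss [j r] is the fraction [1 - e]
    of [r Y]. What remains is [K (c / z) e Y], which dominates [Y' = (m B / z) Y]. *)
Lemma comparison_powR V (j : R -> R) (a B c m K C e Ta Tb : R) : Ta <= Tb -> 0 <= K -> 0 <= C ->
  0 < a -> 0 <= B -> 0 < c -> 0 <= m -> m * B <= K * c * e ->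
  (forall z, a <= z -> c / z * (1 - e) * z `^ (- m) = j (c / z)) ->
  (forall t h r, Ta <= t -> 0 <= h -> t + h <= Tb -> 0 < r <= c / a ->
    V t + h * (K * (r * V t - j r)) - C * h ^+ 2 <= V (t + h)) ->
  V Tb <= a `^ (- m) -> V Ta <= (a + B * (Tb - Ta)) `^ (- m).
Proof.
move=> Tab K0 C0 a0 B0 c0 m0 rate jE HV Vv.
pose z t := a + B * (Tb - t).
have za t : t <= Tb -> a <= z t by move=> tT; rewrite /z lerDl mulr_ge0// subr_ge0.
have zp t : t <= Tb -> 0 < z t by move=> tT; exact: lt_le_trans (za t tT).
have rb t : t <= Tb -> 0 < c / z t <= c / a.
  move=> tT; rewrite divr_gt0 ?zp//= ler_pM2l// lef_pV2 ?za ?posrE ?zp//.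
apply: (@comparison V (fun t => z t `^ (- m)) (fun t => c / z t) j Ta Tb K C (m * B / a * a `^ (- m)) (c / a)) => //.
- by rewrite mulr_ge0 ?powR_ge0// divr_ge0 ?mulr_ge0// ltW.
- by move=> t h Tt h0 thT; apply: HV => //; exact: rb.
- by move=> t /andP[_ tT]; have /andP[/ltW -> ->] := rb t tT.
- move=> t h Tt h0 thT; set u := z (t + h).
  have u0 : 0 < u by exact: zp.
  have au : a <= u by exact: za.
  have zt : z t = u * (1 + B * h / u).
    by rewrite mulrDr mulr1 mulrCA divff ?gt_eqF// mulr1 /u /z; ring.
  have w0 : 0 <= B * h / u by rewrite divr_ge0 ?mulr_ge0// ltW.
  have w1 : 0 < 1 + B * h / u by lra.
  have P0 : 0 <= u `^ (- m) by exact: powR_ge0.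
  have e1 : z t `^ (- m) = u `^ (- m) * (1 + B * h / u) `^ (- m).
    by rewrite zt powRM// ltW.
  have low : 1 - m * (B * h / u) <= (1 + B * h / u) `^ (- m).
    rewrite powRE//; apply: le_trans (expR_ge1Dx _); rewrite mulNr lerD2l lerN2 ler_wpM2l//.
    by apply: le_ln1Dx; lra.
  have step : u `^ (- m) - z t `^ (- m) <= u `^ (- m) * (m * (B * h / u)).
    by rewrite e1 -{1}[u `^ _]mulr1 -mulrBr ler_wpM2l//; lra.
  split; apply: le_trans step _.
    rewrite -jE// -subr_ge0.
    rewrite (_ : _ - _ = h / u * u `^ (- m) * (K * c * e - m * B)); last first.
      by field; rewrite gt_eqF.
    by rewrite mulr_ge0 ?subr_ge0// mulr_ge0// divr_ge0// ltW.
  have pm : u `^ (- m) <= a `^ (- m).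
    rewrite !powRE// ler_expR !mulNr lerN2 ler_wpM2l// ler_ln//.
  rewrite (_ : _ * (m * _) = h * (m * B / u * u `^ (- m))); last by ring.
  rewrite ler_wpM2l//; apply: ler_pM => //; first by rewrite divr_ge0 ?mulr_ge0// ltW.
  by rewrite ler_wpM2l ?mulr_ge0// lef_pV2 ?posrE.
by rewrite /z subrr mulr0 addr0.
Qed.

End Comparison.

(** * A priori bounds on the volume and passage to the measure *)

Section FinalBounds.
Context {R : realType} {N : nat}.
Implicit Types (x : 'I_N -> R) (b eta T t rho : R).

Variables (omega : 'I_N -> R) (kappa : R) (sol : ('I_N -> R) -> R -> 'I_N -> R).
Hypotheses (N0 : (0 < N)%N) (k0 : 0 <= kappa).
Hypothesis solP : forall x, is_solution omega kappa x (sol x).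

Lemma survivors_le_exp b eta T t x (lambda : R) : 0 < eta -> 0 <= t <= T -> 0 <= lambda ->
  survivors sol b eta T t x <= \prod_i (expR (lambda * b) * expR (- lambda * (1 + cos (x i)))).
Proof.
move=> e0 tT l0; rewrite prod_chernoff.
have /andP[p0 p1] := survivors01 sol b eta T t x.
have [pp|np] := ltrP 0 (survivors sol b eta T t x); last first.
  by apply: le_trans np (expR_ge0 _).
have Rb := survivors_gt0 N0 k0 solP e0 tT pp.
apply: le_trans p1 _; rewrite -[leLHS]expR0 ler_expR.
rewrite (_ : _ - _ = lambda * N%:R * (b - order_param x)); last by ring.
by rewrite !mulr_ge0// subr_ge0 ltW.
Qed.

Lemma volume_le_prod b eta T t (f : R -> R) (beta K : R) : (forall s, 0 <= f s) -> 0 <= beta ->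
  (forall x, survivors sol b eta T t x <= \prod_i f (x i)) ->
  (forall n, mean1 n f <= beta + K / n.+1%:R) ->
  volume sol b eta T t <= beta ^+ N.
Proof.
move=> f0 b0 pf fm; apply: upmean_le => [x|]; first exact: survivors01.
exact: gmean_prod_le pf fm.
Qed.

Lemma volume_le_small b eta T t : 0 < b -> 0 < eta -> 0 <= t <= T ->
  volume sol b eta T t <= small_order_bound N b.
Proof.
move=> b0 e0 tT; pose lambda := (2 * b)^-1.
have l0 : 0 < lambda by rewrite invr_gt0 mulr_gt0.
have [K fK] := mean1_exp_one_cos l0.
apply: (volume_le_prod (f := fun s => expR (lambda * b) * expR (- lambda * (1 + cos s)))
    (K := expR (2^-1) * K)).
- by move=> s; rewrite mulr_ge0 ?expR_ge0.
- by rewrite divr_ge0 ?sqrtr_ge0.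
- by move=> x; apply: survivors_le_exp => //; exact: ltW.
have -> : lambda * b = 2^-1 by rewrite /lambda; field; rewrite gt_eqF.
by move=> n; rewrite mean1Z -sqrt_chernoff// -mulrA -mulrDr ler_wpM2l ?expR_ge0.
Qed.

(** Chernoff with [lambda = 2 d], which minimizes [- lambda d + lambda^2/4]; [d <= 1/2] keeps
    [lambda] in the range of [mean1_exp_cos]. *)
Lemma volume_le_hoeffding (d : R) eta T t : 0 <= d <= 2^-1 -> 0 < eta -> 0 <= t <= T ->
  volume sol (1 - d) eta T t <= expR (- (N%:R * d ^+ 2)).
Proof.
move=> /andP[d0 d1] e0 tT.
have l01 : 0 <= 2 * d <= 1 by apply/andP; split; lra.
have /andP[l0 _] := l01.
have [K fK] := mean1_exp_cos l01.
have -> : expR (- (N%:R * d ^+ 2)) = expR (- d ^+ 2) ^+ N :> R.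
  by rewrite -expRM_natl mulrN mulrC.
have fE s : expR (2 * d * (1 - d)) * expR (- (2 * d) * (1 + cos s)) =
    expR (- (2 * d ^+ 2)) * expR (- (2 * d) * cos s).
  by rewrite -!expRD; congr expR; ring.
apply: (volume_le_prod (f := fun s => expR (2 * d * (1 - d)) * expR (- (2 * d) * (1 + cos s)))
    (K := expR (- (2 * d ^+ 2)) * K)).
- by move=> s; rewrite mulr_ge0 ?expR_ge0.
- exact: expR_ge0.
- by move=> x; exact: survivors_le_exp.
move=> n; rewrite (_ : (fun s => _) = fun s => expR (- (2 * d ^+ 2)) * expR (- (2 * d) * cos s)); last first.
  by apply/funext.
rewrite mean1Z; have -> : expR (- d ^+ 2) = expR (- (2 * d ^+ 2)) * expR ((2 * d) ^+ 2 / 4).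
  by rewrite -expRD; congr expR; field.
by rewrite -mulrA -mulrDr ler_wpM2l ?expR_ge0.
Qed.

(** A point of the cube outside [E] never reaches [b - eta] during [[0, T]], so the cutoff equals
    [1] there. *)
Lemma norm_meas_lower_bound b eta T (v : R) (E : set ('I_N -> R)) : 0 < eta -> 0 <= T ->
  (forall x t0, cube x -> 0 <= t0 <= T -> b - eta <= order_param (sol x t0) -> E x) ->
  volume sol b eta T 0 <= v -> ((1 - v)%:E <= norm_meas E)%E.
Proof.
move=> e0 T0 HE Vv; have p0 := @pi_gt0 R.
have cN : 0 < (2 * pi) ^+ N :> R by rewrite exprn_gt0// mulr_gt0.
have T00 : 0 <= (0 : R) <= T by rewrite lexx.
have L0 : 0 <= eta^-1 * (N%:R * expR (6 * kappa * N%:R * T)) ^+ 2.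
  by rewrite mulr_ge0 ?sqr_ge0// invr_ge0 ltW.
have out : (leb_outer (@cube R N `\` E) <= ((2 * pi) ^+ N * volume sol b eta T 0)%:E)%E.
  apply: (leb_outer_upmean N0 _ L0 (survivors01 sol b eta T 0) _ (survivors_lipschitz N0 k0 solP b e0 T00)).
    by move=> x [].
  move=> x [xc nE]; rewrite /survivors oppr0 (solP x).1 /cutoff clamp_eq1//.
  rewrite ler_pdivlMr// mul1r lerBrDl -lerBrDr; apply: max_order_le => // s sT.
  by rewrite leNgt; apply/negP => /ltW h; apply: nE; apply: HE sT h.
rewrite /norm_meas EFinB; apply: leeB => //.
apply: (@le_trans _ _ (((2 * pi) ^- N)%:E * ((2 * pi) ^+ N * volume sol b eta T 0)%:E)%E).
  by rewrite lee_wpmul2l// lee_fin invr_ge0 ltW.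
by rewrite -EFinM lee_fin mulKf// gt_eqF.
Qed.

End FinalBounds.

(** * Numerical constants *)

Section Constants.
Context {R : realType}.

Lemma expR1_bounds : 5 / 2 <= (expR 1 : R) <= 4.
Proof.
apply/andP; split.
  by apply: le_trans (expR_ge_quadratic ler01); rewrite expr1n; lra.
have h : 2^-1 <= expR (- 2^-1) :> R by apply: le_trans (expR_ge1Dx _); lra.
have e : expR 1 * (expR (- 2^-1) * expR (- 2^-1)) = 1 :> R.
  by rewrite -!expRD (_ : _ + _ = 0) ?expR0//; field.
have E0 := expR_ge0 (1 : R).
have : 2^-1 * 2^-1 <= expR (- 2^-1) * expR (- 2^-1) :> R by apply: ler_pM; lra.
by move=> /(ler_wpM2l E0); rewrite e; lra.
Qed.

Lemma pi_le4 : pi <= 4 :> R.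
Proof. by have := @pihalf_lt2 R; lra. Qed.

(** [cos (7/5) = 1 - 2 sin^2 (7/10) >= 1 - 2 (7/10)^2 > 0] puts [7/5] below [pi / 2]. *)
Lemma pi_ge14_5 : 14 / 5 <= pi :> R.
Proof.
have p2 := @pi_ge2 R; have p0 := @pi_gt0 R.
have c14 : 1 / 50 <= cos (7 / 5) :> R.
  have -> : 7 / 5 = (7 / 10) *+ 2 :> R by rewrite -mulr_natr; field.
  rewrite cos_mulr2n cos2sin2 mulr2n.
  have := sin_lipschitz (7 / 10 : R) 0; rewrite sin0 !subr0 [X in _ <= X]ger0_norm; last by lra.
  move=> h; have : `|sin (7 / 10 : R)| ^+ 2 <= (7 / 10) ^+ 2 by rewrite ler_pXn2r// nnegrE; lra.
  by rewrite real_normK ?num_real//; lra.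
rewrite leNgt; apply/negP => lt.
have : cos (7 / 5) < cos (pi / 2) :> R by rewrite ltr_cos ?in_itv/=; lra.
by rewrite cos_pihalf; lra.
Qed.

Lemma small_order_bound_powR (N : nat) (z : R) : 0 < z ->
  small_order_bound N (4 / (pi * expR 1) / z) = z `^ (- (N%:R / 2)).
Proof.
move=> z0; have p0 := @pi_gt0 R; have e0 := expR_gt0 (1 : R).
rewrite /small_order_bound powRE//.
have -> : pi * expR 1 * (4 / (pi * expR 1) / z) = (2 * expR (- (ln z / 2))) ^+ 2.
  rewrite exprMn -expRM_natl mulrN [2%:R * _]mulrC divfK// expRN lnK//.
  by move: (@pi R) p0 (expR 1 : R) e0 => p pp E EE; field; rewrite !gt_eqF.
rewrite sqrtr_sqr ger0_norm ?mulr_ge0 ?expR_ge0// mulrC mulKf// -expRM_natl.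
by congr expR; field.
Qed.

End Constants.

(** * The exponential phase and the power phase *)

Section Phases.
Context {R : realType} {N : nat}.
Variables (omega : 'I_N -> R) (kappa : R) (sol : ('I_N -> R) -> R -> 'I_N -> R).
Hypotheses (N2 : (2 <= N)%N) (k0 : 0 < kappa).
Hypothesis solP : forall x, is_solution omega kappa x (sol x).

Let N0 : (0 < N)%N := ltnW N2.

Lemma volume_phase_exp (b eta T Ta rho v : R) : 0 < eta -> 0 <= Ta <= T -> 0 < rho <= 1 ->
  b <= 1 - rho -> small_order_bound N rho / (N%:R / 2 + 1) <= v -> volume sol b eta T T <= v ->
  volume sol b eta T Ta <= small_order_bound N rho / (N%:R / 2 + 1) +
    (v - small_order_bound N rho / (N%:R / 2 + 1))
      * expR (- (kappa * N%:R * (1 - rho) * rho * (T - Ta))).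
Proof.
move=> e0 /andP[Ta0 TaT] /andP[r0 r1] br gv Vv.
have [C C0 growth] := volume_growth N0 (ltW k0) solP b e0 (le_trans Ta0 TaT).
have n2 : 2 <= N%:R :> R by rewrite ler_nat.
have G0 : 0 <= small_order_bound N rho.
  by rewrite exprn_ge0// divr_ge0 ?sqrtr_ge0.
have /andP[e1 _] := @expR1_bounds R.
apply: (@comparison_exp _ _ (2 * rho / (N%:R * expR 1) * small_order_bound N rho) _ _ C) => //.
- by rewrite !mulr_ge0 ?(ltW k0)// subr_ge0.
- exact: ltW.
(* The equilibrium of the linear inequality is [2 G / (N e)]; since [N e >= N + 2], it is at most
   the [G / (N/2 + 1)] of the statement. *)
- have q : 2 / (N%:R * expR 1) <= (N%:R / 2 + 1)^-1 :> R.
    rewrite ler_pdivrMr ?mulr_gt0 ?expR_gt0 ?ltr0n// ler_pdivlMl; last by lra.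
    by have := ler_wpM2l (ler0n R N) e1; lra.
  have := ler_wpM2l (mulr_ge0 (ltW r0) G0) q.
  set G := small_order_bound _ _; rewrite (_ : rho * G * (2 / _) = 2 * rho / (N%:R * expR 1) * G); last by ring.
  by rewrite mulrA.
by move=> t h Tat h0 thT; apply: growth => //; apply: le_trans Ta0 Tat.
Qed.

(** [rho = 4 / (pi e) / z] solves [small_order_bound N rho = z^(-N/2)], so the loss is the fraction
    [2 / (N e)] of the gain, whatever [z] is. *)
Lemma volume_phase_power (b eta T Tb a B rhom : R) : 0 < eta -> 0 <= Tb <= T -> 0 < a -> 0 <= B ->
  4 / (pi * expR 1) / a <= rhom -> rhom <= 1 -> b <= 1 - rhom ->
  B <= 2 * kappa * (1 - rhom) * (4 / (pi * expR 1)) * (1 - 2 / (N%:R * expR 1)) ->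
  volume sol b eta T Tb <= a `^ (- (N%:R / 2)) ->
  volume sol b eta T 0 <= (a + B * Tb) `^ (- (N%:R / 2)).
Proof.
move=> e0 /andP[Tb0 TbT] a0 B0 cm m1 bm rate Vv.
have [C C0 growth] := volume_growth N0 (ltW k0) solP b e0 (le_trans Tb0 TbT).
have p0 := @pi_gt0 R; have E0 := expR_gt0 (1 : R).
have c0 : 0 < 4 / (pi * expR 1) :> R by rewrite divr_gt0 ?mulr_gt0.
rewrite -[X in B * X]subr0.
apply: (@comparison_powR _ _ (fun r => 2 * r / (N%:R * expR 1) * small_order_bound N r)
  _ _ (4 / (pi * expR 1)) _ (kappa * N%:R * (1 - rhom)) C (1 - 2 / (N%:R * expR 1))) => //.
- by rewrite !mulr_ge0 ?(ltW k0)// subr_ge0.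
- have := ler_wpM2l (ler0n R N) rate.
  by move: (4 / _) (2 / (_ * _)) => c d; lra.
- move=> z az; rewrite small_order_bound_powR; last exact: lt_le_trans az.
  by rewrite opprB addrC subrK; ring.
move=> t h r t0 h0 thT /andP[r0 rca]; apply: growth => //.
- exact: le_trans thT TbT.
- exact: le_trans rca cm.
Qed.

End Phases.

(** * First estimate: the good sets *)

Section Assembly.
Context {R : realType} {N : nat}.

Lemma scaled_small_order_bound (eps : R) : 0 < eps ->
  (Num.sqrt (pi * expR 1 * eps) / (2 * Num.sqrt 5)) ^+ N = small_order_bound N (eps / 5).
Proof.
move=> e0; have p0 := @pi_ge0 R; congr (_ ^+ N).
rewrite [in RHS]mulrA [in RHS]sqrtrM ?mulr_ge0 ?expR_ge0// ?(ltW e0)// sqrtrV//.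
by rewrite invfM mulrA mulrAC.
Qed.

(** Identifies the power inside [T0] as the ratio of the Hoeffding bound at the end to the volume at
    which the power phase takes over. *)
Lemma hoeffding_over_small (eps : R) : 0 < eps ->
  (2 * Num.sqrt 5 / (Num.sqrt (pi * eps) * expR (2^-1 + eps ^+ 2 / 25))) ^+ N =
    expR (- (N%:R * (eps / 5) ^+ 2)) / small_order_bound N (eps / 5).
Proof.
move=> e0; have p0 := @pi_gt0 R.
have -> : expR (- (N%:R * (eps / 5) ^+ 2)) = expR (- (eps ^+ 2 / 25)) ^+ N :> R.
  by rewrite -expRM_natl; congr expR; field.
rewrite -scaled_small_order_bound// -expr_div_n; congr (_ ^+ N).
have -> : Num.sqrt (pi * expR 1 * eps) = Num.sqrt (pi * eps) * expR (2^-1).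
  rewrite mulrAC sqrtrM ?mulr_ge0 ?(ltW p0) ?(ltW e0)//; congr (_ * _).
  have -> : expR 1 = expR (2^-1) ^+ 2 :> R by rewrite -expRM_natl; congr expR; field.
  by rewrite sqrtr_sqr ger0_norm ?expR_ge0.
rewrite expRD expRN.
have s1 : 0 < Num.sqrt (pi * eps) :> R by rewrite sqrtr_gt0 mulr_gt0.
have s5 : 0 < Num.sqrt 5 :> R by rewrite sqrtr_gt0.
have E1 := expR_gt0 (2^-1 : R); have E2 := expR_gt0 (eps ^+ 2 / 25).
by field; rewrite !gt_eqF.
Qed.

(** Ensures [T0 >= 0]. After squaring one factor it reduces to [16 eps / 20 <= 1 - 2 eps^2 / 25],
    using [pi e <= 16]. *)
Lemma small_le_hoeffding (eps : R) : 0 < eps <= 1 ->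
  small_order_bound N (eps / 5) <= expR (- (N%:R * (eps / 5) ^+ 2)).
Proof.
move=> /andP[e0 e1]; have p0 := @pi_ge0 R; have p4 := @pi_le4 R.
have /andP[_ E4] := @expR1_bounds R; have E0 := expR_ge0 (1 : R).
have -> : expR (- (N%:R * (eps / 5) ^+ 2)) = expR (- (eps / 5) ^+ 2) ^+ N :> R.
  by rewrite -expRM_natl mulrN mulrC.
have s0 : 0 <= Num.sqrt (pi * expR 1 * (eps / 5)) / 2 by rewrite divr_ge0 ?sqrtr_ge0.
rewrite /small_order_bound lerXn2r ?nnegrE ?expR_ge0//.
rewrite -(@ler_pXn2r _ 2)// ?nnegrE ?expR_ge0// expr_div_n sqr_sqrtr; last first.
  by rewrite !mulr_ge0// ?(ltW e0)// invr_ge0.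
rewrite -expRM_natl; apply: le_trans (expR_ge1Dx _).
have pe : pi * expR 1 <= 4 * 4 :> R by rewrite ler_pM.
have := ler_wpM2r (ltW e0) pe; have : eps ^+ 2 <= eps by rewrite expr2 ler_piMr// ltW.
by rewrite exprMn exprVn; move: (pi * expR 1) (eps ^+ 2) => a d; lra.
Qed.

Lemma norm_meas_no_bad_point (E : set ('I_N -> R)) : (0 < N)%N -> @cube R N `<=` E ->
  (1 <= norm_meas E)%E.
Proof.
move=> N0 cE; have p0 := @pi_ge0 R.
have e : @cube R N `\` E = set0 by apply/seteqP; split => // x [/cE].
have out : (leb_outer (@set0 ('I_N -> R)) <= 0)%E.
  by have := @leb_outer_seq R N set0 [::] N0; rewrite big_nil; apply=> x [].
rewrite /norm_meas e -[leLHS]sube0; apply: leeB => //.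
by rewrite mule_ge0_le0// lee_fin invr_ge0 exprn_ge0// mulr_ge0.
Qed.

Lemma good_set_lower_bound (omega : 'I_N -> R) (kappa eps T : R)
  (sol : ('I_N -> R) -> R -> 'I_N -> R) :
  (2 <= N)%N -> 0 < kappa -> 0 < eps <= 1 ->
  kappa > (2 + eps) * normOmega omega ->
  (forall x, is_solution omega kappa x (sol x)) ->
  let T0 := 25 / (kappa * N%:R * eps * (5 - eps)) *
      ln ((1 + 2 / N%:R) *
          (2 * Num.sqrt 5 / (Num.sqrt (pi * eps) * expR (2^-1 + eps ^+ 2 / 25))) ^+ N
          - 2 / N%:R) in
  0 < T ->
    ((if T <= T0 then
        1 - (N%:R / 2 + 1)^-1 * (Num.sqrt (pi * expR 1 * eps) / (2 * Num.sqrt 5)) ^+ N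
              * (1 - expR (- (kappa * N%:R * eps * (5 - eps) * T / 25)))
          - expR (- (N%:R * eps ^+ 2 / 25) - kappa * N%:R * eps * (5 - eps) * T / 25)
      else
        1 - (20 / (pi * expR 1 * eps) +
             4 * kappa * (5 - eps) / (5 * pi * expR 1) * (T - T0)) `^ (- (N%:R / 2)))%:E
     <= norm_meas (good_set omega kappa eps T sol))%E.
Proof.
move=> N2 k0 e01 kW solP T0 Tpos; have N0 : (0 < N)%N := ltnW N2.
have /andP[e0 e1] := e01; have p0 := @pi_gt0 R; have E0 := expR_gt0 (1 : R).
have n2 : 2 <= N%:R :> R by rewrite ler_nat.
have n0 : 0 < N%:R :> R by rewrite ltr0n.
(* With [b = 1 - eps/5] and [eta = eps/100], [b - eta] is the threshold [1 - 21 eps/100] of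
   [good_of_crossing]. *)
have eta0 : 0 < eps / 100 by lra.
rewrite scaled_small_order_bound//.
have vE : expR (- (N%:R * (eps / 5) ^+ 2)) = expR (- (N%:R * eps ^+ 2 / 25)) :> R.
  by congr expR; field.
have Gv := small_le_hoeffding e01; have XE := hoeffding_over_small e0.
rewrite XE in T0 *; rewrite vE in Gv T0 *.
have G0 : 0 < small_order_bound N (eps / 5).
  by rewrite exprn_gt0// divr_gt0 ?sqrtr_gt0// !mulr_gt0// invr_gt0.
set G := small_order_bound N (eps / 5) in T0 Gv G0 *.
set v := expR (- (N%:R * eps ^+ 2 / 25)) in T0 Gv *.
pose rate := kappa * N%:R * eps * (5 - eps) / 25.
have rate0 : 0 < rate by rewrite !mulr_gt0//; lra.
have v_end : volume sol (1 - eps / 5) (eps / 100) T T <= v.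
  rewrite /v -vE; apply: (volume_le_hoeffding N0 (ltW k0) solP) => //; last by rewrite lexx (ltW Tpos).
  by lra.
have gG : G / (N%:R / 2 + 1) <= G.
  by rewrite ler_pdivrMr; [rewrite ler_peMr// ?(ltW G0)//|]; lra.
have r01 : 0 < eps / 5 <= 1 by apply/andP; split; lra.
have phase1 Ta : 0 <= Ta <= T -> volume sol (1 - eps / 5) (eps / 100) T Ta <=
    G / (N%:R / 2 + 1) + (v - G / (N%:R / 2 + 1)) * expR (- (rate * (T - Ta))).
  move=> TaT; have -> : rate = kappa * N%:R * (1 - eps / 5) * (eps / 5) by rewrite /rate; field.
  by apply: volume_phase_exp => //; exact: le_trans gG Gv.
have meas := norm_meas_lower_bound N0 (ltW k0) solP (b := 1 - eps / 5) eta0 (ltW Tpos).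
have good x t0 : cube x -> 0 <= t0 <= T -> 1 - eps / 5 - eps / 100 <= order_param (sol x t0) ->
    good_set omega kappa eps T sol x.
  move=> xc /andP[_ t0T] Rt; split => //.
  apply: (good_of_crossing (solP x) N0 k0 e01 kW (t0 := t0)) => //.
  by apply: le_trans Rt; lra.
have {}meas := meas _ _ good.
case: ifPn => [_|].
  rewrite (_ : _ - _ = 1 - (G / (N%:R / 2 + 1) + (v - G / (N%:R / 2 + 1)) * expR (- (rate * (T - 0))))).
    by apply: meas; apply: phase1; rewrite lexx (ltW Tpos).
  rewrite expRD -/v subr0 (_ : rate * T = kappa * N%:R * eps * (5 - eps) * T / 25); last first.
    by rewrite /rate; ring.
  by rewrite -[(- (_ / 25))%R]/(- (_ / 25)); ring.
rewrite -ltNge => T0T.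
set Z := (1 + 2 / N%:R) * (v / G) - 2 / N%:R in T0 T0T *.
have X1 : 1 <= v / G by rewrite ler_pdivlMr// mul1r.
have Z1 : 1 <= Z.
  have : 0 <= (1 + 2 / N%:R) * (v / G - 1) by rewrite mulr_ge0 ?subr_ge0// addr_ge0// divr_ge0.
  by rewrite /Z; move: (v / G) (2 / N%:R) => a d; lra.
have T0E : rate * T0 = ln Z.
  by rewrite /T0 mulrA (_ : rate * _ = 1) ?mul1r// /rate; field; rewrite !gt_eqF//; lra.
have T00 : 0 <= T0.
  by rewrite -(pmulr_rge0 _ rate0) T0E ln_ge0.
have Zp : 0 < Z by lra.
(* Writing [g = G / (N/2 + 1)], [Z] is defined by [v - g = (G - g) Z], so the exponential phase over
   a duration [T0 = ln Z / rate] ends at exactly [G]. *)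
have start : volume sol (1 - eps / 5) (eps / 100) T (T - T0) <= G.
  have := phase1 (T - T0); rewrite (_ : T - (T - T0) = T0); last by ring.
  rewrite T0E expRN lnK ?posrE// => h.
  apply: le_trans (h _) _; first by apply/andP; split; move: T0 T00 T0T {h T0E} => T0; lra.
  have e : v - G / (N%:R / 2 + 1) = (G - G / (N%:R / 2 + 1)) * Z.
    by rewrite /Z; field; rewrite !gt_eqF//; lra.
  by rewrite e mulfK ?gt_eqF// addrC subrK.
(* The starting value [a = 20 / (pi e eps)] corresponds to [rho = eps/5], that is, to volume [G]. *)
apply: meas; apply: (volume_phase_power N2 k0 solP (rhom := eps / 5)) => //.
- by apply/andP; split; lra.
- by rewrite divr_gt0// !mulr_gt0.
- by rewrite divr_ge0 ?mulr_ge0 ?(ltW k0) ?(ltW p0) ?(ltW E0)//; lra.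
- rewrite le_eqVlt; apply/orP; left; apply/eqP.
  by move: (@pi R) p0 (expR 1 : R) E0 => p pp E EE; field; rewrite !gt_eqF.
- by lra.
- have /andP[E52 _] := @expR1_bounds R.
  have half : 2 / (N%:R * expR 1) <= 2^-1 :> R.
    rewrite ler_pdivrMr ?mulr_gt0//.
    by have := ler_wpM2l (ltW n0) E52; lra.
  have c0 : 0 <= 2 * kappa * (1 - eps / 5) * (4 / (pi * expR 1)).
    by rewrite !mulr_ge0 ?invr_ge0 ?mulr_ge0 ?(ltW k0) ?(ltW p0) ?(ltW E0)//; lra.
  rewrite (_ : 4 * kappa * _ / _ = 2 * kappa * (1 - eps / 5) * (4 / (pi * expR 1)) * 2^-1).
    by rewrite ler_wpM2l//; lra.
  by move: (@pi R) p0 (expR 1 : R) E0 => p pp E EE; field; rewrite !gt_eqF.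
apply: le_trans start _.
rewrite -small_order_bound_powR ?divr_gt0 ?mulr_gt0// /G.
rewrite (_ : 4 / _ / _ = eps / 5)//.
by move: (@pi R) p0 (expR 1 : R) E0 => p pp E EE; field; rewrite !gt_eqF.
Qed.

End Assembly.

(** * Second estimate: bounded oscillation *)

Section BoundedOscillation.
Context {R : realType} {N : nat}.
Implicit Types (omega : 'I_N -> R) (kappa T : R) (sol : ('I_N -> R) -> R -> 'I_N -> R).

(** The power phase has slope [8 kappa / (pi e)] times [(1 - rhom) (1 - 2 / (N e))]; the bound [3/8]
    yields the stated [3 kappa / (pi e)]. *)
Lemma bounded_osc_volume omega kappa sol (b eta T a rhom c s : R) :
  (2 <= N)%N -> 0 < kappa -> (forall x, is_solution omega kappa x (sol x)) -> 0 < T -> 0 < eta ->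
  0 < a -> 4 / (pi * expR 1) / a <= rhom -> rhom <= 1 -> b <= 1 - rhom ->
  3 / 8 <= (1 - rhom) * (1 - 2 / (N%:R * expR 1)) ->
  0 < s -> 0 < c < 1 -> s ^+ 2 + c ^+ 2 <= 1 -> 1 - c <= b - eta ->
  normOmega omega < kappa * (b - eta - (1 - c)) * s ->
  volume sol b eta T T <= a `^ (- (N%:R / 2)) ->
  ((1 - (a + 3 * kappa * T / (pi * expR 1)) `^ (- (N%:R / 2)))%:E
     <= norm_meas (bounded_osc_set T sol))%E.
Proof.
move=> N2 k0 solP T0 eta0 a0 cm m1 bm rate s0 c01 sc bc kW Vv; have N0 : (0 < N)%N := ltnW N2.
have p0 := @pi_gt0 R; have E0 := expR_gt0 (1 : R).
apply: (norm_meas_lower_bound N0 (ltW k0) solP (b := b) eta0 (ltW T0)).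
  move=> x t0 xc /andP[_ t0T] Rt; split => //.
  exact: (bounded_oscillation_of_crossing (solP x) N0 k0 s0 c01 sc bc kW Rt t0T).
rewrite (_ : 3 * kappa * T / _ = 3 * kappa / (pi * expR 1) * T); last by ring.
apply: (volume_phase_power N2 k0 solP (rhom := rhom)) => //.
- by rewrite lexx (ltW T0).
- by rewrite divr_ge0 ?mulr_ge0 ?(ltW k0) ?(ltW p0) ?(ltW E0).
have pE : 0 <= 8 * kappa / (pi * expR 1) by rewrite divr_ge0 ?mulr_ge0 ?(ltW k0) ?(ltW p0) ?(ltW E0).
have := ler_wpM2l pE rate.
by move: ((pi * expR 1)^-1 : R) (2 / (_ * _) : R) => q d; lra.
Qed.

Lemma half_le_one_sub : (2 <= N)%N -> 3 / 5 <= 1 - 2 / (N%:R * expR 1) :> R.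
Proof.
move=> N2; have n2 : 2 <= N%:R :> R by rewrite ler_nat.
have /andP[E52 _] := @expR1_bounds R.
have : 2 / (N%:R * expR 1) <= 2 / 5 :> R.
  rewrite ler_pdivrMr ?mulr_gt0 ?expR_gt0//; last by rewrite ltr0n ltnW.
  by have : 2 * (5 / 2) <= N%:R * expR 1 :> R; [apply: ler_pM; lra|lra].
by lra.
Qed.

Lemma bounded_osc_lower_bound omega kappa T sol : (2 <= N)%N -> 0 < kappa ->
  (forall x, is_solution omega kappa x (sol x)) -> kappa > 8 * normOmega omega -> 0 < T ->
    ((if normOmega omega == 0 then 1
      else if kappa <= 16 * Num.sqrt 2 * normOmega omega then
        1 - (expR (2^-1) + 3 * kappa * T / (pi * expR 1)) `^ (- (N%:R / 2))
      else
        1 - (4 / (pi * expR 1) *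
               (kappa / (2 * Num.sqrt 2 * normOmega omega)) `^ (2 / 3) +
             3 * kappa * T / (pi * expR 1)) `^ (- (N%:R / 2)))%:E
     <= norm_meas (bounded_osc_set T sol))%E.
Proof.
move=> N2 k0 solP kW Tpos; have N0 : (0 < N)%N := ltnW N2.
have p0 := @pi_gt0 R; have E0 := expR_gt0 (1 : R); have W0 := normOmega_ge0 omega.
have TT : 0 <= T <= T by rewrite lexx (ltW Tpos).
have d35 := half_le_one_sub N2.
case: ifPn => [/eqP Wz|Wn].
  apply: norm_meas_no_bad_point => // x xc; split => //.
  exact: (bounded_oscillation_no_frequency T (solP x) k0 Wz).
have Wp : 0 < normOmega omega by rewrite lt_neqAle eq_sym Wn.
case: ifPn => [_|].
  have eta0 : 0 < (1 / 100 : R) by lra.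
  (* [b = 1/2] gives the Hoeffding bound [e^(-N/4)], which is [a^(-N/2)] for [a = e^(1/2)].
     [rhom = 3/8] gives [5/8 * 3/5 = 3/8], and [(3/5, 4/5)] lies on the unit circle, with
     [kappa (49/100 - 1/5) 3/5] above [kappa / 8]. *)
  apply: (bounded_osc_volume (b := 1 - 2^-1) (eta := 1 / 100) (rhom := 3 / 8) (c := 4 / 5) (s := 3 / 5)) => //.
  - have /andP[E52 _] := @expR1_bounds R; have p14 := @pi_ge14_5 R.
    have h : 13 / 8 <= expR (2^-1) :> R.
      by apply: le_trans (expR_ge_quadratic _); [|rewrite invr_ge0]; lra.
    rewrite -mulrA -invfM ler_pdivrMr ?mulr_gt0 ?expR_gt0//.
    have h1 : 14 / 5 * (5 / 2) <= pi * expR 1 :> R by apply: ler_pM; lra.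
    have : 14 / 5 * (5 / 2) * (13 / 8) <= pi * expR 1 * expR (2^-1) :> R by apply: ler_pM => //; lra.
    by lra.
  - by lra.
  - by lra.
  - by lra.
  - by lra.
  - by lra.
  - by lra.
  - by lra.
  apply: le_trans (volume_le_hoeffding N0 (ltW k0) solP _ eta0 TT) _; first by lra.
  rewrite powRE ?expR_gt0// expRK ler_expR le_eqVlt; apply/orP; left; apply/eqP.
  by field.
rewrite -ltNge => kW2.
set W := normOmega omega in kW Wn Wp W0 kW2 *.
have s2 : Num.sqrt 2 ^+ 2 = 2 :> R by rewrite sqr_sqrtr.
have s2p : 0 < Num.sqrt 2 :> R by rewrite sqrtr_gt0.
set y := kappa / (2 * Num.sqrt 2 * W).
have y0 : 0 < y by rewrite divr_gt0// !mulr_gt0.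
have yW : y * (2 * Num.sqrt 2 * W) = kappa by rewrite divfK// gt_eqF// !mulr_gt0.
(* This [rho] satisfies [kappa^2 rho^3 = 8 W^2]: the drift left by a trap at a level of order [rho],
   with sine of order [sqrt rho], is then comparable with the frequencies. *)
have [rho [r0 rE]] : exists rho, 0 < rho /\ y `^ (2 / 3) = rho^-1.
  by exists (y `^ (2 / 3))^-1; rewrite invrK invr_gt0 powR_gt0.
have r3 : kappa ^+ 2 * rho ^+ 3 = 8 * W ^+ 2.
  have : (y `^ (2 / 3)) ^+ 3 = y ^+ 2.
    rewrite powRE// -expRM_natl (_ : 3%:R * _ = 2%:R * ln y); last by field.
    by rewrite expRM_natl lnK.
  rewrite rE exprVn => e.
  have -> : kappa ^+ 2 = rho ^- 3 * (8 * W ^+ 2).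
    by rewrite e -yW !exprMn s2; ring.
  by field; rewrite gt_eqF.
(* The condition [kappa > 16 sqrt 2 W] guarantees [rho <= 1/4], so that [b = rho] and [rhom = 1/4]
   are admissible. *)
have r4 : rho <= 4^-1.
  rewrite -(@ler_pXn2r _ 3)// ?nnegrE ?(ltW r0)//.
  have k2 : (16 * Num.sqrt 2 * W) ^+ 2 <= kappa ^+ 2.
    by rewrite lerXn2r ?nnegrE ?(ltW k0) ?(ltW kW2)// !mulr_ge0.
  have kk : 0 < kappa ^+ 2 by rewrite exprn_gt0.
  rewrite -(ler_pM2l kk) r3; move: k2; rewrite !exprMn s2; lra.
have sr : Num.sqrt (rho / 2) ^+ 2 = rho / 2 by rewrite sqr_sqrtr// divr_ge0// ltW.
have srp : 0 < Num.sqrt (rho / 2) by rewrite sqrtr_gt0 divr_gt0.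
have E1 : 4 / (pi * expR 1) / (4 / (pi * expR 1) / rho) = rho.
  by move: (@pi R) p0 (expR 1 : R) E0 => p pp E EE; field; rewrite !gt_eqF.
have a0 : 0 < 4 / (pi * expR 1) / rho by rewrite !divr_gt0 ?mulr_gt0.
have eta0 : 0 < rho / 10 by lra.
rewrite rE; apply: (bounded_osc_volume (b := rho) (eta := rho / 10) (rhom := 4^-1)
  (c := 1 - 3 * rho / 10) (s := Num.sqrt (rho / 2))) => //.
- by rewrite E1.
- by lra.
- by lra.
- by lra.
- by apply/andP; split; lra.
- by rewrite sr; nra.
- by lra.
(* Starting from [9 rho/10] the trap keeps [6 rho/10]; the square of the drift is
   [9/50 kappa^2 rho^3 = 36/25 W^2]. *)
- have W2 : W ^+ 2 < (kappa * (rho - rho / 10 - (1 - (1 - 3 * rho / 10))) * Num.sqrt (rho / 2)) ^+ 2.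
    rewrite !exprMn sr.
    have -> : kappa ^+ 2 * (rho - rho / 10 - (1 - (1 - 3 * rho / 10))) ^+ 2 * (rho / 2) =
        9 / 50 * (kappa ^+ 2 * rho ^+ 3) by field.
    have Wq : 0 < W ^+ 2 by rewrite exprn_gt0.
    by rewrite r3; lra.
  move: W2; rewrite ltr_pXn2r// nnegrE// mulr_ge0 ?(ltW srp)// mulr_ge0 ?(ltW k0)//; lra.
rewrite -small_order_bound_powR// E1.
exact: (volume_le_small N0 (ltW k0) solP r0 eta0 TT).
Qed.

End BoundedOscillation.

Unset Implicit Arguments. Set Strict Implicit.

Theorem theorem1p7 (R : realType) (N : nat) (omega : 'I_N -> R) (kappa eps : R)
  (sol : ('I_N -> R) -> R -> 'I_N -> R) :
  (2 <= N)%N -> 0 < kappa -> 0 < eps <= 1 ->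
  kappa > (2 + eps) * normOmega omega ->
  (forall x, is_solution omega kappa x (sol x)) ->
  let T0 := 25 / (kappa * N%:R * eps * (5 - eps)) *
      ln ((1 + 2 / N%:R) *
          (2 * Num.sqrt 5 / (Num.sqrt (pi * eps) * expR (2^-1 + eps ^+ 2 / 25))) ^+ N
          - 2 / N%:R) in
  (forall T : R, 0 < T ->
    ((if T <= T0 then
        1 - (N%:R / 2 + 1)^-1 * (Num.sqrt (pi * expR 1 * eps) / (2 * Num.sqrt 5)) ^+ N
              * (1 - expR (- (kappa * N%:R * eps * (5 - eps) * T / 25)))
          - expR (- (N%:R * eps ^+ 2 / 25) - kappa * N%:R * eps * (5 - eps) * T / 25)
      else
        1 - (20 / (pi * expR 1 * eps) +
             4 * kappa * (5 - eps) / (5 * pi * expR 1) * (T - T0)) `^ (- (N%:R / 2)))%:E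
     <= norm_meas (good_set omega kappa eps T sol))%E) /\
  (kappa > 8 * normOmega omega ->
   forall T : R, 0 < T ->
    ((if normOmega omega == 0 then 1
      else if kappa <= 16 * Num.sqrt 2 * normOmega omega then
        1 - (expR (2^-1) + 3 * kappa * T / (pi * expR 1)) `^ (- (N%:R / 2))
      else
        1 - (4 / (pi * expR 1) *
               (kappa / (2 * Num.sqrt 2 * normOmega omega)) `^ (2 / 3) +
             3 * kappa * T / (pi * expR 1)) `^ (- (N%:R / 2)))%:E
     <= norm_meas (bounded_osc_set T sol))%E).
Proof.
move=> N2 k0 e01 kW solP T0; split=> [T Tpos|kW8 T Tpos].
  exact: (good_set_lower_bound N2 k0 e01 kW solP Tpos).
exact: bounded_osc_lower_bound.
Qed.
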